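(* There is a universal constant $C>0$ such that for all $d\ge1$ and all $T\geq 110d^2$, the algorithm Schrödinger's-BISONS (defined in the context) run with $B=\frac{264}{5}d^2\log(T)$, $\eta=\frac{1}{4B}$, $\beta=\frac{11d}{7B}$ satisfies, for every sequence $R_1,\dots,R_T\in\mathcal{A}$, $$\max_{U\in\mathcal{A}}\sum_{t=1}^T\big(f_t(X_t)-f_t(U)\big)\leq C\,d^3\log^2(T).$$
   Context: Quantum learning with log loss: $\mathcal{A}$ is the set of $d\times d$ complex Hermitian positive semidefinite matrices of trace $1$; $\langle X,Y\rangle=\mathrm{Tr}(XY)$; $\preceq$ is the Loewner order. In each round $t=1,\dots,T$ the learner plays $X_t\in\mathcal{A}$, then observes $R_t\in\mathcal{A}$ (arbitrary) and suffers $f_t(X_t)$ where $f_t(X)=-\log(\langle X,R_t\rangle)$. Gradients: $\nabla f_t(X)=-R_t/\langle X,R_t\rangle$. Regularizer: $R(X)=-\log\det(X)$. For a Hermitian matrix $M$, $(M)_+$ denotes its positive part (negative eigenvalues set to $0$). Schrödinger's-BISONS with inputs $T,B,\eta,\beta$ operates in epochs, the first starting at round $1$. Within an epoch there is an internal time $\tau=1,2,\dots$, and all quantities below are started afresh in each epoch. Set $P_0=d\,\mathbf{I}_d$, $X_1=U_1=\arg\min_{X\in\mathcal{A}}R(X)=\frac1d\mathbf{I}_d$, and for all $\tau\ge1$ $$P_\tau=P_{\tau-1}+X_\tau^{-1/2}\big(\mathbf{I}_d-X_\tau^{1/2}P_{\tau-1}X_\tau^{1/2}\big)_+X_\tau^{-1/2}$$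 (so $P_1=d\,\mathbf{I}_d$). In the global round $t$ corresponding to internal time $\tau$ the algorithm plays $X_t=X_\tau$, receives $f_\tau:=f_t$, and forms $$\hat f_\tau(X)=f_\tau(X_\tau)+\langle X-X_\tau,\nabla f_\tau(X_\tau)\rangle+\tfrac\beta2\langle X-X_\tau,\nabla f_\tau(X_\tau)\rangle^2,\qquad g_\tau(X)=\hat f_\tau(X)-B\langle X,P_\tau-P_{\tau-1}\rangle.$$ It then computes $$X_{\tau+1}=\arg\min_{X\in\mathcal{A}}\sum_{s=1}^\tau g_s(X)+\eta^{-1}R(X),\qquad U_{\tau+1}=\arg\min_{X\in\mathcal{A}}\sum_{s=1}^\tau\hat f_s(X)+\eta^{-1}R(X),$$ and $P_{\tau+1}$. If $U_{\tau+1}\not\prec\frac{1}{2(1+6\eta)\beta}P_{\tau+1}^{-1}$ (the reset condition, checked at internal time $\tau$), the epoch ends with round $t$ and a new epoch starts in round $t+1$; otherwise $\tau$ is increased by one and the epoch continues. *)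

(* Defs.v *)
From HB Require Import structures.
From mathcomp Require Import all_boot all_order all_algebra.
From mathcomp Require Import complex.
From mathcomp Require Import all_classical all_reals all_analysis.

Set Implicit Arguments.
Unset Strict Implicit.
Unset Printing Implicit Defensive.

Import Order.TTheory GRing.Theory Num.Theory.

Local Open Scope classical_set_scope.
Local Open Scope ring_scope.
Local Open Scope complex_scope.
Local Open Scope sesquilinear_scope.

Section HermitianMatrices.
Context {R : realType} {d : nat}.
Implicit Types A X Y : 'M[R[i]]_d.

(* In the order of R[i], 0 <= z says that z is real and nonnegative. *)
Definition psdmx A : Prop :=
  A \is hermsymmx /\ forall v : 'cV[R[i]]_d, 0 <= (v^t* *m A *m v) 0 0.

Definition pdmx A : Prop :=
  A \is hermsymmx /\
  forall v : 'cV[R[i]]_d, v != 0 -> 0 < (v^t* *m A *m v) 0 0.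

(* Strict Loewner order. *)
Definition loewner_lt X Y : Prop := pdmx (Y - X).

Definition density : set 'M[R[i]]_d := [set X | psdmx X /\ \tr X = 1].

(* Tr(XY) is real when X and Y are Hermitian. *)
Definition inner X Y : R := complex.Re (\tr (X *m Y)).

(* Spectral calculus: apply g to the eigenvalues of a normal matrix A, using
   A = invmx (spectralmx A) *m diag_mx (spectral_diag A) *m spectralmx A. *)
Definition spectral_map (g : R[i] -> R[i]) A : 'M[R[i]]_d :=
  invmx (spectralmx A) *m diag_mx (map_mx g (spectral_diag A)) *m spectralmx A.

Definition sqrtmx : 'M[R[i]]_d -> 'M[R[i]]_d := spectral_map sqrtC.

Definition invsqrtmx : 'M[R[i]]_d -> 'M[R[i]]_d :=
  spectral_map (fun x => (sqrtC x)^-1).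

Definition pospartmx : 'M[R[i]]_d -> 'M[R[i]]_d :=
  spectral_map (fun x => if 0 <= x then x else 0).

End HermitianMatrices.

Arguments density {R} d.

Section LogLoss.
Context {R : realType} {d : nat}.
Implicit Types X Y Xt Rt P Pprev : 'M[R[i]]_d.

(* Extended-real valued: lne 0 = -oo, so the loss is +oo where <X, Rt> = 0. *)
Definition loss Rt X : \bar R := (- lne (inner X Rt)%:E)%E.

Definition grad_loss Rt X : 'M[R[i]]_d := (- (inner X Rt)^-1)%:C *: Rt.

(* Equal to +oo at singular X. *)
Definition logdet_reg X : \bar R := (- lne (complex.Re (\det X))%:E)%E.

Definition argmin (K : set 'M[R[i]]_d) (F : 'M[R[i]]_d -> \bar R) :
    'M[R[i]]_d :=
  xget 0 [set X | K X /\ forall Y, K Y -> (F X <= F Y)%E].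

(* The surrogate built from the loss of Rt at the point Xt, as a function of X. *)
Definition surrogate (beta : R) Xt Rt : 'M[R[i]]_d -> \bar R := fun X =>
  (loss Rt Xt + (inner (X - Xt) (grad_loss Rt Xt)
     + beta / 2 * inner (X - Xt) (grad_loss Rt Xt) ^+ 2)%:E)%E.

Definition biased_surrogate (B beta : R) Xt Rt Pprev P :
    'M[R[i]]_d -> \bar R := fun X =>
  (surrogate beta Xt Rt X - (B * inner X (P - Pprev))%:E)%E.

Definition ftrl (eta : R) (fs : seq ('M[R[i]]_d -> \bar R)) : 'M[R[i]]_d :=
  argmin (density d)
    (fun X => (\sum_(f <- fs) f X + (eta^-1)%:E * logdet_reg X)%E).

(* P_tau as a function of P_(tau-1) and X_tau. *)
Definition update_P Pprev X : 'M[R[i]]_d :=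
  Pprev + invsqrtmx X
            *m pospartmx (1%:M - sqrtmx X *m Pprev *m sqrtmx X)
            *m invsqrtmx X.

End LogLoss.

Section Bisons.
Context {R : realType} (d : nat) (B eta beta : R).

(* State at the beginning of internal time tau of the current epoch. *)
Record bisons_state := BisonsState {
  st_fhats : seq ('M[R[i]]_d -> \bar R) ; (* \hat f_s for 1 <= s < tau *)
  st_gs    : seq ('M[R[i]]_d -> \bar R) ; (* g_s for 1 <= s < tau *)
  st_X     : 'M[R[i]]_d ;                 (* X_tau *)
  st_U     : 'M[R[i]]_d ;                 (* U_tau *)
  st_Pprev : 'M[R[i]]_d ;                 (* P_(tau-1) *)
  st_P     : 'M[R[i]]_d                   (* P_tau *)
}.

Definition epoch_start : bisons_state :=
  let X1 := argmin (density d) logdet_reg in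
  let P0 := d%:R%:M in
  BisonsState [::] [::] X1 X1 P0 (update_P P0 X1).

Definition no_reset (U P : 'M[R[i]]_d) : Prop :=
  loewner_lt U ((2 * (1 + 6 * eta) * beta)^-1%:C *: invmx P).

Definition bisons_step (s : bisons_state) (Rt : 'M[R[i]]_d) : bisons_state :=
  let fhats := rcons (st_fhats s) (surrogate beta (st_X s) Rt) in
  let gs := rcons (st_gs s)
              (biased_surrogate B beta (st_X s) Rt (st_Pprev s) (st_P s)) in
  let X' := ftrl eta gs in
  let U' := ftrl eta fhats in
  let P' := update_P (st_P s) X' in
  if `[< no_reset U' P' >] then BisonsState fhats gs X' U' (st_P s) P'
  else epoch_start.

(* State after the first n rounds; round t receives Rs t, with t >= 1. *)
Fixpoint bisons_after (Rs : nat -> 'M[R[i]]_d) (n : nat) : bisons_state :=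
  if n is n'.+1 then bisons_step (bisons_after Rs n') (Rs n) else epoch_start.

(* The point played in round t >= 1; it depends on Rs 1, ..., Rs (t-1) only. *)
Definition bisons_play (Rs : nat -> 'M[R[i]]_d) (t : nat) : 'M[R[i]]_d :=
  st_X (bisons_after Rs t.-1).

End Bisons.

(* Takes values in \bar R: the regret against U is -oo when <U, Rs t> = 0 for
   some t, provided that every <Xs t, Rs t> is positive, as is the case when
   the Xs t are positive definite. *)
Definition regret (R : realType) (d T : nat) (Rs Xs : nat -> 'M[R[i]]_d)
    (U : 'M[R[i]]_d) : \bar R :=
  (\sum_(1 <= t < T.+1) (loss (Rs t) (Xs t) - loss (Rs t) U))%E.

(* Main.v *)
(** While no reset occurs, U_t lies below a multiple of P_t^-1, and P_t^-1 <= X_s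
    for every s <= t, so each ratio <U_t, R_s> / <X_s, R_s> is at most about
    1/(2 beta); one further FTRL step keeps it below 3/(5 beta).  In that range
    the tangent at the minimizer U_(k+1) of the surrogates lies below the true
    losses, so the regret of an epoch against any positive definite W is at most
    (log det X_1 - log det W) / eta plus what the stability of the biased FTRL
    iterates costs.

    The FTRL stability of X_t splits into a gradient part, paid for by the
    growth of log det (I + const * sum of vec G vec G^* ) over vectorized
    gradients G, and a bias part, paid for by the growth of log det P.  The
    inductive invariant is that the P-update at X_(t+1) is no larger than the
    step from X_t to X_(t+1), both in the local norm of log det.

    Comparing with U_(k+1) leaves the negative term -B (<U_(k+1), P_k> - d).  It
    is never positive, and when the reset condition fires it exceeds in size the
    total of all the other terms, which is at most 8 B d log T.  So finished
    epochs have nonpositive regret, whatever their number, and only the last one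
    counts.  W is (1 - 1/T) U + I/(dT), which costs O(1) over T rounds. *)

Require Import Defs.
From HB Require Import structures.
From mathcomp Require Import all_boot all_order all_algebra.
From mathcomp Require Import complex ring lra.
From mathcomp Require Import all_classical all_reals all_analysis.

Set Implicit Arguments.
Unset Strict Implicit.
Unset Printing Implicit Defensive.

Import Order.TTheory GRing.Theory Num.Theory.
Import numFieldNormedType.Exports.

Local Open Scope classical_set_scope.
Local Open Scope ring_scope.
Local Open Scope complex_scope.
Local Open Scope sesquilinear_scope.

(** * Hermitian matrices *)

Section Adjoint.
Context {R : realType}.
Local Notation C := (Num.ClosedField.sort (R[i] : numClosedFieldType)).

(** Nothing bounds the gradients [R_s / <X_s, R_s>] in advance; the bound comes from the absence of
    a reset. Inverting [U_k < c P_k^-1] gives [P_k <= c U_k^-1], and the first-order condition of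
    [U_k] bounds [<U_k^-1, Y>] linearly in the number of rounds, because the slope of each surrogate
    that matters there is at most [(1 + beta)^2 / (4 beta)]. So [P_k], every [X_s^-1] below it and
    every [1 / <X_s, R_s>] are polynomial in [T], and only their logarithms are paid: [d log T] for
    log det [P], [d^2 log T] for the vectorized gradients. The latter carries the factor
    [1 / (2 beta)], of order [d log T], which puts it on the scale of [B d log T]. The value
    [B eta = 1 / 4] is what lets the invariant on steps and biases reproduce itself with a fixed
    constant. Matrix inequalities are reduced to scalar ones by congruences that make two Hermitian
    matrices diagonal at once. Infinite values occur only where minimizers are identified and where
    the comparator has infinite loss; all else uses real logarithms at positive definite points. *)

Lemma adjM m n p (A : 'M[C]_(m, n)) (B : 'M[C]_(n, p)) :
  (A *m B)^t* = B^t* *m A^t*.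
Proof. by rewrite trmx_mul map_mxM. Qed.

Lemma adjD m n (A B : 'M[C]_(m, n)) : (A + B)^t* = A^t* + B^t*.
Proof. by apply/matrixP => i j; rewrite !mxE rmorphD. Qed.

Lemma adjN m n (A : 'M[C]_(m, n)) : (- A)^t* = - A^t*.
Proof. by apply/matrixP => i j; rewrite !mxE rmorphN. Qed.

Lemma adjZ m n (a : R) (A : 'M[C]_(m, n)) : (a%:C *: A)^t* = a%:C *: A^t*.
Proof.
by apply/matrixP => i j; rewrite !mxE rmorphM /=; congr (_ * _); exact: conjc_real.
Qed.

Lemma adj1 n : (1%:M : 'M[C]_n)^t* = 1%:M.
Proof. by apply/matrixP => i j; rewrite !mxE eq_sym conjC_nat. Qed.

Lemma hermP n (A : 'M[C]_n) : A \is hermsymmx <-> A^t* = A.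
Proof.
split=> [/is_hermitianmxP|h]; first by rewrite expr0 scale1r => <-.
by apply/is_hermitianmxP; rewrite expr0 scale1r h.
Qed.

Lemma adj_gram m n (A : 'M[C]_(m, n)) : (A^t* *m A)^t* = A^t* *m A.
Proof. by rewrite adjM trmxCK. Qed.

Lemma Re_sum (I : Type) (r : seq I) (P : pred I) (F : I -> C) :
  complex.Re (\sum_(i <- r | P i) F i) = \sum_(i <- r | P i) complex.Re (F i).
Proof. exact: (raddf_sum (@complex.Re R : Rcomplex R -> R)). Qed.

Lemma ReD (x y : C) : complex.Re (x + y) = complex.Re x + complex.Re y.
Proof. by case: x; case: y. Qed.

Lemma ReN (x : C) : complex.Re (- x) = - complex.Re x.
Proof. by case: x. Qed.

Lemma ReMl (a : R) (x : C) : complex.Re (a%:C * x) = a * complex.Re x.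
Proof. by case: x => u v /=; rewrite mul0r subr0. Qed.

Lemma Re_conj (x : C) : complex.Re (x^*) = complex.Re x.
Proof. by case: x. Qed.

Lemma Re_conjM (x : C) :
  complex.Re (x^* * x) = complex.Re x ^+ 2 + complex.Im x ^+ 2.
Proof. by case: x => u v /=; rewrite mulNr opprK !expr2. Qed.

Lemma real_Re (x : C) : x^* = x -> x = (complex.Re x)%:C.
Proof. by case: x => u v /= [] hv; congr (_ +i* _); lra. Qed.

Lemma tr_adj n (A : 'M[C]_n) : \tr (A^t*) = (\tr A)^*.
Proof. by rewrite rmorph_sum; apply: eq_bigr => i _; rewrite !mxE. Qed.

Lemma det_adj n (A : 'M[C]_n) : \det (A^t*) = (\det A)^*.
Proof. by rewrite (det_map_mx (@Num.conj _)) det_tr. Qed.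

Lemma innerC n (A B : 'M[C]_n) : inner A B = inner B A.
Proof. by rewrite /inner mxtrace_mulC. Qed.

Lemma innerDl n (A B G : 'M[C]_n) : inner (A + B) G = inner A G + inner B G.
Proof. by rewrite /inner mulmxDl raddfD /= ReD. Qed.

Lemma innerNl n (A G : 'M[C]_n) : inner (- A) G = - inner A G.
Proof. by rewrite /inner mulNmx raddfN /= ReN. Qed.

Lemma innerBl n (A B G : 'M[C]_n) : inner (A - B) G = inner A G - inner B G.
Proof. by rewrite innerDl innerNl. Qed.

Lemma innerZl n (a : R) (A G : 'M[C]_n) : inner (a%:C *: A) G = a * inner A G.
Proof. by rewrite /inner -scalemxAl mxtraceZ ReMl. Qed.

Lemma inner0l n (G : 'M[C]_n) : inner 0 G = 0.
Proof. by rewrite /inner mul0mx mxtrace0. Qed.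

Lemma innerDr n (A B G : 'M[C]_n) : inner G (A + B) = inner G A + inner G B.
Proof. by rewrite innerC innerDl ![inner _ G]innerC. Qed.

Lemma innerNr n (A G : 'M[C]_n) : inner G (- A) = - inner G A.
Proof. by rewrite innerC innerNl innerC. Qed.

Lemma innerBr n (A B G : 'M[C]_n) : inner G (A - B) = inner G A - inner G B.
Proof. by rewrite innerDr innerNr. Qed.

Lemma innerZr n (a : R) (A G : 'M[C]_n) : inner G (a%:C *: A) = a * inner G A.
Proof. by rewrite innerC innerZl innerC. Qed.

Lemma inner0r n (G : 'M[C]_n) : inner G 0 = 0.
Proof. by rewrite innerC inner0l. Qed.

Lemma inner_sumr n (I : Type) (r : seq I) (P : pred I) (F : I -> 'M[C]_n) G :
  inner G (\sum_(i <- r | P i) F i) = \sum_(i <- r | P i) inner G (F i).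
Proof.
by apply: big_morph => [A B|]; rewrite (innerDr, inner0r).
Qed.

Lemma inner_cong n (S A G : 'M[C]_n) :
  inner (S^t* *m A *m S) G = inner A (S *m G *m S^t*).
Proof. by rewrite /inner -!mulmxA mxtrace_mulC !mulmxA. Qed.

Definition rdiag n (a : 'I_n -> R) : 'M[C]_n :=
  diag_mx (\row_i (a i)%:C).

Lemma rdiagE n (a : 'I_n -> R) i j : rdiag a i j = (a i)%:C *+ (i == j).
Proof. by rewrite !mxE; case: eqP => // ->. Qed.

Lemma adj_rdiag n (a : 'I_n -> R) : (rdiag a)^t* = rdiag a.
Proof.
apply/matrixP => i j; rewrite mxE mxE !rdiagE eq_sym.
by case: eqP => [->|_]; rewrite ?mulr1n ?mulr0n ?conjC0 //; exact: conjc_real.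
Qed.

Lemma rdiagM n (a b : 'I_n -> R) :
  rdiag a *m rdiag b = rdiag (fun i => a i * b i).
Proof.
rewrite /rdiag mulmx_diag; congr diag_mx; apply/rowP => i.
by rewrite !mxE -rmorphM.
Qed.

Lemma rdiagD n (a b : 'I_n -> R) :
  rdiag a + rdiag b = rdiag (fun i => a i + b i).
Proof.
apply/matrixP => i j; rewrite mxE !rdiagE.
by case: eqP => _; rewrite ?mulr1n ?mulr0n ?addr0 // -rmorphD.
Qed.

Lemma rdiagZ n (c : R) (a : 'I_n -> R) :
  c%:C *: rdiag a = rdiag (fun i => c * a i).
Proof.
apply/matrixP => i j; rewrite mxE !rdiagE.
by case: eqP => _; rewrite ?mulr1n ?mulr0n ?mulr0 // -rmorphM.
Qed.

Lemma rdiag1 n : rdiag (fun _ : 'I_n => 1) = 1%:M.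
Proof. by apply/matrixP => i j; rewrite rdiagE mxE rmorph1. Qed.

Lemma eq_rdiag n (a b : 'I_n -> R) : a =1 b -> rdiag a = rdiag b.
Proof. by move=> h; congr diag_mx; apply/rowP => i; rewrite !mxE h. Qed.

Lemma det_rdiag n (a : 'I_n -> R) : \det (rdiag a) = (\prod_i a i)%:C.
Proof.
by rewrite det_diag rmorph_prod; apply: eq_bigr => i _; rewrite mxE.
Qed.

Lemma tr_rdiag n (a : 'I_n -> R) : \tr (rdiag a) = (\sum_i a i)%:C.
Proof.
by rewrite mxtrace_diag rmorph_sum; apply: eq_bigr => i _; rewrite mxE.
Qed.

Lemma inner_rdiag n (a : 'I_n -> R) (G : 'M[C]_n) :
  inner (rdiag a) G = \sum_i a i * complex.Re (G i i).
Proof.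
rewrite /inner /rdiag mul_diag_mx Re_sum; apply: eq_bigr => i _.
by rewrite !mxE ReMl.
Qed.

Definition qform n (A : 'M[C]_n) (v : 'cV[C]_n) : R :=
  complex.Re ((v^t* *m A *m v) 0 0).

Lemma qform_real n (A : 'M[C]_n) v : A^t* = A ->
  (v^t* *m A *m v) 0 0 = (qform A v)%:C.
Proof.
move=> hA; apply: real_Re.
have : ((v^t* *m A *m v)^t*) 0 0 = (v^t* *m A *m v) 0 0.
  by rewrite !adjM trmxCK hA mulmxA.
by rewrite mxE mxE.
Qed.

Lemma psdP n (A : 'M[C]_n) :
  psdmx A <-> A^t* = A /\ forall v, 0 <= qform A v.
Proof.
rewrite /psdmx hermP; split=> -[hA h]; split=> // v; move: (h v).
  by rewrite qform_real // ler0c.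
by rewrite qform_real // ler0c.
Qed.

Lemma pdP n (A : 'M[C]_n) :
  pdmx A <-> A^t* = A /\ forall v, v != 0 -> 0 < qform A v.
Proof.
rewrite /pdmx hermP; split=> -[hA h]; split=> // v /(h v);
  by rewrite qform_real // ltcR.
Qed.

Lemma pd_psd n (A : 'M[C]_n) : pdmx A -> psdmx A.
Proof.
move=> /pdP[hA h]; apply/psdP; split=> // v.
have [->|/h/ltW//] := eqVneq v 0; by rewrite /qform mulmx0 mxE.
Qed.

Lemma qform_inner n (A : 'M[C]_n) v : qform A v = inner A (v *m v^t*).
Proof.
by rewrite /inner mulmxA mxtrace_mulC mulmxA /mxtrace big_ord1.
Qed.

Lemma qform_cong n (S A : 'M[C]_n) v :
  qform (S^t* *m A *m S) v = qform A (S *m v).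
Proof. by rewrite /qform adjM !mulmxA. Qed.

Lemma qformD n (A B : 'M[C]_n) v : qform (A + B) v = qform A v + qform B v.
Proof. by rewrite !qform_inner innerDl. Qed.
Lemma qformB n (A B : 'M[C]_n) v : qform (A - B) v = qform A v - qform B v.
Proof. by rewrite !qform_inner innerBl. Qed.
Lemma qformZ n a (A : 'M[C]_n) v : qform (a%:C *: A) v = a * qform A v.
Proof. by rewrite !qform_inner innerZl. Qed.

Definition sqmod (x : C) : R := complex.Re x ^+ 2 + complex.Im x ^+ 2.

Lemma sqmod_ge0 x : 0 <= sqmod x.
Proof. by rewrite addr_ge0 // sqr_ge0. Qed.

Lemma sqmod_eq0 x : (sqmod x == 0) = (x == 0).
Proof.
by case: x => u v; rewrite /sqmod /= paddr_eq0 ?sqr_ge0 // !sqrf_eq0 eq_complex.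
Qed.

Lemma sqmodE x : x^* * x = (sqmod x)%:C.
Proof.
case: x => u v; rewrite /sqmod /=; apply/eqP; rewrite eq_complex /=.
by apply/andP; split; apply/eqP; ring.
Qed.

Lemma qform_rdiag n (a : 'I_n -> R) v :
  qform (rdiag a) v = \sum_i a i * sqmod (v i 0).
Proof.
rewrite qform_inner inner_rdiag; apply: eq_bigr => i _; congr (_ * _).
by rewrite !mxE big_ord1 !mxE mulrC sqmodE.
Qed.

Lemma qform1 n v : qform (1%:M : 'M[C]_n) v = \sum_i sqmod (v i 0).
Proof. by rewrite -rdiag1 qform_rdiag; apply: eq_bigr => i _; rewrite mul1r. Qed.

Lemma qform_gram_ge0 m n (V : 'M[C]_(m, n)) v : 0 <= qform (V^t* *m V) v.
Proof.
have -> : qform (V^t* *m V) v = qform 1%:M (V *m v).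
  by rewrite /qform adjM mulmx1 !mulmxA.
by rewrite qform1 sumr_ge0 // => i _; rewrite sqmod_ge0.
Qed.

Lemma psd_gram m n (V : 'M[C]_(m, n)) : psdmx (V^t* *m V).
Proof. by apply/psdP; split; [exact: adj_gram|move=> v; exact: qform_gram_ge0]. Qed.

End Adjoint.

Local Opaque psdmx pdmx.

(** * Simultaneous diagonalization by congruence *)

Section Congruence.
Context {R : realType} {n : nat}.
Local Notation C := (Num.ClosedField.sort (R[i] : numClosedFieldType)).
Implicit Types (S W A B G X H : 'M[C]_n) (a b mu : 'I_n -> R).

Lemma eq_frame S a b : a =1 b -> S^t* *m rdiag a *m S = S^t* *m rdiag b *m S.
Proof. by move=> /eq_rdiag ->. Qed.

Lemma rdiagB a b : rdiag a - rdiag b = rdiag (fun i => a i - b i).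
Proof.
have -> : - rdiag b = (-1)%:C *: rdiag b by rewrite rmorphN1 scaleN1r.
by rewrite rdiagZ rdiagD; apply: eq_rdiag => i; rewrite mulN1r.
Qed.

Lemma frame_sub S a b : S^t* *m rdiag a *m S - S^t* *m rdiag b *m S =
  S^t* *m rdiag (fun i => a i - b i) *m S.
Proof.
by rewrite -mulmxBl -mulmxBr rdiagB.
Qed.

Lemma frame_scale S a (c : R) : c%:C *: (S^t* *m rdiag a *m S) =
  S^t* *m rdiag (fun i => c * a i) *m S.
Proof. by rewrite scalemxAl scalemxAr rdiagZ. Qed.

Lemma adj_unit S : (S^t* \in unitmx) = (S \in unitmx).
Proof. by rewrite !unitmxE det_adj !unitfE conjC_eq0. Qed.

Lemma adj_inv S : (invmx S)^t* = invmx (S^t*).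
Proof. by rewrite trmx_inv map_invmx. Qed.

Lemma mulmx_unit_eq0 S (v : 'cV[C]_n) : S \in unitmx -> (S *m v == 0) = (v == 0).
Proof.
move=> uS; apply/eqP/eqP => [h|->]; last exact: mulmx0.
by rewrite -[v](mulKmx uS) h mulmx0.
Qed.

Lemma herm_spectral A : A^t* = A ->
  exists W, exists a, W *m W^t* = 1%:M /\ A = W^t* *m rdiag a *m W.
Proof.
move=> /hermP hA; exists (spectralmx A).
have uW : spectralmx A \is @unitarymx C n n by exact: spectral_unitarymx.
exists (fun i => complex.Re (spectral_diag A 0 i)); split; first exact/unitarymxP.
rewrite -(invmx_unitary uW).
rewrite {1}(orthomx_spectralP (hermitian_normalmx hA)); congr (_ *m _ *m _).
congr diag_mx; apply/rowP => i; rewrite mxE.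
have /mxOverP/(_ 0 i) := hermitian_spectral_diag_real hA.
by move=> /complex_realP[k ->].
Qed.

Lemma unitary_adjK W : W *m W^t* = 1%:M -> W^t* *m W = 1%:M.
Proof. exact: mulmx1C. Qed.

Lemma unitary_unit W : W *m W^t* = 1%:M -> W \in unitmx.
Proof. by move=> /mulmx1_unit[]. Qed.

Lemma qform_delta a i (e := delta_mx i 0 : 'cV[C]_n) :
  qform (rdiag a) e = a i.
Proof.
rewrite qform_rdiag (bigD1 i) //= big1 => [|j ji].
  by rewrite mxE !eqxx /sqmod /= expr0n expr1n !addr0 mulr1.
by rewrite mxE (negPf ji) /sqmod /= expr0n addr0 mulr0.
Qed.

Lemma delta_neq0 i : (delta_mx i 0 : 'cV[C]_n) != 0.
Proof.
by apply/eqP => /matrixP/(_ i 0); rewrite !mxE !eqxx => /eqP; rewrite oner_eq0.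
Qed.

Lemma adj_cong S A : A^t* = A -> (S^t* *m A *m S)^t* = S^t* *m A *m S.
Proof. by move=> hA; rewrite !adjM trmxCK hA mulmxA. Qed.

Lemma pd_cong S a : S \in unitmx ->
  pdmx (S^t* *m rdiag a *m S) <-> forall i, 0 < a i.
Proof.
move=> uS; split=> [/pdP[_ h] i|h].
  have := h (invmx S *m delta_mx i 0).
  rewrite mulmx_unit_eq0 ?unitmx_inv // delta_neq0 => /(_ isT).
  by rewrite qform_cong mulKVmx // qform_delta.
apply/pdP; split=> [|v v0]; first by rewrite adj_cong // adj_rdiag.
rewrite qform_cong qform_rdiag.
have : S *m v != 0 by rewrite mulmx_unit_eq0.
move: (S *m v) => w w0.
have [i wi] : exists i, w i 0 != 0.
  apply/existsP; apply: contraNT w0; rewrite negb_exists => /forallP h0.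
  apply/eqP/matrixP => i j; rewrite ord1 mxE; apply/eqP.
  by rewrite -[_ == _]negbK.
rewrite (bigD1 i) //= ltr_pwDl //.
  by rewrite mulr_gt0 // lt_neqAle sqmod_ge0 eq_sym sqmod_eq0 wi.
by rewrite sumr_ge0 // => j _; rewrite mulr_ge0 ?sqmod_ge0 // ltW.
Qed.

Lemma psd_cong S a : S \in unitmx ->
  psdmx (S^t* *m rdiag a *m S) <-> forall i, 0 <= a i.
Proof.
move=> uS; split=> [/psdP[_ h] i|h].
  have := h (invmx S *m delta_mx i 0).
  by rewrite qform_cong mulKVmx // qform_delta.
apply/psdP; split=> [|v]; first by rewrite adj_cong // adj_rdiag.
rewrite qform_cong qform_rdiag sumr_ge0 // => i _.
by rewrite mulr_ge0 ?sqmod_ge0.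
Qed.

Lemma unit_gram S : S \in unitmx -> S^t* *m S \in unitmx.
Proof. by move=> uS; rewrite unitmx_mul adj_unit uS. Qed.

(** Diagonalize [X] to get [X = S0^* S0], then diagonalize [H] transported to that frame; the second
    unitary leaves [S0^* S0] unchanged. Order, determinants and pairings with [X^-1] can then be
    read off the numbers [mu i]. *)
Lemma simdiag X H : pdmx X -> H^t* = H ->
  exists S, exists mu,
    [/\ S \in unitmx, X = S^t* *m S & H = S^t* *m rdiag mu *m S].
Proof.
move=> pX hH.
have [hX _] := (pdP X).1 pX.
have [W [x [uW eX]]] := herm_spectral hX.
have uWu := unitary_unit uW.
have x0 i : 0 < x i by move: pX; rewrite eX pd_cong.
pose S0 := rdiag (fun i => Num.sqrt (x i)) *m W.
have uS0 : S0 \in unitmx.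
  rewrite unitmx_mul uWu andbT unitmxE det_rdiag unitfE.
  apply/eqP => -[] /eqP; rewrite prodf_seq_eq0 => /hasP[i _] /=.
  by rewrite sqrtr_eq0 leNgt x0.
have eX0 : X = S0^t* *m S0.
  rewrite /S0 adjM adj_rdiag eX -!mulmxA; congr (_ *m _); rewrite !mulmxA.
  rewrite rdiagM; congr (_ *m _); apply: eq_rdiag => i.
  by rewrite -expr2 sqr_sqrtr // ltW.
clearbody S0.
have uT : S0^t* \in unitmx by rewrite adj_unit.
pose H' := invmx (S0^t*) *m H *m invmx S0.
have hH' : H'^t* = H'.
  by rewrite /H' !adjM !adj_inv trmxCK hH mulmxA.
have [V [mu [uV eH']]] := herm_spectral hH'.
exists (V *m S0), mu; split.
- by rewrite unitmx_mul uS0 unitary_unit.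
- by rewrite adjM -mulmxA (mulmxA (V^t*)) unitary_adjK // mul1mx.
- rewrite adjM.
  have -> : H = S0^t* *m H' *m S0.
    by rewrite /H' !mulmxA mulmxV // mul1mx mulmxKV.
  by rewrite eH' !mulmxA.
Qed.

Lemma psd_factor A : psdmx A -> exists V : 'M[C]_n, A = V^t* *m V.
Proof.
move=> pA.
have [hA _] := (psdP A).1 pA.
have [W [x [uW eA]]] := herm_spectral hA.
have uWu := unitary_unit uW.
have x0 i : 0 <= x i by move: pA; rewrite eA psd_cong.
exists (rdiag (fun i => Num.sqrt (x i)) *m W).
rewrite adjM adj_rdiag eA -!mulmxA; congr (_ *m _); rewrite !mulmxA.
rewrite rdiagM; congr (_ *m _); apply: eq_rdiag => i.
by rewrite -expr2 sqr_sqrtr.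
Qed.

Lemma psd_conj S A : psdmx A -> psdmx (S *m A *m S^t*).
Proof.
move=> /psd_factor[V ->].
have -> : S *m (V^t* *m V) *m S^t* = (V *m S^t*)^t* *m (V *m S^t*).
  by rewrite adjM trmxCK !mulmxA.
exact: psd_gram.
Qed.

Lemma psd_diag A i : psdmx A -> 0 <= complex.Re (A i i).
Proof.
move=> /psdP[_ /(_ (delta_mx i 0))]; rewrite qform_inner innerC /inner.
have -> : delta_mx i 0 *m (delta_mx i 0 : 'cV[C]_n)^t* = rdiag (fun j => (j == i)%:R).
  apply/matrixP => j k; rewrite !mxE big_ord1 !mxE eqxx !andbT.
  rewrite conjC_nat; have [->|nji] := eqVneq j k.
    by case: eqP => _; rewrite ?mulr1 ?mulr0 ?rmorph1.
  rewrite mulr0n; have [ji|_] := eqVneq j i; last by rewrite mul0r.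
  by rewrite ji eq_sym in nji; rewrite (negPf nji) mulr0.
rewrite -/(inner _ _) inner_rdiag (bigD1 i) //= eqxx mul1r big1 ?addr0 //.
by move=> j /negPf ->; rewrite mul0r.
Qed.

(** With [B = V^* V] the pairing is the trace of [V A V^*], whose diagonal entries are
    nonnegative. *)
Lemma inner_psd_ge0 A B : psdmx A -> psdmx B -> 0 <= inner A B.
Proof.
move=> pA /psd_factor[V ->].
have -> : inner A (V^t* *m V) = inner 1%:M (V *m A *m V^t*).
  by rewrite innerC -inner_cong mulmx1.
rewrite -rdiag1 inner_rdiag sumr_ge0 // => i _.
by rewrite mul1r; apply: psd_diag; exact: psd_conj.
Qed.

Lemma inner_le A B G : psdmx (B - A) -> psdmx G -> inner A G <= inner B G.
Proof. by move=> pAB pG; rewrite -subr_ge0 -innerBl inner_psd_ge0. Qed.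

Lemma inner_diag_cong S a G :
  inner (S^t* *m rdiag a *m S) G = \sum_i a i * complex.Re ((S *m G *m S^t*) i i).
Proof. by rewrite inner_cong inner_rdiag. Qed.

Lemma gram_rdiag S : S^t* *m S = S^t* *m rdiag (fun _ => 1) *m S.
Proof. by rewrite rdiag1 mulmx1. Qed.

Lemma inv_diag_cong S a : S \in unitmx -> (forall i, a i != 0) ->
  invmx (S^t* *m rdiag a *m S) =
  (invmx (S^t*))^t* *m rdiag (fun i => (a i)^-1) *m invmx (S^t*).
Proof.
move=> uS a0; have uT : S^t* \in unitmx by rewrite adj_unit.
rewrite adj_inv trmxCK.
have e : (S^t* *m rdiag a *m S) *m
    (invmx S *m rdiag (fun i => (a i)^-1) *m invmx (S^t*)) = 1%:M.
  rewrite -!mulmxA mulKVmx // (mulmxA (rdiag a)) rdiagM.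
  rewrite (@eq_rdiag _ _ _ (fun _ => 1)) ?rdiag1 ?mul1mx ?mulmxV //.
  by move=> i; rewrite divff.
have [u1 u2] := mulmx1_unit e.
by rewrite -[LHS]mulmx1 -e mulKmx.
Qed.

Lemma inv_gram S : S \in unitmx ->
  invmx (S^t* *m S) = (invmx (S^t*))^t* *m invmx (S^t*).
Proof.
move=> uS; rewrite gram_rdiag inv_diag_cong ?oner_neq0 //.
  by rewrite gram_rdiag; congr (_ *m _ *m _); apply: eq_rdiag => i; rewrite invr1.
Qed.

Lemma cong_inv_gram S : S \in unitmx -> S *m invmx (S^t* *m S) *m S^t* = 1%:M.
Proof.
move=> uS; have uT : S^t* \in unitmx by rewrite adj_unit.
by rewrite inv_gram // adj_inv trmxCK !mulmxA mulmxV // mul1mx mulVmx.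
Qed.

Definition ld A : R := ln (complex.Re (\det A)).

Lemma det_diag_cong S a : complex.Re (\det (S^t* *m rdiag a *m S)) =
  sqmod (\det S) * \prod_i a i.
Proof.
rewrite !det_mulmx det_adj det_rdiag mulrAC.
by rewrite (sqmodE (\det S)) -rmorphM.
Qed.

Lemma sqmod_det_gt0 S : S \in unitmx -> 0 < sqmod (\det S).
Proof.
rewrite unitmxE unitfE => h.
by rewrite lt_neqAle sqmod_ge0 eq_sym sqmod_eq0 h.
Qed.

Lemma ln_prod (I : finType) (F : I -> R) : (forall i, 0 < F i) ->
  ln (\prod_i F i) = \sum_i ln (F i).
Proof.
move=> h; suff: 0 < \prod_i F i /\ ln (\prod_i F i) = \sum_i ln (F i) by case.
elim/big_ind2 : _ => [|x y z t [x0 <-] [z0 <-]|i _]; rewrite ?ln1 ?lnM //.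
by rewrite mulr_gt0.
Qed.

Lemma ld_diag_cong S a : S \in unitmx -> (forall i, 0 < a i) ->
  ld (S^t* *m rdiag a *m S) = ln (sqmod (\det S)) + \sum_i ln (a i).
Proof.
move=> uS h; rewrite /ld det_diag_cong lnM ?ln_prod //.
  by rewrite posrE sqmod_det_gt0.
by rewrite posrE prodr_gt0.
Qed.

Lemma ld_gram S : S \in unitmx -> ld (S^t* *m S) = ln (sqmod (\det S)).
Proof.
move=> uS; rewrite gram_rdiag ld_diag_cong // big1 ?addr0 // => i _.
exact: ln1.
Qed.

Lemma diag_cong_add S mu (t : R) :
  S^t* *m S + t%:C *: (S^t* *m rdiag mu *m S) =
  S^t* *m rdiag (fun i => 1 + t * mu i) *m S.
Proof.
rewrite gram_rdiag frame_scale -mulmxDl -mulmxDr rdiagD.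
by [].
Qed.

Lemma pd_gram S : S \in unitmx -> pdmx (S^t* *m S).
Proof. by move=> uS; rewrite gram_rdiag pd_cong. Qed.

Lemma pd_unit X : pdmx X -> X \in unitmx.
Proof.
move=> pX; have [hX _] := (pdP X).1 pX.
by have [S [mu [uS -> _]]] := simdiag pX hX; exact: unit_gram.
Qed.

Lemma pd_det X : pdmx X -> 0 < complex.Re (\det X).
Proof.
move=> pX; have [hX _] := (pdP X).1 pX.
have [S [mu [uS -> _]]] := simdiag pX hX.
by rewrite gram_rdiag det_diag_cong mulr_gt0 ?sqmod_det_gt0 // prodr_gt0.
Qed.

Lemma pd_inv X : pdmx X -> pdmx (invmx X).
Proof.
move=> pX; have [hX _] := (pdP X).1 pX.
have [S [mu [uS -> _]]] := simdiag pX hX.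
by rewrite (inv_gram uS); apply: pd_gram; rewrite unitmx_inv adj_unit.
Qed.

Lemma pd_herm X : pdmx X -> X^t* = X. Proof. by move=> /pdP[]. Qed.
Lemma psd_herm X : psdmx X -> X^t* = X. Proof. by move=> /psdP[]. Qed.

Lemma psd_det_pd X : psdmx X -> 0 < complex.Re (\det X) -> pdmx X.
Proof.
move=> pX; have [hX _] := (psdP X).1 pX.
have [W [x [uW eX]]] := herm_spectral hX.
have uWu := unitary_unit uW.
have x0 i : 0 <= x i by move: pX; rewrite eX psd_cong.
rewrite {}eX in pX hX *; rewrite det_diag_cong pmulr_rgt0 ?sqmod_det_gt0 // => h.
apply/pd_cong => // i; rewrite lt_neqAle x0 andbT eq_sym.
by apply/eqP => xi; move: h; rewrite (bigD1 i) //= xi mul0r ltxx.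
Qed.

(** In a frame where [X] is the identity and [Y] is [diag (1 + mu)], this is [ln (1 + mu) <= mu] in
    each coordinate. *)
Lemma ld_concave X Y : pdmx X -> pdmx Y ->
  ld Y <= ld X + inner (invmx X) (Y - X).
Proof.
move=> pX pY; have hX := pd_herm pX; have hY := pd_herm pY.
have hH : (Y - X)^t* = Y - X by rewrite adjD adjN hX hY.
have [S [mu [uS eX eH]]] := simdiag pX hH.
have eY : Y = S^t* *m rdiag (fun i => 1 + mu i) *m S.
  rewrite -[Y](subrK X) eH eX -[X in X + _]scale1r addrC.
  have := diag_cong_add S mu 1; rewrite rmorph1 => ->.
  by apply: eq_frame => i; rewrite mul1r.
have mu0 i : 0 < 1 + mu i by move: pY; rewrite eY pd_cong.
rewrite eH innerC inner_diag_cong eX cong_inv_gram // {1}eY ld_diag_cong // ld_gram //.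
rewrite lerD2l ler_sum // => i _; rewrite mxE eqxx mulr1.
by rewrite le_ln1Dx // -subr_gt0 opprK addrC.
Qed.

End Congruence.

(** * The geometry of log det *)

Section LogInequalities.
Context {R : realType}.
Implicit Types x t : R.

Lemma ln_ge_divD t : -1 < t -> t / (1 + t) <= ln (1 + t).
Proof.
move=> h; have h0 : 0 < 1 + t by lra.
have : ln (1 + - (t / (1 + t))) <= - (t / (1 + t)).
  apply: le_ln1Dx; rewrite ltrN2 ltr_pdivrMr // mul1r; lra.
have -> : 1 + - (t / (1 + t)) = (1 + t)^-1 by field; rewrite gt_eqF.
by rewrite lnV ?posrE // lerN2.
Qed.

Lemma ln_mvt (f df : R -> R) (a b : R) :
  (forall x, 0 < x -> is_derive x 1 f (df x)) -> 0 < a -> a <= b ->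
  exists2 c, a <= c <= b & f b - f a = df c * (b - a).
Proof.
move=> h a0 ab.
have hc x : x \in `[a, b] -> derivable f x 1.
  rewrite in_itv /= => /andP[ax _]; have [] // := h x (lt_le_trans a0 ax).
have hd x : x \in `]a, b[ -> is_derive x 1 f (df x).
  by rewrite in_itv /= => /andP[ax _]; exact: h (lt_trans a0 ax).
have [c hx e] := MVT_segment ab hd (derivable_within_continuous hc).
by exists c.
Qed.

(** The function [2 ln x - x + 1 / x] vanishes at 1 and has derivative [- (1 - 1 / x)^2]. *)
Lemma ln_le_half x : 1 <= x -> ln x <= (x - x^-1) / 2.
Proof.
move=> x1.
pose f x : R := 2 * ln x - x + x^-1.
pose df x : R := - (1 - x^-1) ^+ 2.
have hd (y : R) : 0 < y -> is_derive y 1 f (df y).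
  move=> y0; have y00 : y != 0 by rewrite gt_eqF.
  have d1 := is_derive1_ln y0.
  have d2 := @is_deriveV R id y _ 1 y00 (is_derive_id _ _).
  apply: is_derive_eq; rewrite /df /GRing.scale /=.
  by field.
have [c _] := @ln_mvt f df 1 x hd ltr01 x1.
rewrite /f ln1 /df mulr0 sub0r invr1 => e.
have : - (1 - c^-1) ^+ 2 * (x - 1) <= 0.
  by rewrite mulNr oppr_le0 mulr_ge0 ?sqr_ge0 // subr_ge0.
rewrite -e; lra.
Qed.

Lemma ln_le_quad x : 0 < x -> x <= 1 -> ln x <= x - 1 - (x - 1) ^+ 2 / 2.
Proof.
move=> x0 x1.
pose f x : R := ln x - x + (x - 1) ^+ 2 / 2.
pose df x : R := (1 - x) ^+ 2 / x.
have hd (y : R) : 0 < y -> is_derive y 1 f (df y).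
  move=> y0; have y00 : y != 0 by rewrite gt_eqF.
  have d1 := is_derive1_ln y0.
  apply: is_derive_eq; rewrite /df /GRing.scale /=.
  by field.
have [c /andP[xc _]] := @ln_mvt f df x 1 hd x0 x1.
rewrite /f ln1 /df => e.
have : 0 <= (1 - c) ^+ 2 / c * (1 - x).
  by rewrite mulr_ge0 ?divr_ge0 ?sqr_ge0 ?subr_ge0 // ltW // (lt_le_trans x0).
rewrite -e; lra.
Qed.

(** For [t >= 0] this is [ln_le_half] at [1 + t]; for [t < 0] even the undamped quadratic bound
    holds. The damped form suits vectors: [|t|] in the denominator can be enlarged to the Euclidean
    norm of all coordinates. *)
Lemma ln_le_dampened t : -1 < t -> ln (1 + t) <= t - t ^+ 2 / (2 * (1 + `|t|)).
Proof.
move=> ht; have [t0|t0] := leP 0 t.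
  have t1 : 1 + t != 0 by rewrite gt_eqF //; lra.
  have := @ln_le_half (1 + t); rewrite lerDl ger0_norm // => /(_ t0).
  move=> /le_trans; apply.
  suff -> : (1 + t - (1 + t)^-1) / 2 = t - t ^+ 2 / (2 * (1 + t)) by [].
  by field.
have := @ln_le_quad (1 + t); rewrite -ltrBlDl sub0r ht gerDl (ltW t0) => /(_ isT isT).
rewrite [1 + t - 1]addrC addKr => /le_trans; apply; rewrite lerB //.
rewrite ler_wpM2l ?sqr_ge0 // lef_pV2 ?posrE //; have := normr_ge0 t; lra.
Qed.

Lemma ln_ge_quad t : `|t| <= 1 / 2 -> t - 2 * t ^+ 2 <= ln (1 + t).
Proof.
rewrite ler_norml => /andP[h1 h2].
have h0 : 0 < 1 + t by lra.
apply: (le_trans _ (@ln_ge_divD t _)); last by lra.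
rewrite ler_pdivlMr //; have := sqr_ge0 t; nra.
Qed.

Lemma cauchy_schwarz (I : finType) (a b : I -> R) :
  (\sum_i a i * b i) ^+ 2 <= (\sum_i a i ^+ 2) * (\sum_i b i ^+ 2).
Proof.
have : 0 <= \sum_i \sum_j (a i * b j - a j * b i) ^+ 2.
  by do 2!apply: sumr_ge0 => ? _; rewrite sqr_ge0.
have -> : \sum_i \sum_j (a i * b j - a j * b i) ^+ 2 =
   \sum_i \sum_j (a i ^+ 2 * b j ^+ 2) + \sum_i \sum_j (a j ^+ 2 * b i ^+ 2)
   - 2 * \sum_i \sum_j ((a i * b i) * (a j * b j)).
  rewrite mulr_sumr -big_split -sumrB; apply: eq_bigr => i _ /=.
  rewrite mulr_sumr -big_split -sumrB; apply: eq_bigr => j _ /=; ring.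
have -> : \sum_i \sum_j (a j ^+ 2 * b i ^+ 2) = \sum_i \sum_j (a i ^+ 2 * b j ^+ 2).
  exact: exchange_big.
rewrite !big_distrlr /= expr2 big_distrlr /=; lra.
Qed.

Lemma sum_sqr_le_sqr_sum (I : finType) (a : I -> R) : (forall i, 0 <= a i) ->
  \sum_i a i ^+ 2 <= (\sum_i a i) ^+ 2.
Proof.
move=> h; rewrite expr2 big_distrlr /=; apply: ler_sum => i _.
rewrite (bigD1 i) //= expr2 lerDl sumr_ge0 // => j _; exact: mulr_ge0.
Qed.

Lemma le_sqrt_sum (I : finType) (a : I -> R) i :
  `|a i| <= Num.sqrt (\sum_i a i ^+ 2).
Proof.
rewrite -sqrtr_sqr; apply: ler_wsqrtr; rewrite (bigD1 i) //= lerDl.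
by rewrite sumr_ge0 // => j _; rewrite sqr_ge0.
Qed.

End LogInequalities.

(** * The local norm of log det *)

Section LocalNorm.
Context {R : realType} {n : nat}.
Local Notation C := (Num.ClosedField.sort (R[i] : numClosedFieldType)).
Implicit Types (S W A B G X Y H P M : 'M[C]_n) (a b mu : 'I_n -> R).

(* The squared norm of H in the Hessian of - log det at X. *)
Definition locsq X H : R := inner (invmx X *m H *m invmx X) H.

Lemma locsq_cong S mu : S \in unitmx ->
  locsq (S^t* *m S) (S^t* *m rdiag mu *m S) = \sum_i mu i ^+ 2.
Proof.
move=> uS; have uT : S^t* \in unitmx by rewrite adj_unit.
rewrite /locsq inv_gram // adj_inv trmxCK.
have -> : invmx S *m invmx (S^t*) *m (S^t* *m rdiag mu *m S)
    *m (invmx S *m invmx (S^t*)) = invmx S *m rdiag mu *m invmx (S^t*).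
  by rewrite !mulmxA (mulmxK uS) -(mulmxA (invmx S)) (mulVmx uT) mulmx1.
rewrite innerC inner_diag_cong; apply: eq_bigr => i _.
have -> : S *m (invmx S *m rdiag mu *m invmx (S^t*)) *m S^t* = rdiag mu.
  by rewrite !mulmxA mulmxV // mul1mx mulmxKV.
by rewrite rdiagE eqxx mulr1n expr2.
Qed.

Lemma locsq_ge0 X H : pdmx X -> H^t* = H -> 0 <= locsq X H.
Proof.
move=> pX hH; have [S [mu [uS -> ->]]] := simdiag pX hH.
by rewrite locsq_cong // sumr_ge0 // => i _; rewrite sqr_ge0.
Qed.

Lemma inner_inv_cong S mu : S \in unitmx ->
  inner (invmx (S^t* *m S)) (S^t* *m rdiag mu *m S) = \sum_i mu i.
Proof.
move=> uS; rewrite innerC inner_diag_cong cong_inv_gram //.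
by apply: eq_bigr => i _; rewrite mxE eqxx mulr1.
Qed.

Lemma gram_sub S mu (c : R) :
  c%:C *: (S^t* *m S) - S^t* *m rdiag mu *m S =
  S^t* *m rdiag (fun i => c - mu i) *m S.
Proof.
rewrite gram_rdiag frame_scale frame_sub.
by apply: eq_frame => i; rewrite mulr1.
Qed.

(** Each coordinate of [H] relative to [X] is at most the Euclidean norm of all of them. This turns
    the local norm of a step into a bound on the relative change of [<X, G>]. *)
Lemma loc_psd X H : pdmx X -> H^t* = H ->
  psdmx ((Num.sqrt (locsq X H))%:C *: X - H).
Proof.
move=> pX hH; have [S [mu [uS -> ->]]] := simdiag pX hH.
rewrite locsq_cong // gram_sub psd_cong // => i.
by rewrite subr_ge0 (le_trans (ler_norm _)) // le_sqrt_sum.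
Qed.

Lemma locsqN X H : locsq X (- H) = locsq X H.
Proof. by rewrite /locsq mulmxN mulNmx innerNl innerNr opprK. Qed.

Lemma inner_loc X H G : pdmx X -> H^t* = H -> psdmx G ->
  inner H G <= Num.sqrt (locsq X H) * inner X G.
Proof.
by move=> pX hH pG; rewrite -innerZl (inner_le (loc_psd pX hH) pG).
Qed.

Lemma frob_diag A : A^t* = A ->
  \sum_i complex.Re (A i i) ^+ 2 <= inner A A.
Proof.
move=> hA; rewrite /inner /mxtrace Re_sum ler_sum // => i _.
rewrite mxE Re_sum (bigD1 i) //=.
have h j : complex.Re (A i j * A j i) = sqmod (A j i).
  by rewrite -{1}hA !mxE; exact: Re_conjM.
rewrite h -[leLHS]addr0 lerD ?lerDl ?sqr_ge0 //.
by rewrite sumr_ge0 // => j _; rewrite h sqmod_ge0.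
Qed.

(** Cauchy-Schwarz between the local norm at [X] and its dual. In the frame of [X] and [H] only the
    diagonal of [S G S^*] meets [H], and its squares are part of a squared Frobenius norm that
    equals [<X G X, G>]. *)
Lemma inner_loc_dual X H G : pdmx X -> H^t* = H -> G^t* = G ->
  inner H G ^+ 2 <= locsq X H * inner (X *m G *m X) G.
Proof.
move=> pX hH hG; have [S [mu [uS -> ->]]] := simdiag pX hH.
rewrite locsq_cong // inner_diag_cong (le_trans (cauchy_schwarz _ _)) //.
rewrite ler_wpM2l ?sumr_ge0 // => [i _|]; first by rewrite sqr_ge0.
rewrite (le_trans (frob_diag _)) //.
  by rewrite !adjM trmxCK hG mulmxA.
by rewrite -inner_cong !mulmxA.
Qed.

Lemma Re_scaleB (c : R) A B i j : complex.Re ((c%:C *: A - B) i j) =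
  c * complex.Re (A i j) - complex.Re (B i j).
Proof. by rewrite !mxE ReD ReN ReMl. Qed.

Lemma Re_oppmx A i j : complex.Re ((- A) i j) = - complex.Re (A i j).
Proof. by rewrite !mxE ReN. Qed.

(** In an eigenbasis of [H], the bounds [H <= m X] and [- H <= m X] give [|h i| <= m * x i], where
    the [x i] are diagonal entries of [X], nonnegative with sum 1. This lets the curvature of log
    det pay for a Frobenius term. *)
Lemma inner_loc_frob X H : pdmx X -> \tr X = 1 -> H^t* = H ->
  inner H H <= locsq X H.
Proof.
move=> pX tX hH.
have [W [h [uW eH]]] := herm_spectral hH.
have hd A i : psdmx A -> 0 <= complex.Re ((W *m A *m W^t*) i i).
  by move=> pA; apply: psd_diag; apply: psd_conj.
have eW : W *m H *m W^t* = rdiag h.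
  by rewrite eH !mulmxA uW mul1mx -mulmxA uW mulmx1.
set m := Num.sqrt (locsq X H).
have l0 := locsq_ge0 pX hH.
have m0 : 0 <= m by exact: sqrtr_ge0.
pose x i := complex.Re ((W *m X *m W^t*) i i).
have x0 i : 0 <= x i by apply: hd; exact: pd_psd.
have key H' i : H'^t* = H' -> locsq X H' = locsq X H ->
    complex.Re ((W *m H' *m W^t*) i i) <= m * x i.
  move=> hH' el; have := loc_psd pX hH'; rewrite el => /(hd _ i).
  rewrite mulmxBr mulmxBl -scalemxAr -scalemxAl Re_scaleB.
  by rewrite subr_ge0.
have hx i : h i ^+ 2 <= m ^+ 2 * x i ^+ 2.
  have := key (- H) i; have := key H i; rewrite locsqN adjN hH.
  rewrite mulmxN mulNmx eW Re_oppmx rdiagE eqxx mulr1n /=.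
  move=> /(_ erefl erefl) + /(_ erefl erefl).
  rewrite -exprMn => k1 k2; rewrite -subr_ge0 subr_sqr mulr_ge0 //; lra.
have -> : inner H H = \sum_i h i ^+ 2.
  rewrite {1}eH inner_diag_cong; apply: eq_bigr => i _.
  by rewrite eW rdiagE eqxx mulr1n expr2.
apply: (le_trans (ler_sum _ (fun i _ => hx i))).
rewrite -mulr_sumr sqr_sqrtr // ler_piMr //.
apply: (le_trans (sum_sqr_le_sqr_sum x0)).
have -> : \sum_i x i = 1; last by rewrite expr1n.
rewrite /x -Re_sum -/(mxtrace _) mxtrace_mulC mulmxA unitary_adjK // mul1mx tX.
by [].
Qed.

Lemma pd_line X H mu S (t : R) : S \in unitmx -> X = S^t* *m S ->
  H = S^t* *m rdiag mu *m S ->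
  pdmx (X + t%:C *: H) <-> forall i, 0 < 1 + t * mu i.
Proof. by move=> uS -> ->; rewrite diag_cong_add pd_cong. Qed.

(** The gains of [ln_le_dampened] add up to [locsq] once each [|mu i|] in a denominator is replaced
    by the local norm. *)
Lemma ld_bregman X H : pdmx X -> H^t* = H -> pdmx (X + H) ->
  ld (X + H) <= ld X + inner (invmx X) H
     - locsq X H / (2 * (1 + Num.sqrt (locsq X H))).
Proof.
move=> pX hH pXH; have [S [mu [uS eX eH]]] := simdiag pX hH.
have e1 : X + H = X + 1%:C *: H by rewrite scale1r.
have mu0 i : 0 < 1 + mu i.
  by move: pXH; rewrite e1 (pd_line 1 uS eX eH) => /(_ i); rewrite mul1r.
rewrite e1 {1}eX {1}eH diag_cong_add ld_diag_cong //; last by move=> i; rewrite mul1r.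
rewrite eX eH locsq_cong // inner_inv_cong // ld_gram // -addrA lerD2l.
set m := Num.sqrt _; rewrite mulr_suml -sumrB; apply: ler_sum => i _.
rewrite mul1r (le_trans (ln_le_dampened _)) //; first by have := mu0 i; lra.
rewrite lerB // ler_wpM2l ?sqr_ge0 // lef_pV2 ?posrE ?mulr_gt0 //.
- by rewrite ler_pM2l // lerD2l le_sqrt_sum.
- by rewrite ltr_pwDl // sqrtr_ge0.
Qed.

(** A quadratic lower bound on a short segment, from which the first-order condition of a minimizer
    is extracted without differentiating a determinant. *)
Lemma ld_line_ge X H (t : R) : pdmx X -> H^t* = H ->
  0 < t -> t * Num.sqrt (locsq X H) <= 1 / 2 ->
  pdmx (X + t%:C *: H) /\
  ld X + t * inner (invmx X) H - 2 * t ^+ 2 * locsq X H <= ld (X + t%:C *: H).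
Proof.
move=> pX hH t0; have [S [mu [uS eX eH]]] := simdiag pX hH.
rewrite {1}eX {1}eH locsq_cong // => ht.
have tm i : `|t * mu i| <= 1 / 2.
  rewrite normrM gtr0_norm // (le_trans _ ht) // ler_pM2l //.
  exact: le_sqrt_sum.
have tm1 i : 0 < 1 + t * mu i by move: (tm i); rewrite ler_norml => /andP[]; lra.
split; first by rewrite (pd_line t uS eX eH).
rewrite {4}eX {3}eH diag_cong_add ld_diag_cong // eX eH locsq_cong //.
rewrite inner_inv_cong // ld_gram // -addrA lerD2l !mulr_sumr -sumrB.
apply: ler_sum => i _; rewrite (le_trans _ (ln_ge_quad (tm i))) //.
by lra.
Qed.

End LocalNorm.

(** * The update of P *)

Section UnitaryFrames.
Context {C : numClosedFieldType} {n : nat}.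
Implicit Types (A F P V W X Y s t : 'M[C]_n).

Lemma unitary_mul W A F : W *m W^t* = 1%:M ->
  W^t* *m A *m W *m (W^t* *m F *m W) = W^t* *m (A *m F) *m W.
Proof. by move=> uW; rewrite !mulmxA -(mulmxA _ W) uW mulmx1. Qed.

Lemma herm_compress P s : P^t* = P -> s^t* = s ->
  (1%:M - s *m P *m s)^t* = 1%:M - s *m P *m s.
Proof.
move=> hP hs; rewrite linearB /= map_mxB trmx1 map_mx1.
by rewrite !trmx_mul !map_mxM hs hP mulmxA.
Qed.

(** Here [s] and [t] stand for [X^(1/2)] and [X^(-1/2)]. Diagonalizing [1 - s P s] by [V] and
    pulling back by [V t] makes [X^-1] the identity and [P] equal to [1 - E] at once. *)
Lemma compress_frame s t P X V E : s^t* = s -> t^t* = t -> s *m t = 1%:M ->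
  s *m s = X -> V *m V^t* = 1%:M -> 1%:M - s *m P *m s = V^t* *m E *m V ->
  [/\ V *m t \in unitmx, invmx X = (V *m t)^t* *m (V *m t),
      P = (V *m t)^t* *m (1%:M - E) *m (V *m t) &
      forall F, t *m (V^t* *m F *m V) *m t = (V *m t)^t* *m F *m (V *m t)].
Proof.
move=> hs ht st ss uV eE; have ts := mulmx1C st; have uV' := mulmx1C uV.
have [us ut] := mulmx1_unit st; have [uVu _] := mulmx1_unit uV.
have eM : (V *m t)^t* = t *m V^t* by rewrite trmx_mul map_mxM ht.
split; rewrite ?eM.
- by rewrite unitmx_mul ut uVu.
- have e : X *m (t *m t) = 1%:M by rewrite -ss !mulmxA -(mulmxA s) st mulmx1.
  have [uX _] := mulmx1_unit e.
  by rewrite !mulmxA -(mulmxA t) uV' mulmx1 -[LHS]mulmx1 -e mulKmx.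
- have -> : t *m V^t* *m (1%:M - E) *m (V *m t) =
      t *m (1%:M - V^t* *m E *m V) *m t.
    by rewrite !mulmxBr !mulmxBl !mulmx1 !mulmxA -(mulmxA t (V^t*)) uV' mulmx1.
  rewrite -eE subKr !mulmxA ts mul1mx -mulmxA st mulmx1.
  by [].
- by move=> F; rewrite !mulmxA.
Qed.

(** Since [X (X^-1 - Y^-1) = - (X - Y) Y^-1], the change of the inverse, measured at [X], has
    exactly the size of the step measured at [Y]. *)
Lemma inv_diff_tr X Y : X \in unitmx -> Y \in unitmx ->
  \tr (X *m (invmx X - invmx Y) *m X *m (invmx X - invmx Y)) =
  \tr (invmx Y *m (X - Y) *m invmx Y *m (X - Y)).
Proof.
move=> uX uY.
have e : X *m (invmx X - invmx Y) = - ((X - Y) *m invmx Y).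
  by rewrite mulmxBr (mulmxV uX) mulmxBl (mulmxV uY) opprB.
rewrite -mulmxA e mulmxN mulNmx opprK -!mulmxA [RHS]mxtrace_mulC !mulmxA.
by [].
Qed.

End UnitaryFrames.

Section SpectralMaps.
Context {R : realType} {n : nat}.
Local Notation C := (Num.ClosedField.sort (R[i] : numClosedFieldType)).
Local Opaque rdiag mulmx invmx.
Implicit Types (S W T A B G K X Xo H P M N U Z : 'M[C]_n) (a b x mu : 'I_n -> R).

Lemma diag_mxE (v : 'rV[C]_n) a : (forall i, v 0 i = (a i)%:C) ->
  diag_mx v = rdiag a.
Proof.
by move=> h; apply/matrixP => i j; rewrite rdiagE mxE; case: eqP => // ->; rewrite h.
Qed.

Lemma spectral_map_herm A : A^t* = A -> exists W x,
  [/\ W *m W^t* = 1%:M, A = W^t* *m rdiag x *m W &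
    forall (g : C -> C) (h : R -> R),
      (forall i, g (x i)%:C = (h (x i))%:C) ->
      spectral_map g A = W^t* *m rdiag (fun i => h (x i)) *m W].
Proof.
move=> /hermP hA; exists (spectralmx A).
have uW : spectralmx A \is @unitarymx C n n by exact: spectral_unitarymx.
pose x i := complex.Re (spectral_diag A 0 i).
have ex i : spectral_diag A 0 i = (x i)%:C.
  have /mxOverP/(_ 0 i) := hermitian_spectral_diag_real hA.
  by rewrite /x => /complex_realP[k ->].
exists x; split; first exact/unitarymxP.
  rewrite -(invmx_unitary uW).
  by rewrite {1}(orthomx_spectralP (hermitian_normalmx hA)) (diag_mxE ex).
move=> g h gh; rewrite -(invmx_unitary uW) /spectral_map.
by rewrite (@diag_mxE _ (h \o x)) // => i; rewrite mxE ex gh.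
Qed.

Lemma sqrtC_real (r : R) : 0 <= r -> sqrtC (r%:C : C) = (Num.sqrt r)%:C.
Proof.
move=> r0; rewrite -{1}(sqr_sqrtr r0) rmorphXn /= sqrCK //.
by rewrite ler0c sqrtr_ge0.
Qed.

Lemma frame_id W a : W *m W^t* = 1%:M -> (forall i, a i = 1) ->
  W^t* *m rdiag a *m W = 1%:M.
Proof.
by move=> uW h; rewrite (eq_frame W (b := fun=> 1) h) rdiag1 mulmx1 unitary_adjK.
Qed.

Lemma adj_frame W a : (W^t* *m rdiag a *m W)^t* = W^t* *m rdiag a *m W.
Proof. by rewrite adj_cong // adj_rdiag. Qed.

Lemma frameM W a b : W *m W^t* = 1%:M ->
  W^t* *m rdiag a *m W *m (W^t* *m rdiag b *m W) =
  W^t* *m rdiag (fun i => a i * b i) *m W.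
Proof. by move=> uW; rewrite (unitary_mul _ _ uW) rdiagM. Qed.

Lemma sqrtmx_frame X : pdmx X -> exists s t : 'M[C]_n,
  [/\ sqrtmx X = s, invsqrtmx X = t, s^t* = s & t^t* = t] /\
  s *m t = 1%:M /\ s *m s = X.
Proof.
move=> pX; have hX := pd_herm pX.
have [W [x [uW eX gX]]] := spectral_map_herm hX.
have x0 i : 0 < x i by move: pX; rewrite eX pd_cong // (unitary_unit uW).
have sx0 i : Num.sqrt (x i) != 0 by rewrite gt_eqF // sqrtr_gt0.
have eS : sqrtmx X = W^t* *m rdiag (fun i => Num.sqrt (x i)) *m W.
  by apply: gX => i; rewrite sqrtC_real // ltW.
have eI : invsqrtmx X = W^t* *m rdiag (fun i => (Num.sqrt (x i))^-1) *m W.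
  apply: (gX _ (fun r => (Num.sqrt r)^-1)) => i.
  by rewrite sqrtC_real ?ltW // fmorphV.
exists (W^t* *m rdiag (fun i => Num.sqrt (x i)) *m W).
exists (W^t* *m rdiag (fun i => (Num.sqrt (x i))^-1) *m W).
split; first by split; [exact: eS|exact: eI|exact: adj_frame|exact: adj_frame].
rewrite (frameM _ _ uW) (frameM _ _ uW).
have d1 i : Num.sqrt (x i) * (Num.sqrt (x i))^-1 = 1 by rewrite divff.
rewrite (frame_id uW d1); split; first by [].
rewrite [RHS]eX; apply: eq_frame => i.
by rewrite -expr2 sqr_sqrtr // ltW.
Qed.

Lemma update_PE P X s t : sqrtmx X = s -> invsqrtmx X = t ->
  update_P P X = P + t *m pospartmx (1%:M - s *m P *m s) *m t.
Proof. by rewrite /update_P => -> ->. Qed.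

(** In a frame where [X^-1] is the identity and [P] is [diag a], the positive part raises [a] to 1
    exactly where it is smaller. The properties of the update are read off this form. *)
Lemma update_P_frame P X : pdmx X -> P^t* = P ->
  exists M a, [/\ M \in unitmx, invmx X = M^t* *m M, P = M^t* *m rdiag a *m M,
    update_P P X = M^t* *m rdiag (fun i => Num.max (a i) 1) *m M &
    update_P P X - P = M^t* *m rdiag (fun i => Num.max (a i) 1 - a i) *m M].
Proof.
move=> pX hP; have [s [t [[es et hs ht] [st ss]]]] := sqrtmx_frame pX.
rewrite (update_PE P es et); clear es et.
have hE := herm_compress hP hs.
have [V [e [uV eE gE]]] := spectral_map_herm hE.
have [uM iX eP eF] := compress_frame hs ht st ss uV eE.
have -> : pospartmx (1%:M - s *m P *m s) =
    V^t* *m rdiag (fun i => if 0 <= e i then e i else 0) *m V.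
  by apply: (gE _ (fun r => if 0 <= r then r else 0)) => i; rewrite ler0c; case: ifP.
have eP' : P = (V *m t)^t* *m rdiag (fun i => 1 - e i) *m (V *m t).
  by rewrite -rdiagB rdiag1; exact: eP.
exists (V *m t), (fun i => 1 - e i).
set Q := P + _; have eQ : Q = (V *m t)^t* *m
    rdiag (fun i => Num.max (1 - e i) 1) *m (V *m t); last first.
  by split; [exact: uM|exact: iX|exact: eP'|exact: eQ|rewrite eQ {1}eP'; exact: frame_sub].
rewrite /Q eF {1}eP' -mulmxDl -mulmxDr rdiagD; apply: eq_frame => i.
by case: leP => h; [rewrite max_r|rewrite max_l]; lra.
Qed.

Lemma psdD A B : psdmx A -> psdmx B -> psdmx (A + B).
Proof.
move=> /psdP[hA pA] /psdP[hB pB]; apply/psdP; split.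
  by rewrite adjD hA hB.
by move=> v; rewrite qformD addr_ge0.
Qed.

Lemma pd_psdD A B : pdmx A -> psdmx B -> pdmx (A + B).
Proof.
move=> /pdP[hA pA] /psdP[hB pB]; apply/pdP; split.
  by rewrite adjD hA hB.
by move=> v v0; rewrite qformD ltr_pwDl // pA.
Qed.

Lemma psdZ (c : R) A : 0 <= c -> psdmx A -> psdmx (c%:C *: A).
Proof.
move=> c0 /psdP[hA pA]; apply/psdP; split; first by rewrite adjZ hA.
by move=> v; rewrite qformZ mulr_ge0.
Qed.

Lemma psd_trans A B G : psdmx (B - A) -> psdmx (G - B) -> psdmx (G - A).
Proof. move=> h1 h2; have -> : G - A = (G - B) + (B - A) by rewrite addrA subrK.
exact: psdD. Qed.

Lemma inv_antitone A B : pdmx A -> psdmx (B - A) -> psdmx (invmx A - invmx B).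
Proof.
move=> pA pBA; have hH := psd_herm pBA.
have [S [mu [uS eA eH]]] := simdiag pA hH.
have mu0 i : 0 <= mu i by move: pBA; rewrite eH psd_cong.
have e1 : B = S^t* *m rdiag (fun i => 1 + mu i) *m S.
  rewrite -[B](subrK A) eH eA addrC -[X in _ + X]scale1r.
  have := diag_cong_add S mu 1; rewrite rmorph1 => ->.
  by apply: eq_frame => i; rewrite mul1r.
have mu1 i : 0 < 1 + mu i by rewrite ltr_pwDl.
have mu2 i : 1 + mu i != 0 by rewrite gt_eqF.
have uT : invmx (S^t* ) \in unitmx by rewrite unitmx_inv adj_unit.
rewrite e1 (inv_diag_cong uS mu2) eA (inv_gram uS) (gram_rdiag (invmx _)).
rewrite frame_sub; apply/(psd_cong _ uT) => i.
by rewrite subr_ge0 invf_le1 // lerDl.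
Qed.

Lemma sqr_one_sub_le (c e : R) : c <= e -> e <= 1 -> (1 - e) ^+ 2 <= (1 - c) ^+ 2.
Proof. by move=> ce e1; rewrite -subr_ge0 subr_sqr mulr_ge0 //; lra. Qed.

Lemma Re_subid A i : complex.Re ((1%:M - A) i i) = 1 - complex.Re (A i i).
Proof. by rewrite mxE ReD Re_oppmx mxE eqxx. Qed.

Lemma inner_conj_sq S G : inner (S *m G *m S^t*) (S *m G *m S^t*) =
  inner (S^t* *m S *m G *m (S^t* *m S)) G.
Proof. by rewrite -inner_cong !mulmxA. Qed.

Section UpdateP.
Variables (P X : 'M[C]_n).
Hypotheses (pX : pdmx X) (hP : P^t* = P).
Let D := update_P P X - P.

Let uiX : invmx (invmx X) = X. Proof. exact: invmxK. Qed.

Lemma update_P_ge : psdmx D.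
Proof.
have [M [a [uM eX eP eU eD]]] := update_P_frame pX hP.
rewrite /D eD; apply/(psd_cong _ uM) => i.
by rewrite subr_ge0 le_max lexx.
Qed.

Lemma update_P_ge_inv : psdmx (update_P P X - invmx X).
Proof.
have [M [a [uM eX eP eU eD]]] := update_P_frame pX hP.
rewrite eU eX gram_rdiag frame_sub; apply/(psd_cong _ uM) => i.
by rewrite subr_ge0 le_max lexx orbT.
Qed.

Lemma update_P_pd : pdmx P -> pdmx (update_P P X).
Proof.
move=> pP; rewrite -(subrK P (update_P P X)) addrC; apply: pd_psdD => //.
exact: update_P_ge.
Qed.

Lemma update_P_id : psdmx (P - invmx X) -> update_P P X = P.
Proof.
have [M [a [uM eX eP eU eD]]] := update_P_frame pX hP.
rewrite {1}eP eX gram_rdiag frame_sub psd_cong // => a1.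
rewrite eU [RHS]eP; apply: eq_frame => i.
by rewrite max_l // -subr_ge0.
Qed.

Lemma update_P_increment : exists delta : 'I_n -> R,
  [/\ forall i, 0 <= delta i, inner X D = \sum_i delta i &
      inner (X *m D *m X) D = \sum_i delta i ^+ 2].
Proof.
have [M [a [uM eX eP eU eD]]] := update_P_frame pX hP.
exists (fun i => Num.max (a i) 1 - a i).
split=> [i||]; first by rewrite subr_ge0 le_max lexx.
  by rewrite /D eD -[X in inner X]uiX eX (inner_inv_cong _ uM).
have -> : inner (X *m D *m X) D = locsq (invmx X) D by rewrite /locsq uiX.
by rewrite /D eD eX (locsq_cong _ uM).
Qed.

(** As [P >= 0], every increment [max (a i) 1 - a i] lies in [[0, 1]] and so dominates its
    square. *)
Lemma update_P_sq_le : psdmx P -> inner (X *m D *m X) D <= inner X D.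
Proof.
move=> pP; have [M [a [uM eX eP eU eD]]] := update_P_frame pX hP.
have a0 i : 0 <= a i by move: pP; rewrite eP psd_cong.
have -> : inner (X *m D *m X) D = locsq (invmx X) D by rewrite /locsq uiX.
have -> : inner X D = \sum_i (Num.max (a i) 1 - a i).
  by rewrite /D eD -[X in inner X]uiX eX (inner_inv_cong _ uM).
rewrite /D eD eX (locsq_cong _ uM); apply: ler_sum => i _.
rewrite expr2 ler_piMr //; first by rewrite subr_ge0 le_max lexx.
by have := a0 i; case: (leP (a i) 1) => *; lra.
Qed.

(** An entry [a] below 1 is raised to 1, and [1 - a <= - ln a]. Over an epoch the quantities
    [<X, D>] therefore telescope against log det [P]. *)
Lemma update_P_ld : pdmx P -> ld P + inner X D <= ld (update_P P X).
Proof.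
move=> pP; have [M [a [uM eX eP eU eD]]] := update_P_frame pX hP.
have a0 i : 0 < a i by move: pP; rewrite eP pd_cong.
have -> : inner X D = \sum_i (Num.max (a i) 1 - a i).
  by rewrite /D eD -[X in inner X]uiX eX (inner_inv_cong _ uM).
rewrite eU {1}eP !ld_diag_cong // => [|i]; last by rewrite lt_max ltr01 orbT.
rewrite -addrA lerD2l -big_split; apply: ler_sum => i _ /=.
case: (leP (a i) 1) => h; last lra.
rewrite ln1; have e : a i = 1 + (a i - 1) by ring.
have : ln (1 + (a i - 1)) <= a i - 1 by apply: le_ln1Dx; have := a0 i; lra.
rewrite -e; lra.
Qed.

(* In the frame where P is diag(a) and X^-1 is the identity, the step of P has
   entries (1 - a i)_+, while Xo^-1 <= P makes the i-th diagonal entry of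
   1 - Xo^-1 at least 1 - a i.  Comparing diagonal entries suffices. *)
Lemma update_P_sq_locsq Xo : pdmx Xo -> psdmx (P - invmx Xo) ->
  inner (X *m D *m X) D <= locsq Xo (X - Xo).
Proof.
move=> pXo pPX; have [M [a [uM eX eP eU eD]]] := update_P_frame pX hP.
have -> : inner (X *m D *m X) D = locsq (invmx X) D by rewrite /locsq uiX.
rewrite /D eD eX (locsq_cong _ uM).
have uMt : M^t* \in unitmx by rewrite adj_unit.
pose T := invmx (M^t*).
have Tt : T^t* = invmx M by rewrite /T adj_inv trmxCK.
have eT : T^t* *m T = X by rewrite -uiX eX inv_gram.
have TP : T *m P *m T^t* = rdiag a.
  by rewrite Tt eP /T !mulmxA mulVmx // mul1mx mulmxK.
have TX : T *m invmx X *m T^t* = 1%:M.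
  by rewrite Tt eX /T !mulmxA mulVmx // mul1mx mulmxV.
pose K := invmx X - invmx Xo.
pose N := T *m K *m T^t*.
have hK : K^t* = K.
  by rewrite /K adjD adjN (pd_herm (pd_inv pX)) (pd_herm (pd_inv pXo)).
have hN : N^t* = N by rewrite /N !adjM trmxCK hK mulmxA.
have -> : locsq Xo (X - Xo) = inner N N.
  rewrite /N inner_conj_sq eT /locsq /inner.
  by congr complex.Re; apply/esym/inv_diff_tr; exact: pd_unit.
apply: (le_trans _ (frob_diag hN)); apply: ler_sum => i _.
have NE : complex.Re (N i i) = 1 - complex.Re ((T *m invmx Xo *m T^t* : 'M[C]_n) i i).
  by rewrite /N /K mulmxBr mulmxBl TX Re_subid.
have : 0 <= complex.Re ((T *m (P - invmx Xo) *m T^t*) i i).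
  by apply: psd_diag; apply: psd_conj.
rewrite mulmxBr mulmxBl TP mxE ReD Re_oppmx rdiagE eqxx mulr1n /= => h.
rewrite NE; move: (complex.Re _) h => c h.
rewrite subr_ge0 in h.
case: (leP (a i) 1) => h2; last by rewrite subrr expr0n /= sqr_ge0.
exact: sqr_one_sub_le.
Qed.

(** An entry raised from [a] to 1 has [1 - a <= m], hence [a >= 1 - m]. This carries the reset
    condition, stated for the updated matrix, back to the matrix before the update. *)
Lemma update_P_le_scale (m : R) : 0 <= m -> m < 1 ->
  inner (X *m D *m X) D <= m ^+ 2 ->
  psdmx (P - (1 - m)%:C *: update_P P X).
Proof.
move=> m0 m1; have [M [a [uM eX eP eU eD]]] := update_P_frame pX hP.
have -> : inner (X *m D *m X) D = locsq (invmx X) D by rewrite /locsq uiX.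
rewrite /D eD eX (locsq_cong _ uM) => h.
rewrite eU frame_scale {1}eP frame_sub; apply/(psd_cong _ uM) => i.
have hi : Num.max (a i) 1 - a i <= m.
  have := le_sqrt_sum (fun i => Num.max (a i) 1 - a i) i.
  move=> /(le_trans (ler_norm _)) /le_trans; apply.
  by rewrite -(ger0_norm m0) -sqrtr_sqr ler_wsqrtr.
by move: hi; case: (leP (a i) 1) => h1 h2; nra.
Qed.

End UpdateP.

Lemma no_reset_inner (c : R) U P X G : pdmx P -> pdmx X ->
  psdmx (P - invmx X) -> loewner_lt U (c%:C *: invmx P) -> 0 <= c ->
  psdmx G -> inner U G <= c * inner X G.
Proof.
move=> pP pX pPX /pd_psd hU c0 pG; rewrite -innerZl.
apply: (le_trans (inner_le hU pG)); rewrite [leLHS]innerZl [leRHS]innerZl.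
have := inv_antitone (pd_inv pX) pPX; rewrite invmxK => h.
exact: (ler_wpM2l c0 (inner_le h pG)).
Qed.

(** The pairing [<U, P>] is the sum of the nonnegative eigenvalues of [U] relative to [P^-1]; if the
    sum is below [c], so is each of them. *)
Lemma reset_inner (c : R) U P : pdmx P -> psdmx U ->
  ~ loewner_lt U (c%:C *: invmx P) -> c <= inner U P.
Proof.
move=> pP pU h; rewrite leNgt; apply/negP => hc; apply: h.
have [S [mu [uS eP eU]]] := simdiag (pd_inv pP) (psd_herm pU).
have mu0 i : 0 <= mu i by move: pU; rewrite eU psd_cong.
rewrite /loewner_lt eP eU gram_sub pd_cong // => i.
rewrite subr_gt0 (le_lt_trans _ hc) // -[P in leRHS]invmxK eP innerC eU.
rewrite inner_inv_cong // (bigD1 i) //= lerDl.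
by rewrite sumr_ge0.
Qed.

Lemma psd_tr0 Z : psdmx Z -> \tr Z = 0 -> Z = 0.
Proof.
move=> pZ; have [W [z [uW eZ]]] := herm_spectral (psd_herm pZ).
have z0 i : 0 <= z i by move: pZ; rewrite eZ psd_cong // unitary_unit.
rewrite {1}eZ mxtrace_mulC mulmxA uW mul1mx tr_rdiag => -[] /eqP.
rewrite psumr_eq0 // => /allP hz.
rewrite eZ (@eq_rdiag _ _ _ (fun _ => 0)) => [|i].
  have -> : rdiag (fun _ : 'I_n => 0) = 0 :> 'M[C]_n.
    by apply/matrixP => i j; rewrite rdiagE mxE mul0rn.
  by rewrite mulmx0 mul0mx.
by apply/eqP/hz; rewrite mem_index_enum.
Qed.

Lemma inner_pd_gt0 X G : pdmx X -> density n G -> 0 < inner X G.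
Proof.
move=> pX [pG tG].
have [S [mu [uS eX eG]]] := simdiag (pd_inv pX) (psd_herm pG).
have mu0 i : 0 <= mu i by move: pG; rewrite eG psd_cong.
have eI : inner X G = \sum_i mu i by rewrite -[X]invmxK eX eG inner_inv_cong.
rewrite eI lt_neqAle (sumr_ge0 _ (fun i _ => mu0 i)) andbT.
apply/eqP => /esym/eqP; rewrite psumr_eq0 // => /allP hz.
have G0 : G = 0.
  rewrite eG (@eq_rdiag _ _ _ (fun _ => 0)) => [|i].
    have -> : rdiag (fun _ : 'I_n => 0) = 0 :> 'M[C]_n.
      by apply/matrixP => i j; rewrite rdiagE mxE mul0rn.
    by rewrite mulmx0 mul0mx.
  by apply/eqP/hz; rewrite mem_index_enum.
by move: tG; rewrite G0 mxtrace0 => /eqP; rewrite eq_sym oner_eq0.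
Qed.

End SpectralMaps.

(** * Existence of the minimizers *)

Section EntrywiseContinuity.
Context {R : realType} {T : topologicalType}.
Local Notation C := (Num.ClosedField.sort (R[i] : numClosedFieldType)).
Implicit Types (f g : T -> R) (F G : T -> C).

Lemma contD f g : continuous f -> continuous g -> continuous (fun x => f x + g x).
Proof. by move=> cf cg x; apply: cvgD; [exact: cf|exact: cg]. Qed.

Lemma contN f : continuous f -> continuous (fun x => - f x).
Proof. by move=> cf x; apply: cvgN; exact: cf. Qed.

Lemma contM f g : continuous f -> continuous g -> continuous (fun x => f x * g x).
Proof. by move=> cf cg x; apply: cvgM; [exact: cf|exact: cg]. Qed.

Lemma cont_cst (c : R) : continuous (fun _ : T => c).
Proof. by move=> x; exact: cvg_cst. Qed.

Lemma cont_sum (I : Type) (r : seq I) (f : I -> T -> R) :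
  (forall i, continuous (f i)) -> continuous (fun x => \sum_(i <- r) f i x).
Proof.
move=> h; elim: r => [|i r IH].
  by under eq_fun do rewrite big_nil; exact: cont_cst.
by under eq_fun do rewrite big_cons; exact: contD.
Qed.

(** Continuity is stated for the two real coordinates, so that only the topology of [R] is
    involved. *)
Definition ccont F := continuous (fun x => complex.Re (F x)) /\
                      continuous (fun x => complex.Im (F x)).

Lemma eq_ccont F G : F =1 G -> ccont F -> ccont G.
Proof. by move=> /funext ->. Qed.

Lemma ccont_cst (c : C) : ccont (fun _ => c).
Proof. by split; exact: cont_cst. Qed.

Lemma ccontD F G : ccont F -> ccont G -> ccont (fun x => F x + G x).
Proof.
move=> [rF iF] [rG iG]; split.
  have -> : (fun x => complex.Re (F x + G x)) =
      (fun x => complex.Re (F x) + complex.Re (G x)).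
    by apply/funext => x; case: (F x) (G x) => ? ? [].
  exact: contD.
have -> : (fun x => complex.Im (F x + G x)) =
    (fun x => complex.Im (F x) + complex.Im (G x)).
  by apply/funext => x; case: (F x) (G x) => ? ? [].
exact: contD.
Qed.

Lemma ccontM F G : ccont F -> ccont G -> ccont (fun x => F x * G x).
Proof.
move=> [rF iF] [rG iG]; split.
  have -> : (fun x => complex.Re (F x * G x)) =
      (fun x => complex.Re (F x) * complex.Re (G x)
                + - (complex.Im (F x) * complex.Im (G x))).
    by apply/funext => x; case: (F x) (G x) => ? ? [].
  by apply: contD; [exact: contM|apply: contN; exact: contM].
have -> : (fun x => complex.Im (F x * G x)) =
    (fun x => complex.Re (F x) * complex.Im (G x)
              + complex.Im (F x) * complex.Re (G x)).
  by apply/funext => x; case: (F x) (G x) => ? ? [].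
by apply: contD; exact: contM.
Qed.

Lemma ccont_conj F : ccont F -> ccont (fun x => Num.conj (F x)).
Proof.
move=> [rF iF]; split.
  have -> // : (fun x => complex.Re (Num.conj (F x))) = (fun x => complex.Re (F x)).
  by apply/funext => x; exact: Re_conj.
have -> : (fun x => complex.Im (Num.conj (F x))) = (fun x => - complex.Im (F x)).
  by apply/funext => x; case: (F x).
exact: contN.
Qed.

Lemma ccont_sum (I : Type) (r : seq I) (F : I -> T -> C) :
  (forall i, ccont (F i)) -> ccont (fun x => \sum_(i <- r) F i x).
Proof.
move=> h; elim: r => [|i r IH].
  by apply: (@eq_ccont (fun=> 0)) => [x|]; rewrite ?big_nil //; exact: ccont_cst.
apply: (@eq_ccont (fun x => F i x + \sum_(i <- r) F i x)) => [x|].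
  by rewrite big_cons.
exact: ccontD.
Qed.

Lemma ccont_prod (I : Type) (r : seq I) (F : I -> T -> C) :
  (forall i, ccont (F i)) -> ccont (fun x => \prod_(i <- r) F i x).
Proof.
move=> h; elim: r => [|i r IH].
  by apply: (@eq_ccont (fun=> 1)) => [x|]; rewrite ?big_nil //; exact: ccont_cst.
apply: (@eq_ccont (fun x => F i x * \prod_(i <- r) F i x)) => [x|].
  by rewrite big_cons.
exact: ccontM.
Qed.

Definition mxcont m n (A : T -> 'M[C]_(m, n)) := forall i j, ccont (fun x => A x i j).

Lemma mxcontM m n p (A : T -> 'M[C]_(m, n)) (B : T -> 'M[C]_(n, p)) :
  mxcont A -> mxcont B -> mxcont (fun x => A x *m B x).
Proof.
move=> cA cB i j.
apply: (@eq_ccont (fun x => \sum_k A x i k * B x k j)) => [x|]; first by rewrite mxE.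
by apply: ccont_sum => k; exact: ccontM.
Qed.

Lemma mxcont_adj m n (A : T -> 'M[C]_(m, n)) :
  mxcont A -> mxcont (fun x => (A x)^t*).
Proof.
move=> cA i j.
apply: (@eq_ccont (fun x => Num.conj (A x j i))) => [x|]; first by rewrite !mxE.
exact: ccont_conj.
Qed.

Lemma mxcont_cst m n (A : 'M[C]_(m, n)) : mxcont (fun _ => A).
Proof. by move=> i j; exact: ccont_cst. Qed.

Lemma mxcont_det n (A : T -> 'M[C]_n) : mxcont A -> ccont (fun x => \det (A x)).
Proof.
move=> cA; apply: ccont_sum => s; apply: ccontM; first exact: ccont_cst.
by apply: ccont_prod => i; exact: cA.
Qed.

Lemma mxcont_tr n (A : T -> 'M[C]_n) : mxcont A -> ccont (fun x => \tr (A x)).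
Proof. by move=> cA; apply: ccont_sum => i; exact: cA. Qed.

Lemma mxcont_inner n (A : T -> 'M[C]_n) (G : 'M[C]_n) :
  mxcont A -> continuous (fun x => inner (A x) G).
Proof.
move=> cA; rewrite /inner.
have cG := mxcont_cst G.
by have [] := mxcont_tr (mxcontM cA cG).
Qed.

End EntrywiseContinuity.

Section GramParametrization.
Context {R : realType} (n : nat).
Local Notation C := (Num.ClosedField.sort (R[i] : numClosedFieldType)).
Local Notation N := (n * n + n * n)%N.
Implicit Types (A V X Y : 'M[C]_n) (w : 'rV[R]_N).

(** Real parts sit in the first half of the row and imaginary parts in the second, so compactness
    can be taken from real Euclidean space. *)
Definition cmx w : 'M[C]_n := \matrix_(i, j)
  ((w 0 (lshift _ (mxvec_index i j))) +i* (w 0 (rshift _ (mxvec_index i j)))).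

Definition cmx_inv V : 'rV[R]_N :=
  row_mx (mxvec (\matrix_(i, j) complex.Re (V i j)))
         (mxvec (\matrix_(i, j) complex.Im (V i j))).

Lemma cmx_invK V : cmx (cmx_inv V) = V.
Proof.
apply/matrixP => i j; rewrite mxE row_mxEl row_mxEr !mxvecE !mxE.
by case: (V i j).
Qed.

Lemma mxcont_cmx : mxcont cmx.
Proof.
move=> i j; split.
  have -> : (fun w => complex.Re (cmx w i j)) =
      (fun w => w 0 (lshift _ (mxvec_index i j))).
    by apply/funext => w; rewrite mxE.
  exact: coord_continuous.
have -> : (fun w => complex.Im (cmx w i j)) =
    (fun w => w 0 (rshift _ (mxvec_index i j))).
  by apply/funext => w; rewrite mxE.
exact: coord_continuous.
Qed.

Definition gram w := (cmx w)^t* *m cmx w.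

Lemma mxcont_gram : mxcont gram.
Proof.
apply: mxcontM; last exact: mxcont_cmx.
by apply: mxcont_adj; exact: mxcont_cmx.
Qed.

Lemma tr_gram w : complex.Re (\tr (gram w)) = \sum_j \sum_i sqmod (cmx w i j).
Proof.
rewrite /gram /mxtrace Re_sum; apply: eq_bigr => j _.
rewrite mxE Re_sum; apply: eq_bigr => i _.
by rewrite !mxE; exact: Re_conjM.
Qed.

Lemma coord_le_tr_gram w k : w 0 k ^+ 2 <= complex.Re (\tr (gram w)).
Proof.
rewrite tr_gram.
suff h i j : sqmod (cmx w i j) <= \sum_j \sum_i sqmod (cmx w i j).
  rewrite -(splitK k); case: (fintype.split k) => k' /=;
  by case: (mxvec_indexP k') => i j; apply: le_trans (h i j);
     rewrite /sqmod mxE /= ?lerDl ?lerDr sqr_ge0.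
rewrite (bigD1 j) //= (bigD1 i) //= -addrA lerDl addr_ge0 //.
  by apply: sumr_ge0 => ? _; exact: sqmod_ge0.
by do 2!apply: sumr_ge0 => ? _; exact: sqmod_ge0.
Qed.

(* The density matrices are the image under V |-> V^* V of the unit Frobenius
   sphere, which is compact. *)
Lemma max_over_density (f : 'M[C]_n -> R) :
  continuous (fun w => f (gram w)) -> (exists X, density n X) ->
  exists2 X, density n X & forall Y, density n Y -> f Y <= f X.
Proof.
move=> cf [X0 [pX0 tX0]].
pose K : set 'rV[R]_N := [set w | complex.Re (\tr (gram w)) = 1].
have dK w : K w -> density n (gram w).
  move=> Kw; split; first exact: psd_gram.
  have h : (\tr (gram w))^* = \tr (gram w) by rewrite -tr_adj adj_gram.
  by rewrite (real_Re h) Kw.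
have sK Y : density n Y -> exists2 w, K w & gram w = Y.
  move=> [/psd_factor[V eV] tY]; exists (cmx_inv V); last by rewrite /gram cmx_invK.
  by rewrite /K /= /gram cmx_invK -eV tY.
have [w0 Kw0 _] := sK X0 (conj pX0 tX0).
have cK : compact K.
  apply: bounded_closed_compact.
    exists 1; split; first exact: num_real.
    move=> x x1 w Kw /=; have -> : `|w| = mx_norm w by [].
    rewrite mx_normrE; apply: bigmax_le => [|i _].
      by rewrite (le_trans ler01) // ltW.
    rewrite (le_trans _ (ltW x1)) // -(@ler_sqr _ _ 1) ?nnegrE // expr1n.
    rewrite real_normK ?num_real //.
    by rewrite ord1 -[leRHS]Kw coord_le_tr_gram.
  have := (continuous_closedP (fun w => complex.Re (\tr (gram w)))).1.
  move=> /(_ _ [set x | x = 1] (@closed_eq _ 1)); apply.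
  by have [] := mxcont_tr mxcont_gram.
have [|w Kw hw] := EVT_max_rV _ cK (continuous_subspaceT cf); first by exists w0.
exists (gram w); first by apply: dK; rewrite inE in Kw.
by move=> Y /sK[v Kv <-]; apply: hw; rewrite inE.
Qed.

End GramParametrization.

Section Density.
Context {R : realType} {n : nat}.
Local Notation C := (Num.ClosedField.sort (R[i] : numClosedFieldType)).
Implicit Types (A X Y H G : 'M[C]_n).

Lemma psd_det_ge0 A : psdmx A -> 0 <= complex.Re (\det A).
Proof.
move=> pA; have [W [a [uW eA]]] := herm_spectral (psd_herm pA).
have uWu := unitary_unit uW.
have a0 i : 0 <= a i by move: pA; rewrite eA => /(psd_cong _ uWu).
by rewrite eA det_diag_cong mulr_ge0 ?sqmod_ge0 ?prodr_ge0.
Qed.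

Lemma density_herm X : density n X -> X^t* = X.
Proof. by case=> /psd_herm. Qed.

Lemma density_line X Y (t : R) : density n X -> density n Y -> 0 <= t -> t <= 1 ->
  density n (X + t%:C *: (Y - X)).
Proof.
move=> [pX tX] [pY tY] t0 t1; split.
  have -> : X + t%:C *: (Y - X) = (1 - t)%:C *: X + t%:C *: Y.
    by rewrite rmorphB rmorph1 scalerBl scale1r scalerBr addrAC addrA.
  by apply: psdD; apply: psdZ => //; rewrite subr_ge0.
by rewrite mxtraceD mxtraceZ linearB /= tX tY subrr mulr0 addr0.
Qed.

Lemma density_sub_herm X Y : density n X -> density n Y -> (Y - X)^t* = Y - X.
Proof. by move=> /density_herm hX /density_herm hY; rewrite adjD adjN hX hY. Qed.

Lemma pd_scalar (c : R) : 0 < c -> pdmx (c%:C%:M : 'M[C]_n).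
Proof.
move=> c0; have -> : (c%:C%:M : 'M[C]_n) = (1%:M)^t* *m rdiag (fun _ => c) *m 1%:M.
  rewrite adj1 mul1mx mulmx1; apply/matrixP => i j; rewrite rdiagE mxE.
  by [].
by apply/(pd_cong _ (unitmx1 _ _)).
Qed.

Lemma inner1 X : inner X 1%:M = complex.Re (\tr X).
Proof. by rewrite /inner mulmx1. Qed.

Lemma inner_scalar X (c : R) : inner X c%:C%:M = c * complex.Re (\tr X).
Proof. by rewrite -inner1 -innerZr scalemx1. Qed.

Lemma density_uniform : (0 < n)%N ->
  density n ((n%:R^-1 : R)%:C%:M : 'M[C]_n).
Proof.
move=> n0; have c0 : 0 < (n%:R^-1 : R) by rewrite invr_gt0 ltr0n.
split; first by apply: pd_psd; exact: pd_scalar.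
rewrite mxtrace_scalar -[RHS](rmorph1 (real_complex R)) -rmorphMn /=.
by rewrite -mulr_natr mulVf // pnatr_eq0 -lt0n.
Qed.

End Density.

(** * Optimality conditions for FTRL *)

Section Ftrl.
Context {R : realType} {n : nat}.
Local Notation C := (Num.ClosedField.sort (R[i] : numClosedFieldType)).
Variables (b B eta : R) (l : nat -> R) (Xs Gs Ds : nat -> 'M[C]_n).
Hypotheses (b0 : 0 <= b) (eta0 : 0 < eta) (n0 : (0 < n)%N).
Implicit Types (X Y H : 'M[C]_n).

(** With [B = 0] this is the sum of the unbiased surrogates, so both sequences of minimizers fall
    under the same lemmas. *)
Definition qobj k X : R := \sum_(s < k) (l s + inner (X - Xs s) (Gs s)
  + b / 2 * inner (X - Xs s) (Gs s) ^+ 2 - B * inner X (Ds s)).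

(* The derivative of qobj k at X in the direction H. *)
Definition qdir k X H : R := \sum_(s < k)
  ((1 + b * inner (X - Xs s) (Gs s)) * inner H (Gs s) - B * inner H (Ds s)).

Definition phi k X : R := qobj k X - eta^-1 * ld X.

(* Only positive definite competitors: at singular Y, ld Y is the junk value
   ln 0 = 0 instead of -oo. *)
Definition is_min k X := [/\ density n X, pdmx X &
  forall Y, density n Y -> pdmx Y -> phi k X <= phi k Y].

Lemma qobj_line k X H (t : R) : qobj k (X + t%:C *: H) = qobj k X + t * qdir k X H
  + t ^+ 2 * (b / 2 * \sum_(s < k) inner H (Gs s) ^+ 2).
Proof.
rewrite /qobj /qdir !mulr_sumr -!big_split; apply: eq_bigr => s _ /=.
have -> : X + t%:C *: H - Xs s = X - Xs s + t%:C *: H by rewrite addrAC.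
by rewrite (innerDl (X - _)) (innerDl X (t%:C *: H)) !innerZl; field.
Qed.

(** Moving from [X] towards [Y] by [t] changes [phi] by at most [t * D + t^2 * K], so a negative [D]
    would contradict minimality for small [t]. *)
Lemma is_min_first_order k X Y : is_min k X -> density n Y ->
  0 <= qdir k X (Y - X) - eta^-1 * inner (invmx X) (Y - X).
Proof.
move=> [dX pX hmin] dY.
have hH := density_sub_herm dX dY; have := density_line dX dY.
move: (Y - X) hH => H hH dl.
set m := Num.sqrt (locsq X H).
have m0 : 0 <= m by exact: sqrtr_ge0.
have L0 := locsq_ge0 pX hH.
set D := qdir k X H - _.
set K := b / 2 * \sum_(s < k) inner H (Gs s) ^+ 2 + eta^-1 * (2 * locsq X H).
have K0 : 0 <= K.
  rewrite addr_ge0 ?mulr_ge0 ?invr_ge0 ?(ltW eta0) ?sumr_ge0 // => i _.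
  exact: sqr_ge0.
have step t : 0 < t -> t <= 1 -> t * m <= 1 / 2 -> 0 <= D + t * K.
  move=> t0 t1 tm.
  have [pL hL] := ld_line_ge pX hH t0 tm.
  have := hmin _ (dl _ (ltW t0) t1) pL.
  rewrite /phi qobj_line => h.
  have h2 : eta^-1 * (ld X + t * inner (invmx X) H - 2 * t ^+ 2 * locsq X H) <=
      eta^-1 * ld (X + t%:C *: H) by rewrite ler_wpM2l // invr_ge0 ltW.
  rewrite -(pmulr_rge0 _ t0) /D /K; move: h h2.
  move: (qobj k X) (ld _) (ld _) (qdir k X H) (inner _ _) (\sum_(s < k) _) => *; nra.
rewrite leNgt; apply/negP => D0.
(* The three bounds keep the point on the segment, keep the step within the range of [ld_line_ge],
   and make [t * K < - D]. *)
pose t := Num.min 1 (Num.min (1 / (2 * (m + 1))) (- D / (2 * (K + 1)))).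
have t0 : 0 < t by rewrite !lt_min ltr01 !divr_gt0 ?oppr_gt0 //; lra.
have t1 : t <= 1 by rewrite ge_min lexx.
have tm : t * m <= 1 / 2.
  have : t <= 1 / (2 * (m + 1)) by rewrite !ge_min lexx orbT.
  rewrite ler_pdivlMr; nra.
have tK : t * K < - D.
  have : t <= - D / (2 * (K + 1)) by rewrite !ge_min lexx !orbT.
  rewrite ler_pdivlMr; nra.
have := step t t0 t1 tm; lra.
Qed.

(** Because [qobj] is exactly quadratic, all that [phi k Y - phi k X] contains beyond the
    first-order term is the sum of squares and the Bregman divergence of [- ld / eta]. *)
Lemma is_min_gap k X Y : is_min k X -> density n Y -> pdmx Y ->
  phi k X + b / 2 * (\sum_(s < k) inner (Y - X) (Gs s) ^+ 2) +
  eta^-1 * (ld X + inner (invmx X) (Y - X) - ld Y) <= phi k Y.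
Proof.
move=> hX dY pY; have := is_min_first_order hX dY.
have eY : Y = X + 1%:C *: (Y - X) by rewrite scale1r addrC subrK.
have -> : phi k Y = phi k (X + 1%:C *: (Y - X)) by rewrite -eY.
rewrite /phi qobj_line -eY expr1n !mul1r; lra.
Qed.

Lemma qobj_cont k : continuous (fun w => qobj k (gram w : 'M[C]_n)).
Proof.
apply: cont_sum => s.
have cg := mxcont_gram (R := R) (n := n).
have ci : continuous (fun w : 'rV[R]_(n * n + n * n) => inner (gram w - Xs s) (Gs s)).
  under eq_fun do rewrite innerBl.
  by apply: contD; [exact: mxcont_inner|exact: cont_cst].
apply: contD.
  apply: contD; first by apply: contD => //; exact: cont_cst.
  apply: contM; first exact: cont_cst.
  under eq_fun do rewrite expr2.
  exact: contM.
by apply: contN; apply: contM; [exact: cont_cst|exact: mxcont_inner].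
Qed.

Lemma rescale_objective (a c p q : R) :
  a - eta * p <= c - eta * q -> q - eta^-1 * c <= p - eta^-1 * a.
Proof.
rewrite -(ler_pM2l (x := eta^-1)) ?invr_gt0 // !mulrBr.
rewrite !(mulrA eta^-1) mulVf ?gt_eqF // !mul1r; lra.
Qed.

(* Minimizing qobj - ld / eta is maximizing det * exp (- eta * qobj), which is
   continuous up to the singular matrices and vanishes there. *)
Lemma ex_min k : exists X, is_min k X.
Proof.
pose f X := complex.Re (\det X) * expR (- eta * qobj k X).
have cf : continuous (fun w => f (gram w : 'M[C]_n)).
  apply: contM; first by have [] := mxcont_det (mxcont_gram (R := R) (n := n)).
  move=> w; apply: (@continuous_comp _ _ _ (fun w => - eta * qobj k (gram w)) expR).
    by apply: contM; [exact: cont_cst|exact: qobj_cont].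
  exact: continuous_expR.
have [U dU pU] : exists2 U : 'M[C]_n, density n U & pdmx U.
  exists ((n%:R^-1 : R)%:C%:M); first exact: density_uniform.
  by apply: pd_scalar; rewrite invr_gt0 ltr0n.
have [|X dX hX] := @max_over_density _ _ f cf; first by exists U.
have pX : pdmx X.
  apply: psd_det_pd; first by case: dX.
  have fU : 0 < f U := mulr_gt0 (pd_det pU) (expR_gt0 _).
  by have := lt_le_trans fU (hX _ dU); rewrite /f (pmulr_lgt0 _ (expR_gt0 _)).
exists X; split=> // Y dY pY; have := hX _ dY.
have fpos Z : pdmx Z -> f Z \in Num.pos.
  by move=> pZ; rewrite posrE (mulr_gt0 (pd_det pZ) (expR_gt0 _)).
have eln Z : pdmx Z -> ln (f Z) = ld Z - eta * qobj k Z.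
  move=> pZ; rewrite lnM; [|by rewrite posrE (pd_det pZ)|by rewrite posrE expR_gt0].
  by rewrite expRK mulNr.
rewrite -(ler_ln (fpos _ pY) (fpos _ pX)) => h.
have : ld Y - eta * qobj k Y <= ld X - eta * qobj k X.
  by rewrite -(eln Y pY) -(eln X pX).
exact: rescale_objective.
Qed.

(** [argmin] defaults to [0] when no minimizer exists, so [ex_min] has to supply one. The extended
    objective is [+oo] at singular densities, which forces the point actually chosen to be positive
    definite. *)
Lemma argmin_is_min k (F : 'M[C]_n -> \bar R) :
  (forall X, F X = ((qobj k X)%:E + (eta^-1)%:E * logdet_reg X)%E) ->
  is_min k (argmin (density n) F).
Proof.
move=> hF.
have F1 X : 0 < complex.Re (\det X) -> F X = (phi k X)%:E.
  move=> dX; rewrite hF /logdet_reg lne_EFin // -EFinN -EFinM -EFinD.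
  by rewrite mulrN.
have F0 X : complex.Re (\det X) = 0 -> F X = +oo%E.
  move=> dX; rewrite hF /logdet_reg dX le0_lneNy //= mulry gtr0_sg ?invr_gt0 // mul1e.
  by rewrite addey.
have dge X : density n X -> complex.Re (\det X) = 0 \/ 0 < complex.Re (\det X).
  by case=> /psd_det_ge0; rewrite le_eqVlt => /orP[/eqP <-|]; [left|right].
have [Z [dZ pZ hZ]] := ex_min k.
have hex : exists X, [set X | density n X /\ forall Y, density n Y -> (F X <= F Y)%E] X.
  exists Z; split=> // Y dY; rewrite (F1 Z (pd_det pZ)).
  have [d0|d0] := dge Y dY; first by rewrite (F0 Y d0) leey.
  rewrite (F1 Y d0) lee_fin; apply: (hZ _ dY).
  by apply: psd_det_pd d0; case: dY.
have [dA hA] := xgetPex 0 hex; rewrite -/(argmin (density n) F) in dA hA.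
move: (argmin _ _) dA hA => A dA hA.
have detA : 0 < complex.Re (\det A).
  have [d0|//] := dge A dA; have := hA _ dZ.
  by rewrite (F0 A d0) (F1 Z (pd_det pZ)) leye_eq.
split; first exact: dA.
  by apply: psd_det_pd detA; case: dA.
move=> Y dY pY; have := hA _ dY.
by rewrite (F1 A detA) (F1 Y (pd_det pY)) lee_fin.
Qed.

End Ftrl.

(** * Inverses, traces and log det *)

Section MoreLoewner.
Context {R : realType} {n : nat}.
Local Notation C := (Num.ClosedField.sort (R[i] : numClosedFieldType)).
Implicit Types (A X Y H G P U V : 'M[C]_n).

Lemma mulmx1_invmx A X : A *m X = 1%:M -> invmx A = X.
Proof.
by move=> e; have [uA _] := mulmx1_unit e; rewrite -[RHS](mulKmx uA) e mulmx1.
Qed.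

Lemma inner_self_le1 G : density n G -> inner G G <= 1.
Proof.
move=> [pG tG]; have [W [a [uW eG]]] := herm_spectral (psd_herm pG).
have uWu := unitary_unit uW.
have a0 i : 0 <= a i by move: pG; rewrite eG => /(psd_cong _ uWu).
have eW : W *m G *m W^t* = rdiag a.
  by rewrite eG !mulmxA uW mul1mx -mulmxA uW mulmx1.
have sa : \sum_i a i = 1.
  by move: tG; rewrite eG mxtrace_mulC mulmxA uW mul1mx tr_rdiag => -[].
rewrite {1}eG inner_diag_cong eW -[leRHS](expr1n _ 2) -sa.
apply: (le_trans _ (sum_sqr_le_sqr_sum a0)).
by apply: ler_sum => i _; rewrite rdiagE eqxx mulr1n expr2.
Qed.

(** Put [q = <X, G>]. The matrix [X / q - 2 + q X^-1] has eigenvalues [(x - q)^2 / (q x) >= 0], and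
    its pairing with [G] is [q <X^-1, G> - 1]. *)
Lemma inner_inv_ge X G : pdmx X -> density n G ->
  1 <= inner X G * inner (invmx X) G.
Proof.
move=> pX dG; have [pG tG] := dG; have q0 := inner_pd_gt0 pX dG.
have [W [x [uW eX]]] := herm_spectral (pd_herm pX).
have uWu := unitary_unit uW.
have x0 i : 0 < x i by move: pX; rewrite eX => /(pd_cong _ uWu).
have x00 i : x i != 0 by rewrite gt_eqF.
have eI : invmx X = W^t* *m rdiag (fun i => (x i)^-1) *m W.
  rewrite eX (inv_diag_cong uWu x00).
  by rewrite (mulmx1_invmx (unitary_adjK uW)).
have e1 : 1%:M = W^t* *m rdiag (fun _ => 1) *m W by rewrite rdiag1 mulmx1 unitary_adjK.
set q := inner X G in q0 *.
have : 0 <= inner (q^-1%:C *: X - 2%:C *: 1%:M + q%:C *: invmx X) G.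
  apply: inner_psd_ge0 pG; rewrite eI eX e1 !frame_scale frame_sub -mulmxDl -mulmxDr rdiagD.
  apply/(psd_cong _ uWu) => i.
  have -> : q^-1 * x i - 2 * 1 + q * (x i)^-1 = (x i - q) ^+ 2 / (q * x i).
    by field; rewrite x00 gt_eqF.
  by rewrite divr_ge0 ?sqr_ge0 // mulr_ge0 // ltW.
rewrite innerDl innerBl !innerZl -/q mulVf ?gt_eqF // [inner 1%:M _]innerC inner1 tG /=.
lra.
Qed.

Lemma no_reset_inv (c : R) U P : pdmx P -> pdmx U -> 0 < c ->
  loewner_lt U (c%:C *: invmx P) -> psdmx (c%:C *: invmx U - P).
Proof.
move=> pP pU c0 /pd_psd h.
have c00 : c != 0 by rewrite gt_eqF.
have e : invmx (c%:C *: invmx P) = c^-1%:C *: P.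
  apply: mulmx1_invmx; rewrite -scalemxAl -scalemxAr scalerA -rmorphM.
  by rewrite mulfV // rmorph1 scale1r (mulVmx (pd_unit pP)).
have := psdZ (ltW c0) (inv_antitone pU h); rewrite e scalerBr scalerA -rmorphM.
by rewrite (mulfV c00) rmorph1 scale1r => h'; exact: h'.
Qed.

Lemma ld_mono X Y : pdmx X -> pdmx Y -> psdmx (Y - X) -> ld X <= ld Y.
Proof.
move=> pX pY pYX; have := ld_concave pY pX.
have := inner_psd_ge0 (pd_psd (pd_inv pY)) pYX.
rewrite !innerBr; lra.
Qed.

Lemma ld_scalar (c : R) : 0 < c -> ld (c%:C%:M : 'M[C]_n) = n%:R * ln c.
Proof. by move=> c0; rewrite /ld det_scalar -rmorphXn /= lnXn // mulr_natl. Qed.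

(** The tangent of [ld] at the scalar matrix [c], for use when only a trace bound is known. *)
Lemma ld_le_tr X (c : R) : 0 < c -> pdmx X ->
  ld X <= n%:R * ln c + complex.Re (\tr X) / c - n%:R.
Proof.
move=> c0 pX; have pc := pd_scalar (n := n) c0.
rewrite -addrA.
have -> : complex.Re (\tr X) / c - n%:R = inner (invmx c%:C%:M) (X - c%:C%:M).
  have -> : invmx (c%:C%:M : 'M[C]_n) = (c^-1%:C)%:M.
    by rewrite invmx_scalar fmorphV.
  rewrite innerC inner_scalar mxtraceD linearN /= mxtrace_scalar ReD ReN.
  by rewrite -rmorphMn /= -mulr_natl; field; rewrite gt_eqF.
by rewrite -(ld_scalar c0); exact: ld_concave.
Qed.

End MoreLoewner.

(** * Matrices as vectors *)

Section Vectorization.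
Context {R : realType} {n : nat}.
Local Notation C := (Num.ClosedField.sort (R[i] : numClosedFieldType)).
Implicit Types (H G : 'M[C]_n) (V : 'M[C]_(n * n)).

(** Gradients become columns of length [n * n], so that their outer products sum to one Gram matrix
    whose log det serves as a potential. *)
Definition vec H : 'cV[C]_(n * n) := (mxvec H)^T.

Lemma vec_dot H G : H^t* = H -> ((vec H)^t* *m vec G) 0 0 = \tr (H *m G).
Proof.
move=> hH; rewrite mxE (reindex _ (curry_mxvec_bij n n)) /=.
rewrite (eq_bigr (fun p => (vec H)^t* 0 (mxvec_index p.1 p.2) *
  vec G (mxvec_index p.1 p.2) 0)); last by case.
rewrite -(pair_bigA _ (fun i j =>
   (vec H)^t* 0 (mxvec_index i j) * vec G (mxvec_index i j) 0)) /=.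
rewrite /mxtrace exchange_big; apply: eq_bigr => i _; rewrite mxE /=.
apply: eq_bigr => j _; rewrite !mxE !mxvecE -{2}hH !mxE.
by [].
Qed.

Lemma tr_herm_real H G : H^t* = H -> G^t* = G -> \tr (H *m G) = (inner H G)%:C.
Proof.
move=> hH hG; apply: real_Re.
by rewrite -tr_adj adjM hH hG mxtrace_mulC.
Qed.

Lemma qform_outer H G : H^t* = H -> G^t* = G ->
  qform (vec G *m (vec G)^t*) (vec H) = inner H G ^+ 2.
Proof.
move=> hH hG; rewrite /qform !mulmxA -(mulmxA _ _ (vec H)).
rewrite mxE big_ord1 (vec_dot _ hH) (vec_dot _ hG).
rewrite !tr_herm_real // innerC -rmorphM expr2.
by [].
Qed.

Lemma qform_id H : H^t* = H -> qform 1%:M (vec H) = inner H H.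
Proof. by move=> hH; rewrite /qform mulmx1 vec_dot. Qed.

Lemma psd_outer G : psdmx (vec G *m (vec G)^t*).
Proof. by rewrite -{1}[vec G]trmxCK; exact: psd_gram. Qed.

Lemma tr_outer G : G^t* = G -> complex.Re (\tr (vec G *m (vec G)^t*)) = inner G G.
Proof.
by move=> hG; rewrite mxtrace_mulC /mxtrace big_ord1 (vec_dot _ hG).
Qed.

(** Fenchel-Young for the form of [V]: expand its nonnegative value at [h + V^-1 g]. *)
Lemma qform_cross (N : nat) (V : 'M[C]_N) (h g : 'cV[C]_N) : pdmx V ->
  - 2 * complex.Re ((h^t* *m g) 0 0) <= qform V h + qform (invmx V) g.
Proof.
move=> pV; have hV := pd_herm pV; have uV := pd_unit pV.
have [_ h0] := (psdP _).1 (pd_psd pV).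
have := h0 (h + invmx V *m g).
suff -> : qform V (h + invmx V *m g) =
    qform V h + 2 * complex.Re ((h^t* *m g) 0 0) + qform (invmx V) g by lra.
have hI : (invmx V)^t* = invmx V by rewrite adj_inv hV.
rewrite /qform adjD adjM hI mulmxDl !mulmxDr !mulmxDl.
rewrite -!mulmxA !(mulKVmx uV) (mulKmx uV).
have Radd (A B : 'M[C]_1) :
  complex.Re ((A + B) 0 0) = complex.Re (A 0 0) + complex.Re (B 0 0).
  by rewrite mxE ReD.
rewrite !Radd.
have -> : complex.Re ((g^t* *m h) 0 0) = complex.Re ((h^t* *m g) 0 0).
  have cj (A : 'M[C]_1) : complex.Re (A^t* 0 0) = complex.Re (A 0 0).
    by rewrite !mxE; exact: Re_conj.
  by rewrite -(cj (h^t* *m g)) adjM trmxCK.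
lra.
Qed.

End Vectorization.

(** * Regret of one epoch *)

Section ScalarBounds.
Context {R : realType}.
Variables (b B eta : R).
Hypotheses (b0 : 0 < b) (b1 : b <= 1 / 100) (e0 : 0 < eta) (e1 : eta <= 1 / 100).
Hypothesis Be : B * eta = 1 / 4.

Lemma drift_ratio_le (m rho : R) : 0 <= m -> 0 <= rho ->
  eta^-1 * (m ^+ 2 / (2 * (1 + m))) <= m * rho -> m <= 2 * (eta * rho) * (1 + m).
Proof.
move=> m0 r0; have m2 : 0 < 2 * (1 + m) by lra.
have er : 0 <= eta * rho by rewrite mulr_ge0 // ltW.
have [->|m1] := eqVneq m 0; first by rewrite addr0 mulr1; lra.
have mp : 0 < m by rewrite lt_neqAle eq_sym m1.
rewrite -(ler_pM2l e0) (mulVKf (lt0r_neq0 e0)) ler_pdivrMr // => h.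
rewrite -(ler_pM2l mp); lra.
Qed.

(** The constant 5 reproduces itself: with [B * eta = 1 / 4] and [p <= 5 * eta] one gets
    [m <= 9 / 2 * eta * (1 + m)], and [eta <= 1 / 100] absorbs the factor [1 + m] into the passage
    from 9/2 to 5. *)
Lemma drift_le (m p : R) : 0 <= m -> 0 <= p -> p <= 5 * eta ->
  eta^-1 * (m ^+ 2 / (2 * (1 + m))) <= m + B * (m * p) -> m <= 5 * eta.
Proof.
move=> m0 p0 p1 h.
have B0 : 0 < B by rewrite -(pmulr_lgt0 _ e0) Be; lra.
have : m <= 2 * (eta * (1 + B * p)) * (1 + m).
  apply: drift_ratio_le => //; first by rewrite addr_ge0 // mulr_ge0 // ltW.
  by apply: (le_trans h); rewrite le_eqVlt; apply/orP; left; apply/eqP; ring.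
have -> : eta * (1 + B * p) = eta + B * eta * p by ring.
rewrite Be => h2.
have h3 : 0 <= (5 * eta - p) * (1 + m) by rewrite mulr_ge0 // ?subr_ge0 //; lra.
have h4 : 0 <= m * (1 / 100 - eta) by rewrite mulr_ge0 // subr_ge0.
lra.
Qed.

(* For q = <U,R>/<X,R> and r = <W,R>/<X,R>, the left-hand side is the surrogate
   at U (up to the loss at X) plus its derivative in the direction W - U. *)
Lemma tangent_le_log (q r : R) : 0 < q -> b * q <= 3 / 5 -> 0 < r ->
  (1 - q) + b / 2 * (1 - q) ^+ 2 - (1 + b * (1 - q)) * (r - q) <= - ln r.
Proof.
move=> q0 bq r0; have := b0; have := b1 => b1' b0'.
set y := b * (1 - q); have s0 : 2 / 5 <= 1 + y by rewrite /y; lra.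
have s1 : 0 < 1 + y by lra.
have h1 : ln (1 + y) + ln r <= (1 + y) * r - 1.
  rewrite -lnM ?posrE // -[in ln _](subrK 1 ((1 + y) * r)) addrC le_ln1Dx //.
  by rewrite -subr_gt0 opprK subrK mulr_gt0.
have h2 : y / (1 + y) <= ln (1 + y) by apply: ln_ge_divD; lra.
have h3 : y - b * (1 - q) ^+ 2 / 2 <= y / (1 + y).
  rewrite ler_pdivlMr // /y.
  have := sqr_ge0 (1 - q).
  have -> : (b * (1 - q) - b * (1 - q) ^+ 2 / 2) * (1 + b * (1 - q)) =
    b * (1 - q) - b * (1 - q) ^+ 2 * ((1 + b * (1 - q)) / 2 - b) by field.
  rewrite -/y => h; rewrite lerBlDr lerDl mulr_ge0 //; last by lra.
  by rewrite mulr_ge0 // ltW.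
have -> : 1 - q + b / 2 * (1 - q) ^+ 2 - (1 + y) * (r - q) =
  1 + y - b * (1 - q) ^+ 2 / 2 - (1 + y) * r by rewrite /y; field.
lra.
Qed.

(** Since [1 / eta = 4 B], the left side is [B (m p - 9 / 10 m^2)], whose maximum over [m] is
    [5 / 18 * B p^2]. *)
Lemma bias_le (m p : R) :
  B * (m * p) - eta^-1 * (9 / 40 * m ^+ 2) <= B / 3 * p ^+ 2.
Proof.
have eB : eta^-1 = 4 * B.
  apply: (mulIf (lt0r_neq0 e0)); by rewrite mulVf ?gt_eqF // -mulrA Be; field.
have B0 : 0 < B by rewrite -(pmulr_lgt0 _ e0) Be; lra.
rewrite eB -subr_ge0.
have -> : B / 3 * p ^+ 2 - (B * (m * p) - 4 * B * (9 / 40 * m ^+ 2)) =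
  B * ((p ^+ 2) / 3 - m * p + 9 / 10 * m ^+ 2) by field.
rewrite (mulr_ge0 (ltW B0)) //; have := sqr_ge0 (p - 3 / 2 * m); have := sqr_ge0 m; lra.
Qed.

Lemma curvature_le (m : R) : 0 <= m -> m <= 1 / 9 ->
  9 / 20 * m ^+ 2 <= m ^+ 2 / (2 * (1 + m)).
Proof.
move=> m0 m1; rewrite mulrC ler_wpM2l ?sqr_ge0 // -[leLHS]mul1r.
by rewrite -[leRHS]mul1r ler_pM2l // -[leRHS]div1r ler_pdivlMr; lra.
Qed.

(** The right side is the maximum over [q] of this concave quadratic; it bounds the slope of a
    surrogate however large the ratio [q] is. *)
Lemma quadratic_le (q : R) : q * (1 + b * (1 - q)) <= (1 + b) ^+ 2 / (4 * b).
Proof.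
rewrite ler_pdivlMr ?mulr_gt0 //; have := sqr_ge0 (1 + b - 2 * b * q); nra.
Qed.

(** The hypotheses give [m <= 1 / 12 * (1 + m)]. The looser [1 / 5] is enough: it raises a ratio
    bound [1 / (2 b)] to [3 / (5 b)], the range of [tangent_le_log]. *)
Lemma udrift_solve (m : R) : 44 * eta <= 7 * b -> 0 <= m ->
  eta^-1 * (m ^+ 2 / (2 * (1 + m))) <= m * ((1 + b) ^+ 2 / (4 * b)) -> m <= 1 / 5.
Proof.
move=> eb m0 h; have b0' := b0; have b1' := b1.
have := drift_ratio_le m0 _ h; rewrite divr_ge0 ?sqr_ge0 ?mulr_ge0 ?(ltW b0) // => /(_ isT).
have : eta * ((1 + b) ^+ 2 / (4 * b)) <= 1 / 24.
  rewrite mulrA ler_pdivrMr ?mulr_gt0 //.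
  have h1 : (1 + b) ^+ 2 <= 41 / 40 by nra.
  have h2 : eta * (1 + b) ^+ 2 <= eta * (41 / 40) by rewrite ler_wpM2l // ltW.
  lra.
move: (eta * _) => x hx hm.
have : x * (1 + m) <= 1 / 24 * (1 + m) by rewrite ler_wpM2r //; lra.
lra.
Qed.

End ScalarBounds.

(** * Stability of FTRL iterates *)

Section FtrlStability.
Context {R : realType} {n : nat}.
Local Notation C := (Num.ClosedField.sort (R[i] : numClosedFieldType)).
Variables (b B eta : R) (l : nat -> R) (Xs Gs Ds : nat -> 'M[C]_n).
Hypotheses (b0 : 0 <= b) (eta0 : 0 < eta).
Implicit Types (X Y H : 'M[C]_n).

Local Notation phi := (phi b B eta l Xs Gs Ds).
Local Notation is_min := (is_min b B eta l Xs Gs Ds).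

Lemma phi_recr k X : phi k.+1 X = phi k X + (l k + inner (X - Xs k) (Gs k)
  + b / 2 * inner (X - Xs k) (Gs k) ^+ 2 - B * inner X (Ds k)).
Proof. rewrite /phi /qobj big_ord_recr /=; lra. Qed.

(** Adding round [k] to [is_min_gap] completes the sum of squares to [k.+1] terms and leaves the
    slope of the new surrogate at [X]; [ld_bregman] bounds the divergence from below. *)
Lemma stability k X Y (m := Num.sqrt (locsq X (Y - X))) :
  is_min k X -> density n Y -> pdmx Y ->
  phi k.+1 X - phi k.+1 Y <=
   - ((1 + b * inner (X - Xs k) (Gs k)) * inner (Y - X) (Gs k))
   - b / 2 * (\sum_(s < k.+1) inner (Y - X) (Gs s) ^+ 2)
   + B * inner (Y - X) (Ds k) - eta^-1 * (m ^+ 2 / (2 * (1 + m))).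
Proof.
move=> hX dY pY; have [dX pX _] := hX.
have gap := is_min_gap b0 eta0 hX dY pY.
have hH := density_sub_herm dX dY.
have eY : X + (Y - X) = Y by rewrite addrC subrK.
have breg := ld_bregman pX hH; rewrite eY in breg.
have {}breg := breg pY.
have m2 : m ^+ 2 = locsq X (Y - X) by rewrite sqr_sqrtr // locsq_ge0.
rewrite -/m -m2 in breg.
have : eta^-1 * (m ^+ 2 / (2 * (1 + m))) <=
   eta^-1 * (ld X + inner (invmx X) (Y - X) - ld Y).
  rewrite ler_wpM2l ?invr_ge0 ?(ltW eta0) //; lra.
rewrite !phi_recr big_ord_recr /=.
have -> : inner (Y - Xs k) (Gs k) = inner (X - Xs k) (Gs k) + inner (Y - X) (Gs k).
  by rewrite -innerDl [X - _ + _]addrC addrA subrK.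
have -> : inner Y (Ds k) = inner X (Ds k) + inner (Y - X) (Ds k).
  by rewrite -innerDl eY.
move: gap; clear.
move: (phi k X) (phi k Y) (inner (X - Xs k) (Gs k)) (inner (Y - X) (Gs k)).
move: (inner X (Ds k)) (inner (Y - X) (Ds k)) (\sum_(s < k) _).
move: (eta^-1 * _) (eta^-1 * _) => *; lra.
Qed.

End FtrlStability.

Section GradLoss.
Context {R : realType} {n : nat}.
Local Notation C := (Num.ClosedField.sort (R[i] : numClosedFieldType)).
Implicit Types (X Y H G A : 'M[C]_n).

Lemma inner_grad G X H : inner H (grad_loss G X) = - (inner H G / inner X G).
Proof. by rewrite innerZr mulNr mulrC. Qed.

Lemma grad_herm G X : density n G -> (grad_loss G X)^t* = grad_loss G X.
Proof. by move=> /density_herm hG; rewrite adjZ hG. Qed.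

Lemma inner_inv_self X : pdmx X -> inner (invmx X) X = n%:R.
Proof.
move=> pX; rewrite /inner (mulVmx (pd_unit pX)) mxtrace1.
by rewrite -(rmorph_nat (real_complex R)).
Qed.

Lemma psd_of_density_bound A (c : R) : A^t* = A ->
  (forall Y, density n Y -> inner A Y <= c) -> psdmx (c%:C%:M - A).
Proof.
move=> hA h.
have hc : (c%:C%:M : 'M[C]_n)^t* = c%:C%:M by rewrite -scalemx1 adjZ adj1.
apply/psdP; split; first by rewrite adjD adjN hA hc.
move=> v; have [->|v0] := eqVneq v 0; first by rewrite /qform mulmx0 mxE.
have p1 : pdmx (1%:M : 'M[C]_n) 
  by have := pd_scalar (n := n) (@ltr01 R); rewrite rmorph1.
have q0 : 0 < qform 1%:M v by have [_ hv] := (pdP _).1 p1; exact: hv.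
have ev : inner (v *m v^t*) 1%:M = qform 1%:M v by rewrite qform_inner innerC.
have hv : (v *m v^t*)^t* = v *m v^t* by rewrite adjM trmxCK.
have tv : \tr (v *m v^t*) = (qform 1%:M v)%:C.
  by rewrite -ev inner1; apply: real_Re; rewrite -tr_adj hv.
have dY : density n ((qform 1%:M v)^-1%:C *: (v *m v^t*)).
  split.
    apply: psdZ; first by rewrite invr_ge0 ltW.
    by rewrite -{1}[v]trmxCK; exact: psd_gram.
  by rewrite mxtraceZ tv -rmorphM mulVf ?rmorph1 // gt_eqF.
have := h _ dY; rewrite innerZr -qform_inner (ler_pdivrMl _ _ q0) => hq.
by rewrite qformB -scalemx1 qformZ subr_ge0 mulrC.
Qed.

(** The first-order condition says [<X^-1, Y> <= n] for every density [Y], so [X^-1 <= n] and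
    [X >= 1 / n]. Both sides have trace 1, hence they agree. *)
Lemma is_min0_uniform (b B eta : R) l Xs Gs Ds X : (0 < n)%N -> 0 <= b -> 0 < eta ->
  is_min b B eta l Xs Gs Ds 0 X -> X = (n%:R^-1 : R)%:C%:M.
Proof.
move=> n0 b0 eta0 hX; have [dX pX _] := hX.
have nR0 : 0 < (n%:R : R) by rewrite ltr0n.
have ub Y : density n Y -> inner (invmx X) Y <= n%:R.
  move=> dY; have := is_min_first_order b0 eta0 hX dY.
  rewrite /qdir big_ord0 sub0r oppr_ge0 pmulr_rle0 ?invr_gt0 // innerBr subr_le0.
  by rewrite inner_inv_self.
have h := psd_of_density_bound (pd_herm (pd_inv pX)) ub.
have := inv_antitone (pd_inv pX) h; rewrite invmxK invmx_scalar -fmorphV => h2.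
apply/eqP; rewrite -subr_eq0; apply/eqP; apply: psd_tr0 h2 _.
have [_ t1] := density_uniform (R := R) n0.
by case: dX => _ tX; rewrite linearB /= tX t1 subrr.
Qed.

End GradLoss.

(* An epoch without a reset at the internal times 0, ..., k (one less than in the
   paper): X j, U j, P j are the iterates, and index k.+1 is the state computed
   in the last round, before the reset condition is checked. *)
Section Epoch.
Context {R : realType} {n : nat}.
Local Notation C := (Num.ClosedField.sort (R[i] : numClosedFieldType)).
Hypothesis n0 : (0 < n)%N.
Variables (b B eta : R) (k : nat) (Rs X U P : nat -> 'M[C]_n).

Definition prevP j : 'M[C]_n := if j is i.+1 then P i else (n%:R : R)%:C%:M.
Definition stepP j := P j - prevP j.
Definition gradX j := grad_loss (Rs j) (X j).
Definition lossX j := - ln (inner (X j) (Rs j)).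
Local Notation D := stepP.
Local Notation G := gradX.
Local Notation l := lossX.
Local Notation c := ((2 * (1 + 6 * eta) * b)^-1).

Hypotheses (b0 : 0 < b) (b1 : b <= 1 / 100) (e0 : 0 < eta) (e1 : eta <= 1 / 100).
Hypotheses (Be : B * eta = 1 / 4) (eb : 44 * eta <= 7 * b).
Hypothesis hX : forall j, (j <= k.+1)%N -> is_min b B eta l X G D j (X j).
Hypothesis hU : forall j, (j <= k.+1)%N -> is_min b 0 eta l X G D j (U j).
Hypothesis hP : forall j, (j <= k.+1)%N -> P j = update_P (prevP j) (X j).
Hypothesis hR : forall j, (j <= k)%N -> density n (Rs j).
Hypothesis hr : forall j, (j <= k)%N -> loewner_lt (U j) (c%:C *: invmx (P j)).

Lemma B_gt0 : 0 < B.
Proof. by rewrite -(pmulr_lgt0 _ e0) Be. Qed.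

Lemma reset_level_gt0 : 0 < c.
Proof.
have := e0 => e0'; rewrite invr_gt0 mulr_gt0 // mulr_gt0 //; lra.
Qed.

Lemma reset_level_mul_le : c * b <= 1 / 2.
Proof.
have := e0 => e0'.
have -> : c * b = (2 * (1 + 6 * eta))^-1.
  by field; rewrite ?(gt_eqF b0) /= gt_eqF //; lra.
by rewrite div1r lef_pV2 ?posrE //; lra.
Qed.

Lemma X_pd j : (j <= k.+1)%N -> pdmx (X j). Proof. by case/hX. Qed.
Lemma X_density j : (j <= k.+1)%N -> density n (X j). Proof. by case/hX. Qed.
Lemma U_pd j : (j <= k.+1)%N -> pdmx (U j). Proof. by case/hU. Qed.
Lemma U_density j : (j <= k.+1)%N -> density n (U j). Proof. by case/hU. Qed.

Lemma nR_gt0 : 0 < (n%:R : R). Proof. by rewrite ltr0n. Qed.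

Lemma prevP_pd j : (j <= k.+2)%N -> pdmx (prevP j).
Proof.
elim: j => [|j IH] jk /=; first exact: pd_scalar nR_gt0.
rewrite (hP jk); apply: update_P_pd; first exact: X_pd.
  by apply: pd_herm; apply: IH; exact: ltnW.
by apply: IH; exact: ltnW.
Qed.

Lemma P_pd j : (j <= k.+1)%N -> pdmx (P j).
Proof. by move=> jk; apply: (@prevP_pd j.+1). Qed.

Lemma prevP_herm j : (j <= k.+1)%N -> (prevP j)^t* = prevP j.
Proof. by move=> jk; apply/pd_herm/prevP_pd/ltnW. Qed.

Lemma stepP_psd j : (j <= k.+1)%N -> psdmx (D j).
Proof.
by move=> jk; rewrite /stepP (hP jk); apply: update_P_ge; [exact: X_pd|exact: prevP_herm].
Qed.

Lemma P_ge_inv j : (j <= k.+1)%N -> psdmx (P j - invmx (X j)).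
Proof.
move=> jk; rewrite (hP jk).
by apply: update_P_ge_inv; [exact: X_pd|exact: prevP_herm].
Qed.

Lemma P_ge_inv_le i j : (i <= j)%N -> (j <= k.+1)%N -> psdmx (P j - invmx (X i)).
Proof.
elim: j => [|j IH] ij jk.
  by move: ij; rewrite leqn0 => /eqP ->; exact: P_ge_inv.
move: ij; rewrite leq_eqVlt => /orP[/eqP -> |ij]; first exact: P_ge_inv.
apply: psd_trans (IH ij (ltnW jk)) _; exact: (@stepP_psd j.+1).
Qed.

Lemma X0_uniform : X 0%N = (n%:R^-1 : R)%:C%:M.
Proof. exact: is_min0_uniform n0 (ltW b0) e0 (hX (leq0n _)). Qed.

(** The inverse of [X 0] is already the initial [n I], so the update is idle. This gives the
    induction on [bias_norm] its base. *)
Lemma stepP0 : D 0%N = 0.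
Proof.
rewrite /stepP (hP (leq0n _)) update_P_id ?subrr //.
- exact: X_pd.
- exact: prevP_herm.
- rewrite X0_uniform invmx_scalar -fmorphV invrK subrr.
  by have := @psd_gram R n n 0; rewrite mulmx0.
Qed.

(* By bias_norm_le_drift, a small drift keeps the next bias small, which in turn
   keeps the next drift small. *)
Definition drift j : R := Num.sqrt (locsq (X j) (X j.+1 - X j)).
Definition bias_norm j : R := Num.sqrt (inner (X j *m D j *m X j) (D j)).

Lemma stepP_herm j : (j <= k.+1)%N -> (D j)^t* = D j.
Proof. by move=> /stepP_psd/psd_herm. Qed.

Lemma bias_norm_sq j : (j <= k.+1)%N ->
  bias_norm j ^+ 2 = inner (X j *m D j *m X j) (D j).
Proof.
move=> jk; rewrite sqr_sqrtr //.
have [delta [_ _]] := update_P_increment (X_pd jk) (prevP_herm jk).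
rewrite -(hP jk) -/(stepP j) => ->; apply: sumr_ge0 => i _; exact: sqr_ge0.
Qed.

Lemma bias_norm_sq_le j : (j <= k.+1)%N -> bias_norm j ^+ 2 <= inner (X j) (D j).
Proof.
move=> jk; rewrite bias_norm_sq // /stepP (hP jk).
apply: update_P_sq_le; [exact: X_pd|exact: prevP_herm|].
by apply/pd_psd/prevP_pd/ltnW.
Qed.

Lemma step_herm j : (j <= k)%N -> (X j.+1 - X j)^t* = X j.+1 - X j.
Proof.
move=> jk; exact: density_sub_herm (X_density (leqW jk)) (@X_density j.+1 jk).
Qed.

Lemma bias_norm_le_drift j : (j <= k)%N -> bias_norm j.+1 <= drift j.
Proof.
move=> jk; apply: ler_wsqrtr.
have h := @update_P_sq_locsq R n (prevP j.+1) _ (@X_pd j.+1 jk) (@prevP_herm j.+1 jk).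
rewrite -(@hP j.+1 jk) in h; apply: h; first exact: X_pd (leqW jk).
exact: P_ge_inv (leqW jk).
Qed.

Lemma step_inner_stepP j : (j <= k)%N ->
  inner (X j.+1 - X j) (D j) <= drift j * bias_norm j.
Proof.
move=> jk; have jk' := leqW jk; rewrite (le_trans (ler_norm _)) //.
rewrite -sqrtr_sqr /drift /bias_norm -sqrtrM.
  apply: ler_wsqrtr; apply: inner_loc_dual (X_pd jk') (step_herm jk) _.
  exact: stepP_herm.
exact: locsq_ge0 (X_pd jk') (step_herm jk).
Qed.

Lemma stab_ineq j (H := X j.+1 - X j) : (j <= k)%N ->
  phi b B eta l X G D j.+1 (X j) - phi b B eta l X G D j.+1 (X j.+1) <=
   - inner H (G j) - b / 2 * (\sum_(s < j.+1) inner H (G s) ^+ 2)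
   + B * (drift j * bias_norm j) - eta^-1 * (drift j ^+ 2 / (2 * (1 + drift j))).
Proof.
move=> jk; rewrite /H.
have := stability (ltW b0) e0 (hX (leqW jk)) (@X_density j.+1 jk) (@X_pd j.+1 jk).
have -> : inner (X j - X j) (G j) = 0 by rewrite subrr inner0l.
rewrite mulr0 addr0 mul1r -/(drift j).
have : B * inner (X j.+1 - X j) (D j) <= B * (drift j * bias_norm j).
  by rewrite ler_wpM2l ?(ltW B_gt0) // step_inner_stepP.
move: (eta^-1 * _) (phi _ _ _ _ _ _ _ _ _) (phi _ _ _ _ _ _ _ _ _).
move: (b / 2 * _) (B * (_ * _)) (B * inner _ _) (inner _ (G j)) => *; lra.
Qed.

Lemma step_inner_gradX j : (j <= k)%N -> - inner (X j.+1 - X j) (G j) <= drift j.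
Proof.
move=> jk; have dR := hR jk; have q0 := inner_pd_gt0 (X_pd (leqW jk)) dR.
rewrite inner_grad opprK (ler_pdivrMr _ _ q0).
apply: inner_loc (X_pd (leqW jk)) (step_herm jk) _; by case: dR.
Qed.

Lemma drift_bias_norm_le j :
  ((j <= k.+1)%N -> bias_norm j <= 5 * eta) /\ ((j <= k)%N -> drift j <= 5 * eta).
Proof.
have h i : (i <= k)%N -> bias_norm i <= 5 * eta -> drift i <= 5 * eta.
  move=> ik hi; apply: (drift_le e0 e1 Be (p := bias_norm i)) => //; try exact: sqrtr_ge0.
  (* As [X i.+1] minimizes [phi] at [i.+1], the left side of [stab_ineq] is nonnegative; the squares
     are dropped from the right side. *)
  have [_ _ hmin] := hX (ik : (i < k.+1)%N).
  have := hmin _ (X_density (leqW ik)) (X_pd (leqW ik)).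
  have := stab_ineq ik; have := step_inner_gradX ik.
  have : 0 <= b / 2 * (\sum_(s < i.+1) inner (X i.+1 - X i) (G s) ^+ 2).
    rewrite mulr_ge0 ?divr_ge0 ?(ltW b0) ?sumr_ge0 // => s _; exact: sqr_ge0.
  move: (eta^-1 * _) (phi _ _ _ _ _ _ _ _ _) (phi _ _ _ _ _ _ _ _ _).
  move: (drift i) (b / 2 * _) (inner _ (G i)) (B * _) => *; lra.
elim: j => [|j [IH1 IH2]]; last first.
  have h1 : (j.+1 <= k.+1)%N -> bias_norm j.+1 <= 5 * eta.
    by move=> jk; apply: (le_trans (bias_norm_le_drift jk)); exact: IH2.
  by split=> // jk; apply: h => //; apply: h1; exact: ltnW.
have i0 : bias_norm 0 <= 5 * eta.
  have := stepP0; rewrite /bias_norm /= => ->; rewrite inner0r sqrtr0 mulr_ge0 // ltW //.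
by split=> [//|jk]; exact: h.
Qed.

Lemma drift_small j : (j <= k)%N -> drift j <= 1 / 9.
Proof.
move=> jk; apply: (le_trans ((drift_bias_norm_le j).2 jk)).
by have := e1 => e1'; lra.
Qed.

(* ridge / 2 times the squared Frobenius norm is the part of the curvature of the
   regularizer that is spent on the gradients (half of 9 / 20, see curvature_le
   and bias_le). *)
Definition ridge : R := 9 / 20 * eta^-1.
Definition gradGram j : 'M[C]_(n * n) :=
  1%:M + \sum_(s < j) (b / ridge)%:C *: (vec (G s) *m (vec (G s))^t*).

Lemma ridge_gt0 : 0 < ridge. Proof. by rewrite mulr_gt0 ?invr_gt0. Qed.

Lemma gradGram_recr j :
  gradGram j.+1 = gradGram j + (b / ridge)%:C *: (vec (G j) *m (vec (G j))^t*).
Proof. by rewrite /gradGram big_ord_recr /= addrA. Qed.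

Lemma gradGram0 : gradGram 0 = 1%:M. Proof. by rewrite /gradGram big_ord0 addr0. Qed.

Lemma gradGram_pd j : pdmx (gradGram j).
Proof.
elim: j => [|j IH].
  by rewrite gradGram0; have := pd_scalar (n := n * n) (@ltr01 R); rewrite rmorph1.
rewrite gradGram_recr; apply: pd_psdD IH _; apply: psdZ; last exact: psd_outer.
by rewrite divr_ge0 // ltW // ridge_gt0.
Qed.

Lemma gradX_herm j : (j <= k)%N -> (G j)^t* = G j.
Proof. by move=> jk; exact: grad_herm (hR jk). Qed.

Lemma qform_gradGram j H : (j <= k.+1)%N -> H^t* = H ->
  qform (gradGram j) (vec H) = inner H H + b / ridge * \sum_(s < j) inner H (G s) ^+ 2.
Proof.
move=> + hH; elim: j => [|j IH] jk.
  by rewrite gradGram0 big_ord0 mulr0 addr0 qform_id.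
rewrite gradGram_recr qformD qformZ (IH (ltnW jk)) (qform_outer hH (@gradX_herm j jk)).
rewrite big_ord_recr /=; ring.
Qed.

Lemma potential_step j H : (j <= k)%N -> H^t* = H ->
  - inner H (G j) - b / 2 * (\sum_(s < j.+1) inner H (G s) ^+ 2)
    - ridge / 2 * inner H H <= 1 / (2 * b) * (ld (gradGram j.+1) - ld (gradGram j)).
Proof.
move=> jk hH.
(* With the scaling by [ridge], division by [2 * ridge] turns the quadratic form of [gradGram j.+1]
   into exactly the two quadratic terms of the statement. *)
have hlam : (ridge%:C *: H)^t* = ridge%:C *: H by rewrite adjZ hH.
(* Fenchel-Young in the norm of gradGram j.+1; concavity of log det bounds the
   dual norm of G j by the growth of the potential. *)
have := qform_cross (vec (ridge%:C *: H)) (vec (G j)) (gradGram_pd j.+1).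
rewrite (vec_dot _ hlam) -/(inner (ridge%:C *: H) (G j)) innerZl.
rewrite (@qform_gradGram j.+1 _ jk hlam) innerZl innerZr.
have -> : \sum_(s < j.+1) inner (ridge%:C *: H) (G s) ^+ 2 =
    ridge ^+ 2 * \sum_(s < j.+1) inner H (G s) ^+ 2.
  by rewrite mulr_sumr; apply: eq_bigr => s _; rewrite innerZl exprMn.
have := ld_concave (gradGram_pd j.+1) (gradGram_pd j).
have -> : gradGram j - gradGram j.+1 = (- (b / ridge))%:C *: (vec (G j) *m (vec (G j))^t*).
  by rewrite gradGram_recr opprD addrA subrr add0r rmorphN scaleNr.
rewrite innerZr -qform_inner.
have := ridge_gt0; have := b0.
move: (ld _) (ld _) (qform _ _) (inner _ _) (inner _ _) (\sum_(s < _) _) ridge.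
move=> v w q x y S L bb0 L0 h1 h2.
have h3 : 1 / (2 * L) * (- 2 * (L * y)) <= 1 / (2 * L) *
   (L * (L * x) + b / L * (L ^+ 2 * S) + q).
  by rewrite ler_wpM2l // divr_ge0 // mulr_ge0 // ltW.
have h4 : 1 / (2 * b) * (b / L * q) <= 1 / (2 * b) * (v - w).
  rewrite ler_wpM2l //; first by rewrite divr_ge0 // mulr_ge0 // ltW.
  by rewrite lerBrDr addrC -lerBrDr -mulNr.
have e3 : 1 / (2 * L) * (- 2 * (L * y)) = - y by field; rewrite gt_eqF.
have e4 : 1 / (2 * L) * (L * (L * x) + b / L * (L ^+ 2 * S) + q) =
  L / 2 * x + b / 2 * S + 1 / (2 * L) * q by field; rewrite gt_eqF.
have e5 : 1 / (2 * b) * (b / L * q) = 1 / (2 * L) * q.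
  by field; rewrite !gt_eqF.
rewrite e3 e4 in h3; rewrite e5 in h4; lra.
Qed.

Lemma stab_le j : (j <= k)%N ->
  phi b B eta l X G D j.+1 (X j) - phi b B eta l X G D j.+1 (X j.+1) <=
  1 / (2 * b) * (ld (gradGram j.+1) - ld (gradGram j)) + B / 3 * inner (X j) (D j).
Proof.
move=> jk; have jk' := leqW jk; apply: (le_trans (stab_ineq jk)).
have m0 : 0 <= drift j by exact: sqrtr_ge0.
have m5 := (drift_bias_norm_le j).2 jk.
have frob : inner (X j.+1 - X j) (X j.+1 - X j) <= drift j ^+ 2.
  rewrite /drift sqr_sqrtr; last exact: locsq_ge0 (X_pd jk') (step_herm jk).
  by apply: inner_loc_frob (X_pd jk') _ (step_herm jk); case: (X_density jk').
have pot := potential_step jk (step_herm jk).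
have bias := bias_le e0 Be (drift j) (bias_norm j).
have inc : B / 3 * bias_norm j ^+ 2 <= B / 3 * inner (X j) (D j).
  by rewrite ler_wpM2l ?bias_norm_sq_le // divr_ge0 ?(ltW B_gt0).
have ei0 : 0 < eta^-1 by rewrite invr_gt0.
have curv : eta^-1 * (9 / 20 * drift j ^+ 2) <=
    eta^-1 * (drift j ^+ 2 / (2 * (1 + drift j))).
  by rewrite (ler_pM2l ei0); exact: curvature_le m0 (drift_small jk).
have frob2 : ridge / 2 * inner (X j.+1 - X j) (X j.+1 - X j) <=
    eta^-1 * (9 / 40 * drift j ^+ 2).
  have -> : ridge / 2 = eta^-1 * (9 / 40) by rewrite /ridge; field; rewrite gt_eqF.
  by rewrite -(mulrA eta^-1) (ler_pM2l ei0) ler_wpM2l.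
move: pot bias inc curv frob2.
move: (inner _ (G j)) (b / 2 * _) (B * _) (eta^-1 * (_ / _)) (1 / _ * _).
move: (B / 3 * inner _ _) (B / 3 * _) (ridge / 2 * _) (drift j ^+ 2) => *; lra.
Qed.

Lemma sum_stab_le :
  \sum_(j < k.+1) (phi b B eta l X G D j.+1 (X j) - phi b B eta l X G D j.+1 (X j.+1))
  <= 1 / (2 * b) * ld (gradGram k.+1) + B / 3 * \sum_(j < k.+1) inner (X j) (D j).
Proof.
have ld1 : ld (gradGram 0) = 0 by rewrite gradGram0 /ld det1 ln1.
have -> : ld (gradGram k.+1) = \sum_(j < k.+1) (ld (gradGram j.+1) - ld (gradGram j)).
  rewrite -(big_mkord xpredT (fun j => ld (gradGram j.+1) - ld (gradGram j))).
  by rewrite telescope_sumr // ld1 subr0.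
rewrite !mulr_sumr -big_split; apply: ler_sum => j _ /=; apply: stab_le.
by rewrite -ltnS.
Qed.

(** The surrogate of round [j] equals [l j] at [X j], so [phi j.+1 (X j)] is [phi j (X j)] plus a
    loss minus a bias, and the rest telescopes. *)
Lemma sum_gap :
  \sum_(j < k.+1) (phi b B eta l X G D j.+1 (X j) - phi b B eta l X G D j.+1 (X j.+1))
  = \sum_(j < k.+1) l j - B * \sum_(j < k.+1) inner (X j) (D j)
    + phi b B eta l X G D 0 (X 0%N) - phi b B eta l X G D k.+1 (X k.+1).
Proof.
elim: k.+1 => [|j IH]; first by rewrite !big_ord0; ring.
rewrite !big_ord_recr /= IH (phi_recr _ _ _ _ _ _ _ j (X j)).
have -> : inner (X j - X j) (G j) = 0 by rewrite subrr inner0l.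
move: (phi _ _ _ _ _ _ _ _ _) (phi _ _ _ _ _ _ _ _ _) (phi _ _ _ _ _ _ _ _ _).
move: (inner _ _) (\sum_(i < j) inner _ _) (\sum_(i < j) _) (l j) => *; ring.
Qed.

Lemma sum_stepP j : \sum_(i < j.+1) D i = P j - prevP 0.
Proof.
elim: j => [|j IH]; first by rewrite big_ord1.
by rewrite big_ord_recr IH /stepP /= addrC addrA subrK.
Qed.

Lemma qobj_bias j Z : qobj b B l X G D j Z =
  qobj b 0 l X G D j Z - B * inner Z (\sum_(i < j) D i).
Proof.
rewrite inner_sumr mulr_sumr /qobj -sumrB; apply: eq_bigr => s _; ring.
Qed.

(** [U k.+1] is used as a competitor of [X k.+1] in the biased problem, where its biases sum to
    [<U k.+1, P k> - n]. The factor [4 / 3] is 1 for the biases at the played points plus [1 / 3]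
    from [stab_le]. *)
Lemma sum_loss_le : \sum_(j < k.+1) l j <=
  phi b 0 eta l X G D k.+1 (U k.+1) + eta^-1 * ld (X 0%N)
  - B * (inner (U k.+1) (P k) - n%:R) + 1 / (2 * b) * ld (gradGram k.+1)
  + 4 / 3 * B * \sum_(j < k.+1) inner (X j) (D j).
Proof.
have := sum_stab_le; rewrite sum_gap.
have [_ _ hmin] := hX (leqnn k.+1).
have := hmin _ (U_density (leqnn _)) (U_pd (leqnn _)).
have -> : phi b B eta l X G D k.+1 (U k.+1) =
    phi b 0 eta l X G D k.+1 (U k.+1) - B * (inner (U k.+1) (P k) - n%:R).
  rewrite /phi qobj_bias sum_stepP innerBr inner_scalar.
  have [_ ->] := U_density (leqnn k.+1); rewrite /= mulr1; ring.
have -> : phi b B eta l X G D 0 (X 0%N) = - (eta^-1 * ld (X 0%N)).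
  by rewrite /phi /qobj big_ord0 sub0r.
move: (eta^-1 * _) (phi _ _ _ _ _ _ _ _ _) (phi _ _ _ _ _ _ _ _ _).
move: (\sum_(j < k.+1) _) (\sum_(j < k.+1) _) (1 / _ * _) (inner _ _ - _) => *; lra.
Qed.

Definition play_inner s := inner (X s) (Rs s).

Lemma play_inner_gt0 s : (s <= k)%N -> 0 < play_inner s.
Proof. by move=> sk; exact: inner_pd_gt0 (X_pd (leqW sk)) (hR sk). Qed.

Lemma U_ratio s j : (s <= j)%N -> (j <= k)%N ->
  inner (U j) (Rs s) / play_inner s <= c.
Proof.
move=> sj jk; have sk := leq_trans sj jk.
rewrite (ler_pdivrMr _ _ (play_inner_gt0 sk)).
apply: no_reset_inner (P_pd (leqW jk)) (X_pd (leqW sk)) _ (hr jk) (ltW reset_level_gt0) _.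
  exact: P_ge_inv_le sj (leqW jk).
by case: (hR sk).
Qed.

Lemma inner_gradX Z s : inner Z (G s) = - (inner Z (Rs s) / play_inner s).
Proof. exact: inner_grad. Qed.

Lemma inner_sub_gradX Z s : (s <= k)%N ->
  inner (Z - X s) (G s) = 1 - inner Z (Rs s) / play_inner s.
Proof.
move=> sk; rewrite innerBl !inner_gradX -/(play_inner s) divff ?gt_eqF ?play_inner_gt0 //.
by rewrite opprK addrC.
Qed.

Definition udrift := Num.sqrt (locsq (U k) (U k.+1 - U k)).

Lemma Ustep_herm : (U k.+1 - U k)^t* = U k.+1 - U k.
Proof. exact: density_sub_herm (U_density (leqnSn k)) (U_density (leqnn _)). Qed.

Lemma Ustep_inner s : (s <= k)%N ->
  inner (U k.+1 - U k) (Rs s) <= udrift * inner (U k) (Rs s).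
Proof.
move=> sk; apply: inner_loc (U_pd (leqnSn k)) Ustep_herm _.
by case: (hR sk).
Qed.

(** No reset at [k] means [b * q <= 1 / 2], so the slope factor [1 + b * (1 - q)] is nonnegative and
    may multiply the bound of [Ustep_inner]; [quadratic_le] then controls the product whatever the
    size of the gradient. *)
Lemma udrift_le : udrift <= 1 / 5.
Proof.
have m0 : 0 <= udrift by exact: sqrtr_ge0.
apply: (udrift_solve b0 b1 e0 eb m0).
have := stability (ltW b0) e0 (hU (leqnSn k)) (U_density (leqnn k.+1)) (U_pd (leqnn k.+1)).
rewrite -/udrift mul0r addr0 inner_sub_gradX // inner_gradX.
set q := inner (U k) (Rs k) / play_inner k.
have [_ _ hmin] := hU (leqnn k.+1).
have := hmin _ (U_density (leqnSn k)) (U_pd (leqnSn k)).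
have bq : b * q <= 1 / 2.
  apply: (le_trans _ reset_level_mul_le); rewrite mulrC (ler_pM2r b0).
  exact: U_ratio (leqnn k) (leqnn k).
have zq : inner (U k.+1 - U k) (Rs k) / play_inner k <= udrift * q.
  by rewrite /q mulrA (ler_pM2r _) ?invr_gt0 ?play_inner_gt0 // Ustep_inner.
have s0 : 0 <= 1 + b * (1 - q) by have := b0 => b0'; lra.
have h1 := ler_wpM2l s0 zq.
have h2 := ler_wpM2l m0 (quadratic_le b0 q).
have h3 : 0 <= b / 2 * (\sum_(s < k.+1) inner (U k.+1 - U k) (G s) ^+ 2).
  rewrite mulr_ge0 ?divr_ge0 ?(ltW b0) ?sumr_ge0 // => s _; exact: sqr_ge0.
move: h1 h2 h3.
have -> : (1 + b * (1 - q)) * (udrift * q) = udrift * (q * (1 + b * (1 - q))) by ring.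
rewrite mulrN.
move: (phi _ _ _ _ _ _ _ _ _) (phi _ _ _ _ _ _ _ _ _) (eta^-1 * _).
move: (udrift * _) (udrift * (q * _)) (b / 2 * _) ((1 + b * (1 - q)) * _) => *; lra.
Qed.

Lemma U_last_ratio s : (s <= k)%N ->
  b * (inner (U k.+1) (Rs s) / play_inner s) <= 3 / 5.
Proof.
move=> sk; have x0 := play_inner_gt0 sk.
have h1 := Ustep_inner sk.
have h2 := U_ratio sk (leqnn k).
have u0 := inner_pd_gt0 (U_pd (leqnSn k)) (hR sk).
rewrite innerBl in h1.
have h3 : inner (U k.+1) (Rs s) <= 6 / 5 * inner (U k) (Rs s).
  have := ler_wpM2r (ltW u0) udrift_le; move: h1.
  move: (inner _ _) (inner _ _) (udrift * _) => *; lra.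
have h4 : inner (U k.+1) (Rs s) / play_inner s <= 6 / 5 * c.
  apply: le_trans (_ : 6 / 5 * (inner (U k) (Rs s) / play_inner s) <= _).
    by rewrite mulrA ler_pM2r ?invr_gt0.
  by rewrite ler_pM2l.
have h5 := ler_wpM2l (ltW b0) h4; apply: (le_trans h5).
have := reset_level_mul_le; move: c => c' hc; lra.
Qed.

(** The ratios of [W] may be so large that a surrogate exceeds the loss at [W]. Only its tangent at
    [U k.+1] is compared there, and the first-order condition together with concavity of [ld] makes
    the tangent suffice. *)
Lemma surrogate_dominated W : density n W -> pdmx W ->
  phi b 0 eta l X G D k.+1 (U k.+1) <=
  \sum_(s < k.+1) (- ln (inner W (Rs s))) - eta^-1 * ld W.
Proof.
move=> dW pW; set u := U k.+1.
have fo := is_min_first_order (ltW b0) e0 (hU (leqnn k.+1)) dW.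
have cc := ld_concave (U_pd (leqnn k.+1)) pW.
have cc2 := ler_wpM2l (ltW (etrans (invr_gt0 eta) e0)) cc.
have key : qobj b 0 l X G D k.+1 u + qdir b 0 X G D k.+1 u (W - u) <=
    \sum_(s < k.+1) (- ln (inner W (Rs s))).
  rewrite /qobj /qdir -big_split; apply: ler_sum => s _ /=.
  have sk : (s <= k)%N by rewrite -ltnS.
  have x0 := play_inner_gt0 sk; have w0 := inner_pd_gt0 pW (hR sk).
  have u0 := inner_pd_gt0 (U_pd (leqnn k.+1)) (hR sk).
  rewrite !mul0r !subr0 inner_sub_gradX // inner_gradX innerBl.
  have := tangent_le_log b0 b1 (divr_gt0 u0 x0) (U_last_ratio sk) (divr_gt0 w0 x0).
  rewrite ln_div ?posrE // mulrBl.
  rewrite /lossX -/(play_inner s).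
  move: (ln _) (ln _) (_ / play_inner s) (_ / play_inner s) => *; lra.
rewrite {1}/phi -/u; move: fo cc2 key; rewrite -/u mulrDr.
move: (eta^-1 * ld _) (eta^-1 * ld _) (eta^-1 * _) (qobj _ _ _ _ _ _ _ _).
move: (qdir _ _ _ _ _ _ _ _) (\sum_(s < _) _) => *; lra.
Qed.

(* Bounds <P k, Y> over all densities Y, hence also every 1 / <X s, Rs s>. *)
Definition P_bound := c * (n%:R + eta * (k%:R * ((1 + b) ^+ 2 / (4 * b)))).

Lemma P_bound_gt0 : 0 < P_bound.
Proof.
rewrite mulr_gt0 ?reset_level_gt0 // ltr_pwDl ?nR_gt0 // mulr_ge0 ?(ltW e0) //.
by rewrite mulr_ge0 // divr_ge0 ?sqr_ge0 // mulr_ge0 // ltW.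
Qed.

(** As [b * q <= 1 / 2], the part of each slope that involves [Y] has a favourable sign, and
    [quadratic_le] bounds the rest. The first-order condition of [U k] converts these slopes into a
    bound on its inverse. *)
Lemma U_inv_le Y : density n Y ->
  inner (invmx (U k)) Y <= n%:R + eta * (k%:R * ((1 + b) ^+ 2 / (4 * b))).
Proof.
move=> dY; have fo := is_min_first_order (ltW b0) e0 (hU (leqnSn k)) dY.
have : qdir b 0 X G D k (U k) (Y - U k) <= k%:R * ((1 + b) ^+ 2 / (4 * b)).
  rewrite mulr_natl -[X in _ *+ X]card_ord -sumr_const; apply: ler_sum => s _.
  have sk : (s <= k)%N by exact: ltnW.
  have x0 := play_inner_gt0 sk; rewrite mul0r subr0 inner_sub_gradX // inner_gradX innerBl.
  apply: (le_trans _ (quadratic_le b0 (inner (U k) (Rs s) / play_inner s))).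
  have q1 := U_ratio sk (leqnn k); set q := _ / _ in q1 *.
  have y0 : 0 <= inner Y (Rs s) / play_inner s.
    apply: divr_ge0 (ltW x0); apply: inner_psd_ge0; first by case: dY.
    by case: (hR sk).
  have bq : b * q <= 1 / 2.
    by apply: (le_trans _ reset_level_mul_le); rewrite mulrC (ler_pM2r b0).
  have s0 : 0 <= 1 + b * (1 - q) by have := b0 => b0'; lra.
  have := mulr_ge0 s0 y0; rewrite mulrBl -/q.
  move: (inner Y _ / _) => y; lra.
move: fo; rewrite innerBr inner_inv_self; last exact: U_pd (leqnSn k).
rewrite subr_ge0 => h1 h2; have := le_trans h1 h2.
rewrite mulrC ler_pdivrMr // [_ * eta]mulrC; lra.
Qed.

Lemma inner_P_le Y : density n Y -> inner (P k) Y <= P_bound.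
Proof.
move=> dY; have pY : psdmx Y by case: dY.
have h := no_reset_inv (P_pd (leqnSn k)) (U_pd (leqnSn k)) reset_level_gt0 (hr (leqnn k)).
apply: (le_trans (inner_le h pY)); rewrite innerZl /P_bound (ler_pM2l reset_level_gt0).
exact: U_inv_le.
Qed.

(** [X s] has its inverse below [P k], so [inner_P_le] bounds [<(X s)^-1, Rs s>], and [inner_inv_ge]
    converts this into a lower bound on [<X s, Rs s>]. *)
Lemma play_inner_ge s : (s <= k)%N -> 1 <= play_inner s * P_bound.
Proof.
move=> sk; apply: (le_trans (inner_inv_ge (X_pd (leqW sk)) (hR sk))).
rewrite (ler_pM2l (play_inner_gt0 sk)); apply: le_trans (inner_P_le (hR sk)).
by apply: inner_le (P_ge_inv_le sk (leqnSn k)) _; case: (hR sk).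
Qed.

Lemma ld_P_le : ld (P k) <= n%:R * ln P_bound.
Proof.
have := ld_le_tr P_bound_gt0 (P_pd (leqnSn k)).
have := inner_P_le (density_uniform n0); rewrite inner_scalar.
rewrite (ler_pdivrMl _ _ nR_gt0) -(ler_pdivrMr _ _ P_bound_gt0).
move: (_ / P_bound) (ld _) (_ * ln _) => *; lra.
Qed.

Lemma sum_inner_stepP_le :
  \sum_(j < k.+1) inner (X j) (D j) <= n%:R * ln P_bound - n%:R * ln n%:R.
Proof.
apply: le_trans (_ : ld (P k) - ld (prevP 0) <= _); last first.
  by rewrite [ld (prevP 0)](ld_scalar nR_gt0) lerD2r ld_P_le.
have h j : (j <= k)%N ->
    \sum_(i < j.+1) inner (X i) (D i) <= ld (P j) - ld (prevP 0).
  elim: j => [|j IH] jk; rewrite big_ord_recr /=.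
    rewrite big_ord0 add0r lerBrDr addrC /stepP (hP (leq0n _)).
    exact: update_P_ld (X_pd (leq0n _)) (prevP_herm (leq0n _)) (prevP_pd (leq0n _)).
  have := update_P_ld (X_pd (leqW jk)) (prevP_herm (leqW jk)) (prevP_pd (leqW (leqW jk))).
  rewrite -(hP (leqW jk)) -/(stepP j.+1) /=.
  have := IH (ltnW jk); move: (ld _) (ld _) (ld _) (\sum_(i < _) _) => *; lra.
exact: h.
Qed.

(** By [play_inner_ge] each outer product has trace at most [P_bound ^+ 2]. The bound [cc] on the
    average eigenvalue stays free until the tuning, which takes [T^3]. *)
Lemma ld_gradGram_le (cc : R) : 0 < cc ->
  n%:R ^+ 2 + b / ridge * (k.+1%:R * P_bound ^+ 2) <= n%:R ^+ 2 * cc ->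
  ld (gradGram k.+1) <= n%:R ^+ 2 * ln cc.
Proof.
move=> cc0 hcc.
have trG j : (j <= k.+1)%N -> complex.Re (\tr (gradGram j)) <=
    n%:R ^+ 2 + b / ridge * (j%:R * P_bound ^+ 2).
  elim: j => [|j IH] jk.
    rewrite gradGram0 mxtrace1 -(rmorph_nat (real_complex R)) /= natrM mul0r mulr0 addr0.
    by rewrite expr2.
  rewrite gradGram_recr mxtraceD ReD mxtraceZ ReMl (tr_outer (@gradX_herm j jk)).
  have gg : inner (G j) (G j) <= P_bound ^+ 2.
    have x0 := @play_inner_gt0 j jk; have x1 := @play_inner_ge j jk.
    rewrite inner_gradX innerC inner_gradX mulNr opprK.
    have r1 := inner_self_le1 (@hR j jk).
    rewrite !ler_pdivrMr // (le_trans r1) // -mulrA -expr2 -exprMn mulrC.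
    by rewrite exprn_ege1.
  have bl : 0 <= b / ridge by rewrite divr_ge0 ?(ltW b0) ?(ltW ridge_gt0).
  have := ler_wpM2l bl gg; have := IH (ltnW jk); rewrite -[j.+1%:R]natr1.
  move: (complex.Re _) (inner _ _) (b / ridge) (P_bound ^+ 2) => *; lra.
have := ld_le_tr cc0 (gradGram_pd k.+1); have := trG _ (leqnn _).
move=> h1 h2; apply: (le_trans h2); rewrite natrM -expr2.
have := le_trans h1 hcc; rewrite -(ler_pdivrMr _ _ cc0).
move: (_ / cc) (_ * ln _) => *; lra.
Qed.

Lemma epoch_regret W (cc : R) : density n W -> pdmx W -> 0 < cc ->
  n%:R ^+ 2 + b / ridge * (k.+1%:R * P_bound ^+ 2) <= n%:R ^+ 2 * cc ->
  \sum_(s < k.+1) (l s + ln (inner W (Rs s))) <=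
    eta^-1 * (ld (X 0%N) - ld W)
    + 4 / 3 * B * (n%:R * ln P_bound - n%:R * ln n%:R)
    + 1 / (2 * b) * (n%:R ^+ 2 * ln cc)
    - B * (inner (U k.+1) (P k) - n%:R).
Proof.
move=> dW pW cc0 hcc.
have h1 := sum_loss_le; have h2 := surrogate_dominated dW pW.
have h3 : 4 / 3 * B * \sum_(j < k.+1) inner (X j) (D j) <=
    4 / 3 * B * (n%:R * ln P_bound - n%:R * ln n%:R).
  by rewrite ler_wpM2l ?sum_inner_stepP_le // mulr_ge0 // ltW // B_gt0.
have h4 : 1 / (2 * b) * ld (gradGram k.+1) <= 1 / (2 * b) * (n%:R ^+ 2 * ln cc).
  by rewrite ler_wpM2l ?(ld_gradGram_le cc0 hcc) // divr_ge0 // mulr_ge0 // ltW.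
rewrite big_split /= [eta^-1 * _]mulrBr; rewrite sumrN in h2.
move: h1 h2 h3 h4.
move: (phi _ _ _ _ _ _ _ _ _) (B * (inner _ _ - _)) (4 / 3 * B * (_ - _)).
move: (4 / 3 * B * _) (1 / _ * _) (1 / (2 * b) * ld _) (eta^-1 * _) (eta^-1 * _).
move: (\sum_(s < k.+1) _) (\sum_(s < k.+1) _) => *; lra.
Qed.

Lemma U_last_nneg : 0 <= inner (U k.+1) (P k) - n%:R.
Proof.
have [pu tu] := U_density (leqnn k.+1).
have -> : inner (U k.+1) (P k) - n%:R = inner (U k.+1) (P k - prevP 0).
  by rewrite innerBr inner_scalar tu mulr1.
rewrite -sum_stepP inner_sumr; apply: sumr_ge0 => j _; apply: inner_psd_ge0 => //.
by apply: stepP_psd; rewrite ltnW // ltnS.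
Qed.

(** The reset is tested on [P k.+1], whereas the regret contains [P k]. The update between them has
    norm at most [5 * eta], which costs the factor [1 - 5 * eta]. *)
Lemma reset_gain : ~ loewner_lt (U k.+1) (c%:C *: invmx (P k.+1)) ->
  (1 - 5 * eta) * c <= inner (U k.+1) (P k).
Proof.
move=> hn; have [pu _] := U_density (leqnn k.+1).
have := reset_inner (P_pd (leqnn k.+1)) pu hn.
have e1' := e1; have e0' := e0.
have m0 : 0 <= 5 * eta by lra.
have m1 : 5 * eta < 1 by lra.
have hi := bias_norm_sq (leqnn k.+1).
have h5 : bias_norm k.+1 ^+ 2 <= (5 * eta) ^+ 2.
  rewrite ler_sqr ?nnegrE ?sqrtr_ge0 //; exact: (drift_bias_norm_le k.+1).1.
rewrite hi /stepP (hP (leqnn _)) in h5.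
have := update_P_le_scale (X_pd (leqnn _)) (prevP_herm (leqnn _)) m0 m1 h5.
rewrite -(hP (leqnn _)) /= => h6.
have := inner_le h6 pu; rewrite innerZl ![inner _ (U _)]innerC => h7 h8.
apply: le_trans h7; rewrite ler_wpM2l //; lra.
Qed.

End Epoch.

(** * The tuned parameters *)

Section Tuning.
Context {R : realType}.
Variables (d T : nat).
Hypotheses (d1 : (1 <= d)%N) (hT : (110 * d ^ 2 <= T)%N).

Local Notation dR := (d%:R : R).
Local Notation TR := (T%:R : R).
Local Notation L := (ln TR).
Definition tunedB : R := 264 / 5 * dR ^+ 2 * L.
Local Notation B := tunedB.
Definition tuned_eta : R := 1 / (4 * B).
Local Notation eta := tuned_eta.
Definition tuned_beta : R := 11 * dR / (7 * B).
Local Notation b := tuned_beta.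

Lemma tunedBE : B = 264 / 5 * dR ^+ 2 * L. Proof. by []. Qed.
Lemma tuned_etaE : eta = 1 / (4 * B). Proof. by []. Qed.
Lemma tuned_betaE : b = 11 * dR / (7 * B). Proof. by []. Qed.
Local Opaque tunedB tuned_eta tuned_beta.

Lemma natR_ge1 : 1 <= dR. Proof. by rewrite ler1n. Qed.

Lemma natT_ge : 110 * dR ^+ 2 <= TR.
Proof. by rewrite -natrX -natrM ler_nat. Qed.

Lemma natT_ge110 : 110 <= TR.
Proof.
apply: le_trans natT_ge; have := exprn_ege1 2 natR_ge1; move: (dR ^+ 2) => x; lra.
Qed.

Lemma expR1_le4 : expR 1 <= 4 :> R.
Proof.
have h : 1 / 2 <= expR (- (1 / 2)) :> R.
  by have := @expR_ge1Dx R (- (1 / 2)); lra.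
have h2 : expR 1 * (expR (- (1 / 2)) * expR (- (1 / 2))) = 1 :> R.
  by rewrite -!expRD -[RHS]expR0; congr expR; field.
have := expR_gt0 (1 : R); move: (expR 1) (expR (- (1 / 2))) h h2 => x y h h2 x0.
have : 1 / 4 <= y * y by nra.
nra.
Qed.

(** [exp 3 <= 4^3 = 64 <= 110 <= T]. *)
Lemma lnT_ge3 : 3 <= L.
Proof.
have h := natT_ge110.
have -> : 3 = ln (expR 3) :> R by rewrite expRK.
rewrite ler_ln ?posrE ?expR_gt0 //; last by lra.
apply: le_trans h.
have -> : expR 3 = expR 1 ^+ 3 :> R by rewrite -expRM_natl mulr1.
apply: (le_trans (lerXn2r 3 _ _ expR1_le4)); rewrite ?nnegrE ?expR_ge0 //.
by rewrite -natrX ler_nat.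
Qed.

Lemma tunedB_ge : 150 <= B.
Proof.
rewrite tunedBE; have := exprn_ege1 2 natR_ge1; have := lnT_ge3.
move: (dR ^+ 2) L => x y; nra.
Qed.

Lemma tunedB_gt0 : 0 < B. Proof. by have := tunedB_ge; lra. Qed.

Lemma tunedB_dL : B = 264 / 5 * dR * (dR * L).
Proof. by rewrite tunedBE expr2 !mulrA. Qed.

Lemma nat_tunedB_gt0 k : 0 < k.+1%:R * B.
Proof. by apply: mulr_gt0; [rewrite ltr0n|exact: tunedB_gt0]. Qed.

Lemma tuned_beta_gt0 : 0 < b.
Proof.
rewrite tuned_betaE; apply: divr_gt0 (nat_tunedB_gt0 6).
by apply: mulr_gt0; [rewrite ltr0n|rewrite ltr0n].
Qed.

(** After cancellation [b] is [5 / (168 d L)], with [d >= 1] and [L >= 3]. *)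
Lemma tuned_beta_le : b <= 1 / 100.
Proof.
rewrite tuned_betaE (ler_pdivrMr _ _ (nat_tunedB_gt0 6)).
have := natR_ge1; have := lnT_ge3; rewrite tunedB_dL; move: L => y hy hd.
have : dR * 3 <= dR * y by rewrite ler_wpM2l.
move: (dR * y) => z hz.
have : 3 * dR <= dR * z by nra.
lra.
Qed.

Lemma tuned_eta_gt0 : 0 < eta.
Proof. rewrite tuned_etaE; exact: divr_gt0 ltr01 (nat_tunedB_gt0 3). Qed.

Lemma tuned_eta_le : eta <= 1 / 100.
Proof.
by rewrite tuned_etaE (ler_pdivrMr _ _ (nat_tunedB_gt0 3)); have := tunedB_ge; lra.
Qed.

Lemma natR_neq0 : dR != 0. Proof. by rewrite gt_eqF // ltr0n. Qed.
Lemma lnT_neq0 : L != 0.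
Proof. by rewrite gt_eqF // (lt_le_trans _ lnT_ge3). Qed.
Lemma tunedB_neq0 : B != 0. Proof. by rewrite gt_eqF // tunedB_gt0. Qed.
Lemma tuned_beta_neq0 : b != 0. Proof. by rewrite gt_eqF // tuned_beta_gt0. Qed.
Lemma one_tuned_eta_gt0 : 0 < 1 + 6 * eta.
Proof. by have := tuned_eta_gt0; lra. Qed.
Lemma one_tuned_eta_neq0 : 1 + 6 * eta != 0.
Proof. by rewrite gt_eqF // one_tuned_eta_gt0. Qed.

Let tuned_neq0 :=
  (natR_neq0, lnT_neq0, tunedB_neq0, tuned_beta_neq0, one_tuned_eta_neq0).

Lemma tunedB_eta : B * eta = 1 / 4.
Proof. by rewrite tuned_etaE; field; rewrite gt_eqF ?tunedB_gt0. Qed.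

Lemma tuned_eta_beta : 44 * eta <= 7 * b.
Proof.
have B0 := tunedB_gt0.
have -> : 44 * eta = 11 / B by rewrite tuned_etaE; field; rewrite ?tuned_neq0.
have -> : 7 * b = 11 * dR / B by rewrite tuned_betaE; field; rewrite gt_eqF.
by rewrite ler_pM2r ?invr_gt0 // ler_peMr // natR_ge1.
Qed.

Lemma half_inv_beta : 1 / (2 * b) = 84 / 5 * (dR * L).
Proof.
have B0 := tunedB_gt0; have h1 := natR_ge1; have h3 := lnT_ge3.
by rewrite tuned_betaE tunedB_dL; field; rewrite natR_neq0 lnT_neq0.
Qed.

Lemma tuned_eta_div_beta : eta / (4 * b) = 7 / (176 * dR).
Proof.
have B0 := tunedB_gt0; have h1 := natR_ge1.
by rewrite tuned_betaE tuned_etaE; field; rewrite ?tuned_neq0.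
Qed.

Local Notation c := ((2 * (1 + 6 * eta) * b)^-1).

Lemma reset_levelE : c = 84 / 5 * (dR * L) / (1 + 6 * eta).
Proof.
rewrite -half_inv_beta; have := tuned_eta_gt0 => e0; have := tuned_beta_gt0 => b0.
by field; rewrite ?tuned_neq0.
Qed.

Lemma reset_level_le : c <= 84 / 5 * (dR * L).
Proof.
have e0 := tuned_eta_gt0.
have dL : 0 <= dR * L by rewrite mulr_ge0 // ?(le_trans _ lnT_ge3).
rewrite reset_levelE ler_pdivrMr; last by lra.
rewrite ler_peMr //; last by lra.
by rewrite mulr_ge0.
Qed.

Lemma reset_level_gt1 : 1 < c.
Proof.
have e0 := tuned_eta_gt0; have e1 := tuned_eta_le; have h1 := natR_ge1; have h3 := lnT_ge3.
rewrite reset_levelE ltr_pdivlMr; last by lra.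
have : 1 * 3 <= dR * L by apply: ler_pM.
move: (dR * L) => x; lra.
Qed.

Lemma P_bound_le k : (k <= T)%N -> P_bound (n := d) b eta k <= L * TR.
Proof.
move=> kT; have h1 := natR_ge1; have h3 := lnT_ge3; have hTR := natT_ge.
have b0 := tuned_beta_gt0; have b1 := tuned_beta_le; have e0 := tuned_eta_gt0.
have kTR : k%:R <= TR by rewrite ler_nat.
have T0 : 0 <= TR by [].
have inner_le : dR + eta * (k%:R * ((1 + b) ^+ 2 / (4 * b))) <=
    dR + 7 / (176 * dR) * (TR * (41 / 40)).
  rewrite lerD2l.
  have -> : eta * (k%:R * ((1 + b) ^+ 2 / (4 * b))) =
      7 / (176 * dR) * (k%:R * (1 + b) ^+ 2).
    by rewrite -tuned_eta_div_beta; field; rewrite ?tuned_neq0.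
  rewrite ler_wpM2l //.
  by apply: ler_pM => //; [exact: sqr_ge0|nra].
have in0 : 0 <= dR + eta * (k%:R * ((1 + b) ^+ 2 / (4 * b))).
  apply: addr_ge0 => //; apply: mulr_ge0 (ltW e0) _; apply: mulr_ge0 => //.
  by apply: divr_ge0 (sqr_ge0 _) _; apply: mulr_ge0 (ltW b0).
have c0 : 0 <= c by rewrite (le_trans ler01) // ltW // reset_level_gt1.
rewrite /P_bound; apply: (le_trans (ler_pM c0 in0 reset_level_le inner_le)).
have -> : 84 / 5 * (dR * L) * (dR + 7 / (176 * dR) * (TR * (41 / 40))) =
   L * (84 / 5 * (dR ^+ 2 + 7 * 41 / 7040 * TR)).
  by field; rewrite ?tuned_neq0.
(* What remains is [84 / 5 * (d^2 + 287 / 7040 * T) <= T]; with [d^2 <= T / 110] the left side is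
   about [0.84 T]. *)
rewrite ler_wpM2l //; last by lra.
by rewrite (le_trans _ h3).
Qed.

Lemma ln_P_bound_le k : (k <= T)%N -> ln (P_bound (n := d) b eta k) <= 2 * L.
Proof.
move=> kT; have h3 := lnT_ge3; have T110 := natT_ge110.
have k0 : 0 < P_bound (n := d) b eta k.
  by apply: P_bound_gt0 => //; [exact: tuned_beta_gt0|exact: tuned_eta_gt0].
have LT0 : 0 < L * TR by rewrite mulr_gt0 //; lra.
apply: (@le_trans _ _ (ln (L * TR))); first by rewrite ler_ln ?posrE // P_bound_le.
rewrite lnM ?posrE //; try lra.
have e : L = 1 + (L - 1) by ring.
have : ln (1 + (L - 1)) <= L - 1 by apply: le_ln1Dx; lra.
rewrite -e; lra.
Qed.

(** [P_bound ^+ 2] contributes [L^2 T^2], while [b / ridge] is of order [1 / (d^3 L^2)]: the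
    logarithms cancel, and the small constant left over makes [T^3] sufficient. *)
Lemma potential_budget k : (k < T)%N ->
  dR ^+ 2 + b / ridge eta * (k.+1%:R * P_bound (n := d) b eta k ^+ 2) <= dR ^+ 2 * TR ^+ 3.
Proof.
move=> kT; have h1 := natR_ge1; have h3 := lnT_ge3; have T110 := natT_ge110.
have b0 := tuned_beta_gt0; have e0 := tuned_eta_gt0; have B0 := tunedB_gt0.
have k0 : 0 < P_bound (n := d) b eta k by apply: P_bound_gt0.
have bl0 : 0 <= b / ridge eta.
  by apply: divr_ge0 (ltW b0) (ltW (ridge_gt0 e0)).
have -> : dR ^+ 2 * TR ^+ 3 = dR ^+ 2 + dR ^+ 2 * (TR ^+ 3 - 1) by ring.
rewrite lerD2l.
have LT0 : 0 <= L * TR by rewrite mulr_ge0 // (le_trans _ h3).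
have kk : k.+1%:R * P_bound (n := d) b eta k ^+ 2 <= TR * (L * TR) ^+ 2.
  apply: ler_pM; rewrite ?sqr_ge0 ?ler_nat //.
  rewrite ler_sqr ?nnegrE ?(ltW k0) ?LT0 //; exact: P_bound_le (ltnW kT).
apply: (le_trans (ler_wpM2l bl0 kk)).
have -> : b / ridge eta * (TR * (L * TR) ^+ 2) =
   220 * 25 / (252 * 264 ^+ 2) * (TR ^+ 3 / dR ^+ 3).
  rewrite /ridge tuned_betaE tuned_etaE tunedB_dL; field.
  by rewrite ?tuned_neq0.
have t3 : 1 * TR ^+ 3 - 1 >= 1 / 2 * TR ^+ 3.
  have : 110 * 1 <= TR * TR ^+ 2 by apply: ler_pM => //; rewrite exprn_ege1 //; lra.
  by rewrite -exprS; lra.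
have q : TR ^+ 3 / dR ^+ 3 <= TR ^+ 3.
  rewrite ler_pdivrMr ?exprn_gt0 //; last by lra.
  by rewrite ler_peMr ?exprn_ge0 ?exprn_ege1.
have r : TR ^+ 3 - 1 <= dR ^+ 2 * (TR ^+ 3 - 1).
  have T1 : 1 <= TR by lra.
  by apply: ler_peMl; rewrite ?subr_ge0 exprn_ege1.
have t0 : 0 <= TR ^+ 3 by rewrite exprn_ge0.
move: (TR ^+ 3) (TR ^+ 3 / _) (dR ^+ 2 * _) t3 q r t0 => x y z; lra.
Qed.

(** In units of [B d L] the three terms are at most 4 for the regularizer, [8 / 3] for the bias and
    [21 / 22] for the gradients, together less than 8. *)
Lemma epoch_budget k (G : R) : (k < T)%N -> G <= dR * L ->
  eta^-1 * G + 4 / 3 * B * (dR * ln (P_bound (n := d) b eta k) - dR * ln dR)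
  + 1 / (2 * b) * (dR ^+ 2 * ln (TR ^+ 3)) <= 8 * (B * (dR * L)).
Proof.
move=> kT hG; have B0 := tunedB_gt0; have h1 := natR_ge1; have h3 := lnT_ge3.
have lk := ln_P_bound_le (ltnW kT).
have ld0 : 0 <= ln dR by rewrite ln_ge0.
have -> : eta^-1 = 4 * B by rewrite tuned_etaE; field; rewrite ?tuned_neq0.
rewrite lnXn; last by have := natT_ge110; lra.
have -> : 1 / (2 * b) * (dR ^+ 2 * (L *+ 3)) = 21 / 22 * (B * (dR * L)).
  by rewrite half_inv_beta tunedBE -mulr_natr; field.
have hk : dR * ln (P_bound (n := d) b eta k) - dR * ln dR <= 2 * (dR * L).
  have : dR * ln (P_bound (n := d) b eta k) <= dR * (2 * L) by rewrite ler_wpM2l.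
  have : 0 <= dR * ln dR by rewrite mulr_ge0.
  move: (dR * ln _) (dR * ln _) => *; lra.
have g1 : 4 * B * G <= 4 * B * (dR * L) by rewrite ler_wpM2l // mulr_ge0 // ltW.
have g2 : 4 / 3 * B * (dR * ln (P_bound (n := d) b eta k) - dR * ln dR) <=
   4 / 3 * B * (2 * (dR * L)) by rewrite ler_wpM2l // mulr_ge0 // ltW.
have g3 : 0 <= B * (dR * L).
  by apply: mulr_ge0 (ltW B0) _; apply: mulr_ge0 => //; rewrite (le_trans _ h3).
move: g1 g2 g3; move: (_ - dR * _) (dR * L) => x y.
have -> : 4 * B * y = 4 * (B * y) by ring.
have -> : 4 / 3 * B * (2 * y) = 8 / 3 * (B * y) by ring.
move: (B * y) (4 * B * G) (4 / 3 * B * x) => *; lra.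
Qed.

(** [(1 - 5 eta) / (1 + 6 eta) >= 89 / 100] leaves at least [14 d L] in [u], and [d <= d L / 3]. *)
Lemma reset_budget (u : R) : (1 - 5 * eta) * c <= u ->
  8 * (B * (dR * L)) <= B * (u - dR).
Proof.
move=> hu; have B0 := tunedB_gt0; have h1 := natR_ge1; have h3 := lnT_ge3.
have e0 := tuned_eta_gt0; have e1 := tuned_eta_le.
have -> : 8 * (B * (dR * L)) = B * (8 * (dR * L)) by ring.
rewrite ler_pM2l //.
have dL : dR * 3 <= dR * L by rewrite ler_wpM2l //; lra.
have : 84 / 5 * (dR * L) * (89 / 100) <= (1 - 5 * eta) * c.
  rewrite reset_levelE [leRHS]mulrC -[leRHS]mulrA ler_wpM2l //.
    by rewrite mulr_ge0 // mulr_ge0 //; lra.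
  rewrite mulrC ler_pdivlMr; lra.
move: (dR * L) dL => x; lra.
Qed.

End Tuning.

(** * The algorithm *)

Section Run.
Context {R : realType} {d : nat}.
Local Notation C := (Num.ClosedField.sort (R[i] : numClosedFieldType)).
Variables (B eta beta : R).
Hypotheses (d0 : (0 < d)%N) (beta0 : 0 < beta) (eta0 : 0 < eta).

(* The step of the algorithm in which the reset condition is ignored. *)
Definition bisons_next (s : bisons_state d) (Rt : 'M[R[i]]_d) : bisons_state d :=
  let fhats := rcons (st_fhats s) (surrogate beta (st_X s) Rt) in
  let gs := rcons (st_gs s)
              (biased_surrogate B beta (st_X s) Rt (st_Pprev s) (st_P s)) in
  let X' := ftrl eta gs in
  BisonsState fhats gs X' (ftrl eta fhats) (st_P s) (update_P (st_P s) X').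

Lemma bisons_stepE s Rt : bisons_step B eta beta s Rt =
  if `[< no_reset eta beta (st_U (bisons_next s Rt)) (st_P (bisons_next s Rt)) >]
  then bisons_next s Rt else epoch_start d.
Proof. by []. Qed.

Variable Rt : nat -> 'M[C]_d.

Fixpoint run j : bisons_state d :=
  if j is i.+1 then bisons_next (run i) (Rt i) else epoch_start d.

Definition runX j : 'M[C]_d := st_X (run j).
Definition runU j : 'M[C]_d := st_U (run j).
Definition runP j : 'M[C]_d := st_P (run j).

Lemma run_Pprev j : st_Pprev (run j) = prevP runP j.
Proof. by case: j => [|j] //=; rewrite -(rmorph_nat (real_complex R)). Qed.

Lemma run_P j : runP j = update_P (prevP runP j) (runX j).
Proof. by rewrite -run_Pprev; case: j. Qed.

Lemma run_fhats j :
  st_fhats (run j) = [seq surrogate beta (runX i) (Rt i) | i <- iota 0 j].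
Proof. by elim: j => [//|j IH]; rewrite -[in RHS]addn1 iotaD map_cat cats1 /= IH. Qed.

Lemma run_gs j : st_gs (run j) =
  [seq biased_surrogate B beta (runX i) (Rt i) (prevP runP i) (runP i) | i <- iota 0 j].
Proof.
by elim: j => [//|j IH]; rewrite -[in RHS]addn1 iotaD map_cat cats1 /= IH run_Pprev.
Qed.

Local Notation l := (lossX Rt runX).
Local Notation G := (gradX Rt runX).
Local Notation D := (stepP runP).

Lemma loss_EFin (X : 'M[C]_d) A : pdmx X -> density d A ->
  loss A X = (- ln (inner X A))%:E.
Proof. by move=> pX dA; rewrite /loss lne_EFin // inner_pd_gt0. Qed.

Lemma sum_fhats j Z : (forall i, (i < j)%N -> density d (Rt i)) ->
  (forall i, (i < j)%N -> pdmx (runX i)) ->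
  (\sum_(f <- st_fhats (run j)) f Z)%E = (qobj beta 0 l runX G D j Z)%:E.
Proof.
move=> hR hX; rewrite run_fhats big_map -[X in iota 0 X]subn0 -/(index_iota 0 j).
rewrite big_mkord /qobj -sumEFin; apply: eq_bigr => i _.
rewrite /surrogate (loss_EFin (hX _ (ltn_ord i)) (hR _ (ltn_ord i))) -EFinD.
by rewrite mul0r subr0 addrA.
Qed.

Lemma sum_gs j Z : (forall i, (i < j)%N -> density d (Rt i)) ->
  (forall i, (i < j)%N -> pdmx (runX i)) ->
  (\sum_(f <- st_gs (run j)) f Z)%E = (qobj beta B l runX G D j Z)%:E.
Proof.
move=> hR hX; rewrite run_gs big_map -[X in iota 0 X]subn0 -/(index_iota 0 j).
rewrite big_mkord /qobj -sumEFin; apply: eq_bigr => i _.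
rewrite /biased_surrogate /surrogate.
rewrite (loss_EFin (hX _ (ltn_ord i)) (hR _ (ltn_ord i))).
by rewrite /lossX -EFinN -!EFinD addrA.
Qed.

Lemma is_min0 b' B' l' (Xs' Gs' Ds' : nat -> 'M[C]_d) :
  is_min b' B' eta l' Xs' Gs' Ds' 0 (argmin (density d) logdet_reg).
Proof.
(* [epoch_start] minimizes the bare regularizer, so parameter 1 is used; the positive factor
   [eta^-1] does not move the minimizer. *)
have h := @argmin_is_min R d b' B' 1 l' Xs' Gs' Ds' ltr01 d0 0 logdet_reg.
have [X|dX pX hmin] := h; first by rewrite /qobj big_ord0 add0e invr1 mul1e.
split=> // Y dY pY; have := hmin Y dY pY.
rewrite /phi /qobj !big_ord0 !sub0r invr1 !mul1r !lerN2.
by rewrite ler_pM2l ?invr_gt0.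
Qed.

Lemma run_is_min j : (forall i, (i < j)%N -> density d (Rt i)) ->
  is_min beta B eta l runX G D j (runX j) /\
  is_min beta 0 eta l runX G D j (runU j).
Proof.
elim/ltn_ind: j => -[|j] IH hR.
  by split; exact: is_min0.
have hX i : (i < j.+1)%N -> pdmx (runX i).
  move=> ij; have [|[]//] := IH i ij.
  by move=> i' i'i; apply: hR; exact: ltn_trans ij.
split; apply: argmin_is_min => //; try exact: ltW.
  by move=> Z; rewrite -(sum_gs _ hR hX).
by move=> Z; rewrite -(sum_fhats _ hR hX).
Qed.

(** An epoch starts at [U = I / d] and [P = d I], where the condition reads [1 / d < c / d] for the
    reset level [c]. *)
Lemma start_no_reset : 1 < (2 * (1 + 6 * eta) * beta)^-1 ->
  no_reset eta beta (runU 0) (runP 0).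
Proof.
move=> c1; have n0 : 0 < (d%:R : R) by rewrite ltr0n.
have X0 : runX 0 = (d%:R^-1 : R)%:C%:M.
  have hm := is_min0 beta 0 (fun=> 0) (fun=> 0) (fun=> 0) (fun=> 0).
  exact: is_min0_uniform d0 (ltW beta0) eta0 hm.
have P0 : runP 0 = (d%:R : R)%:C%:M.
  rewrite run_P X0 update_P_id //.
  - by apply: pd_scalar; rewrite invr_gt0.
  - by apply: pd_herm; exact: pd_scalar.
  - rewrite invmx_scalar -fmorphV invrK subrr.
    by have := @psd_gram R d d 0; rewrite mulmx0.
rewrite /no_reset /loewner_lt P0 invmx_scalar.
have -> : runU 0 = (d%:R^-1 : R)%:C%:M by exact: X0.
rewrite -fmorphV scale_scalar_mx -rmorphM -raddfB -rmorphB /=.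
apply: pd_scalar; rewrite subr_gt0 -{1}[_^-1]mul1r ltr_pM2r ?invr_gt0 //.
Qed.

End Run.

(** * Epochs and resets *)

Section Regret.
Context {R : realType} {d T : nat}.
Local Notation C := (Num.ClosedField.sort (R[i] : numClosedFieldType)).
Variable Rs : nat -> 'M[C]_d.
Hypotheses (d1 : (1 <= d)%N) (hT : (110 * d ^ 2 <= T)%N).
Hypothesis hRs : forall t, (1 <= t <= T)%N -> density d (Rs t).
Local Notation dR := (d%:R : R).
Local Notation L := (ln (T%:R : R)).
Local Notation B := (tunedB (R := R) d T).
Local Notation eta := (tuned_eta (R := R) d T).
Local Notation beta := (tuned_beta (R := R) d T).
Local Notation bound := (8 * (B * (dR * L))).

Variable W : 'M[C]_d.
Hypotheses (dW : density d W) (pW : pdmx W).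
Hypothesis hW : - (dR * ln dR) - ld W <= dR * L.

(** Rounds count from 1 and internal indices from 0: after [n0] rounds, index [i] is round
    [n0 + i + 1]. *)
Definition shifted n0 i : 'M[C]_d := Rs (n0 + i.+1).
Definition gap (X A : 'M[C]_d) : R := - ln (inner X A) + ln (inner W A).

Section OneEpoch.
Variables (n0 k : nat).
Local Notation Rt := (shifted n0).
Local Notation X := (runX B eta beta Rt).
Local Notation U := (runU B eta beta Rt).
Local Notation P := (runP B eta beta Rt).
Hypothesis hk : (n0 + k.+1 <= T)%N.
Hypothesis hnr : forall i, (i <= k)%N -> no_reset eta beta (U i) (P i).

Lemma shifted_density i : (i <= k)%N -> density d (Rt i).
Proof.
move=> ik; apply: hRs; rewrite addnS /= (leq_trans _ hk) //.
by rewrite -addnS leq_add2l.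
Qed.

Lemma run_min j : (j <= k.+1)%N ->
  is_min beta B eta (lossX Rt X) X (gradX Rt X) (stepP P) j (X j) /\
  is_min beta 0 eta (lossX Rt X) X (gradX Rt X) (stepP P) j (U j).
Proof.
move=> jk; apply: (run_is_min B beta d1 (tuned_eta_gt0 d1 hT)).
by move=> i ij; apply: shifted_density; rewrite -ltnS (leq_trans ij).
Qed.

Lemma epoch_gap_le :
  \sum_(s < k.+1) gap (X s) (Rt s) <= bound - B * (inner (U k.+1) (P k) - dR).
Proof.
have kT : (k < T)%N by apply: leq_trans hk; exact: leq_addl.
have T0 : 0 < (T%:R : R) by have := natT_ge110 (R := R) d1 hT; lra.
have := epoch_regret d1 (tuned_beta_gt0 d1 hT) (tuned_beta_le d1 hT) (tuned_eta_gt0 d1 hT)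
  (tuned_eta_le d1 hT) (tunedB_eta d1 hT) (tuned_eta_beta d1 hT)
  (fun j jk => (run_min jk).1) (fun j jk => (run_min jk).2)
  (fun j _ => run_P B eta beta Rt j) shifted_density hnr dW pW
  (exprn_gt0 3 T0) (potential_budget d1 hT kT) => h.
have X0 : ld (X 0%N) = - (dR * ln dR).
  have hm := (run_min (leq0n _)).1.
  rewrite (is_min0_uniform d1 (ltW (tuned_beta_gt0 d1 hT)) (tuned_eta_gt0 d1 hT) hm).
  by rewrite ld_scalar ?invr_gt0 ?ltr0n // lnV ?posrE ?ltr0n // mulrN.
rewrite X0 in h; have := epoch_budget d1 hT kT hW.
move=> /(lerB)/(_ (lexx (B * (inner (U k.+1) (P k) - dR)))) h2.
exact: le_trans h h2.
Qed.

Lemma epoch_gap_bound : \sum_(s < k.+1) gap (X s) (Rt s) <= bound.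
Proof.
apply: (le_trans epoch_gap_le); rewrite gerBl mulr_ge0 ?(ltW (tunedB_gt0 d1 hT)) //.
exact: (U_last_nneg d1 (fun j jk => (run_min jk).1) (fun j jk => (run_min jk).2)
  (fun j _ => run_P B eta beta Rt j)).
Qed.

Lemma epoch_gap_reset : ~ no_reset eta beta (U k.+1) (P k.+1) ->
  \sum_(s < k.+1) gap (X s) (Rt s) <= 0.
Proof.
move=> hn; apply: (le_trans epoch_gap_le); rewrite subr_le0.
apply: (reset_budget d1 hT).
exact: (reset_gain d1 (tuned_beta_gt0 d1 hT) (tuned_eta_gt0 d1 hT)
  (tuned_eta_le d1 hT) (tunedB_eta d1 hT)
  (fun j jk => (run_min jk).1) (fun j jk => (run_min jk).2)
  (fun j _ => run_P B eta beta Rt j) shifted_density hn).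
Qed.

End OneEpoch.

Local Notation after := (bisons_after B eta beta Rs).
Local Notation play := (bisons_play B eta beta Rs).
Definition total_gap N : R := \sum_(1 <= t < N.+1) gap (play t) (Rs t).

Lemma total_gap_add n0 j :
  (forall i, (i < j)%N -> after (n0 + i) = run B eta beta (shifted n0) i) ->
  total_gap (n0 + j) = total_gap n0 +
    \sum_(s < j) gap (runX B eta beta (shifted n0) s) (shifted n0 s).
Proof.
elim: j => [|j IH] h; first by rewrite addn0 big_ord0 addr0.
rewrite addnS /total_gap big_nat_recr //= -/(total_gap (n0 + j)) IH => [|i ij]; last first.
  by apply: h; exact: ltnW.
have -> : gap (play (n0 + j).+1) (Rs (n0 + j).+1) =
    gap (runX B eta beta (shifted n0) j) (shifted n0 j).
  by rewrite /bisons_play [(n0 + j).+1.-1]/= (h j (ltnSn j)) /shifted addnS.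
rewrite big_ord_recr /= -/(total_gap n0); exact/esym/addrA.
Qed.

(* n0 is the number of rounds in the finished epochs. *)
Lemma epoch_decomposition N : (N <= T)%N ->
  exists n0 m, [/\ N = (n0 + m)%N, total_gap n0 <= 0,
  forall i, (i <= m)%N -> after (n0 + i) = run B eta beta (shifted n0) i &
  forall i, (i <= m)%N -> no_reset eta beta (runU B eta beta (shifted n0) i)
                            (runP B eta beta (shifted n0) i)].
Proof.
have start n0 : no_reset eta beta (runU B eta beta (shifted n0) 0)
    (runP B eta beta (shifted n0) 0).
  by apply: start_no_reset; rewrite ?tuned_beta_gt0 ?tuned_eta_gt0 ?reset_level_gt1.
elim: N => [|N IH] NT.
  exists 0%N, 0%N; split; first by [].
  - by rewrite /total_gap big_geq.
  - by move=> i; rewrite leqn0 => /eqP ->.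
  - by move=> i; rewrite leqn0 => /eqP ->; exact: start.
have [n0 [m [eN t0 ha hn]]] := IH (ltnW NT).
have step : after N.+1 =
    bisons_step B eta beta (run B eta beta (shifted n0) m) (shifted n0 m).
  have e := ha m (leqnn m); rewrite -eN in e.
  by rewrite /= e /shifted addnS -eN.
rewrite bisons_stepE in step.
case: asboolP step => [nr|hr] step.
  exists n0, m.+1; split; [by rewrite addnS eN|exact: t0| |].
  - move=> i; rewrite leq_eqVlt => /orP[/eqP ->|]; last exact: ha.
    by rewrite addnS -eN step.
  - by move=> i; rewrite leq_eqVlt => /orP[/eqP ->|]; [exact: nr|exact: hn].
(* On a reset, round [N.+1] still belongs to the closing epoch, whose total is nonpositive; the new
   epoch has no rounds yet. *)
exists N.+1, 0%N; split; first by rewrite addn0.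
- have -> : N.+1 = (n0 + m.+1)%N by rewrite addnS eN.
  rewrite total_gap_add; last exact: ha.
  have hm : (n0 + m.+1 <= T)%N by rewrite addnS -eN.
  have h := lerD t0 (epoch_gap_reset hm hn hr); rewrite addr0 in h; exact: h.
- by move=> i; rewrite leqn0 => /eqP ->; rewrite addn0 step.
- by move=> i; rewrite leqn0 => /eqP ->; exact: start.
Qed.

Lemma total_gap_le N : (N <= T)%N -> total_gap N <= bound.
Proof.
move=> NT; have [n0 [[|m] [eN t0 ha hn]]] := epoch_decomposition NT.
  rewrite eN addn0; apply: (le_trans t0).
  have B0 := tunedB_gt0 (R := R) d1 hT; have L3 := lnT_ge3 (R := R) d1 hT.
  have dL0 : 0 <= dR * L by apply: mulr_ge0; rewrite ?ler0n ?(le_trans _ L3).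
  exact: mulr_ge0 (ler0n _ 8) (mulr_ge0 (ltW B0) dL0).
rewrite eN total_gap_add; last by move=> i im; apply: ha; exact: ltnW.
have hm : (n0 + m.+1 <= T)%N by rewrite -eN.
have hn' i : (i <= m)%N -> no_reset eta beta (runU B eta beta (shifted n0) i)
    (runP B eta beta (shifted n0) i) by move=> im; apply: hn; exact: leqW.
have h := lerD t0 (epoch_gap_bound hm hn'); rewrite add0r in h; exact: h.
Qed.

Lemma state_pd N : (N <= T)%N -> pdmx (st_X (after N)).
Proof.
move=> NT; have [n0 [m [eN _ ha hn]]] := epoch_decomposition NT.
rewrite eN (ha m (leqnn m)); have [|[_ pX _] _] := @run_is_min R d B eta beta d1
  (tuned_eta_gt0 d1 hT) (shifted n0) m; last exact: pX.
move=> i im; apply: hRs; rewrite addnS /= (leq_trans _ NT) // eN.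
by rewrite -addnS leq_add2l.
Qed.

End Regret.

(** * Smoothing the comparator *)

Section Smoothing.
Context {R : realType} {d T : nat}.
Local Notation C := (Num.ClosedField.sort (R[i] : numClosedFieldType)).
Hypotheses (d1 : (1 <= d)%N) (hT : (110 * d ^ 2 <= T)%N).
Variable U : 'M[C]_d.
Hypothesis dU : density d U.
Local Notation dR := (d%:R : R).
Local Notation TR := (T%:R : R).

Definition smooth : 'M[C]_d := U + (TR^-1)%:C *: ((dR^-1)%:C%:M - U).

Lemma natT_gt1 : 1 < TR.
Proof. by have := natT_ge110 (R := R) d1 hT; lra. Qed.

Lemma invT_gt0 : 0 < TR^-1.
Proof. by rewrite invr_gt0 (lt_trans ltr01 natT_gt1). Qed.

Lemma invT_lt1 : TR^-1 < 1.
Proof. by rewrite invf_lt1 ?natT_gt1 // (lt_trans ltr01 natT_gt1). Qed.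

Lemma smooth_density : density d smooth.
Proof.
apply: density_line (ltW invT_gt0) (ltW invT_lt1) => //.
exact: density_uniform.
Qed.

Lemma smoothE : smooth = (1 - TR^-1)%:C *: U + (TR^-1 * dR^-1)%:C%:M.
Proof.
rewrite /smooth scalerBr scale_scalar_mx -rmorphM rmorphB rmorph1 scalerBl scale1r.
by rewrite addrA addrAC.
Qed.

Lemma smooth_floor_gt0 : 0 < TR^-1 * dR^-1.
Proof. by rewrite mulr_gt0 ?invT_gt0 // invr_gt0 ltr0n. Qed.

Lemma smooth_pd : pdmx smooth.
Proof.
rewrite smoothE addrC; apply: pd_psdD; first exact: pd_scalar smooth_floor_gt0.
by apply: psdZ; [rewrite subr_ge0 ltW // invT_lt1|case: dU].
Qed.

(** [smooth] lies above [I / (d T)], so its log det is at least [- d ln T - d ln d]; the last term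
    is the log det of the uniform starting point. *)
Lemma smooth_ld : - (dR * ln dR) - ld smooth <= dR * ln TR.
Proof.
have := ld_mono (pd_scalar (n := d) smooth_floor_gt0) smooth_pd.
rewrite smoothE addrK ld_scalar ?smooth_floor_gt0 // -smoothE => h.
have {}h := h (psdZ _ _).
have : dR * ln (TR^-1 * dR^-1) <= ld smooth.
  by apply: h; [rewrite subr_ge0 ltW // invT_lt1|case: dU].
have T0 : 0 < TR := lt_trans ltr01 natT_gt1.
have D0 : 0 < dR by rewrite ltr0n.
have -> : ln (TR^-1 * dR^-1) = - ln TR - ln dR.
  rewrite (lnM (x := TR^-1)); [|by rewrite posrE invr_gt0|by rewrite posrE invr_gt0].
  by rewrite (lnV T0) (lnV D0).
lra.
Qed.

Lemma inner_smooth A : density d A ->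
  (1 - TR^-1) * inner U A <= inner smooth A.
Proof.
move=> [pA _]; rewrite smoothE innerDl innerZl lerDl.
exact: inner_psd_ge0 (pd_psd (pd_scalar smooth_floor_gt0)) pA.
Qed.

Lemma smoothing_cost : - ln (1 - TR^-1) <= 2 / TR.
Proof.
have T110 := natT_ge110 (R := R) d1 hT.
have i0 := invT_gt0; have i1 : TR^-1 <= 1 / 110.
  by rewrite div1r lef_pV2 ?posrE ?(lt_trans ltr01 natT_gt1).
have := @ln_ge_divD R (- TR^-1); rewrite ltrN2 invT_lt1 => /(_ isT).
have h : - (2 / TR) <= - TR^-1 / (1 - TR^-1).
  by rewrite ler_pdivlMr; [nra|lra].
by move=> h2; rewrite lerNl (le_trans h h2).
Qed.

Lemma loss_gap_le (X A : 'M[C]_d) : pdmx X -> density d A ->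
  (loss A X - loss A U <= (gap smooth X A + 2 / TR)%:E)%E.
Proof.
move=> pX dA; rewrite (loss_EFin pX dA) /loss.
have [pU _] := dU; have pA : psdmx A by case: dA.
have := inner_psd_ge0 pU pA; rewrite le_eqVlt => /orP[/eqP <-|u0].
  (* If [<U, A> = 0], the loss of [U] is [+oo] and the difference is [-oo]. *)
  by rewrite le0_lneNy //= leNye.
rewrite lne_EFin // -EFinN -EFinB lee_fin opprK /gap -addrA lerD2l.
have c0 : 0 < 1 - TR^-1 by rewrite subr_gt0 invT_lt1.
have : ln (1 - TR^-1) + ln (inner U A) <= ln (inner smooth A).
  rewrite -lnM ?posrE // ler_ln ?posrE ?mulr_gt0 //; first exact: inner_smooth.
  exact: inner_pd_gt0 smooth_pd dA.
have := smoothing_cost; lra.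
Qed.

End Smoothing.

Theorem corollary5 (R : realType) :
  exists C : R, 0 < C /\
    forall (d T : nat) (Rs : nat -> 'M[R[i]]_d),
      (1 <= d)%N ->
      (110 * d ^ 2 <= T)%N ->
      (forall t : nat, (1 <= t <= T)%N -> density d (Rs t)) ->
      let B : R := 264 / 5 * d%:R ^+ 2 * ln T%:R in
      let eta : R := 1 / (4 * B) in
      let beta : R := 11 * d%:R / (7 * B) in
      (ereal_sup [set regret T Rs (bisons_play B eta beta Rs) U
                   | U in density d]
         <= (C * d%:R ^+ 3 * ln T%:R ^+ 2)%:E)%E.
Proof.
(* 425 >= 8 * 264 / 5 + 2 *)
exists 425; split=> [|d T Rs d1 hT hRs]; first by rewrite ltr0n.
cbv zeta; rewrite -/(tunedB (R := R) d T) -/(tuned_eta (R := R) d T).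
rewrite -/(tuned_beta (R := R) d T).
set B := tunedB d T; set eta := tuned_eta d T; set beta := tuned_beta d T.
apply: ge_ereal_sup => _ [U dU <-].
have pW := smooth_pd d1 hT dU; have dW := smooth_density d1 hT dU.
have hW := smooth_ld d1 hT dU.
apply: (@le_trans _ _ (total_gap (T := T) Rs (smooth (T := T) U) T + 2)%:E); last first.
  have ht := total_gap_le d1 hT hRs dW pW hW (leqnn T).
  rewrite lee_fin; apply: (le_trans (lerD ht (lexx 2))).
  have L3 := lnT_ge3 (R := R) d1 hT; have D1 := natR_ge1 (R := R) d1.
  rewrite tunedBE.
  have L1 : 1 <= ln (T%:R : R) by lra.
  have : 1 <= d%:R ^+ 3 * ln T%:R ^+ 2 :> R.
    by apply: mulr_ege1; apply: exprn_ege1.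
  have -> : 8 * (264 / 5 * d%:R ^+ 2 * ln T%:R * (d%:R * ln T%:R)) =
    2112 / 5 * (d%:R ^+ 3 * ln T%:R ^+ 2) :> R by field.
  rewrite -[425 * _ * _]mulrA; move: (d%:R ^+ 3 * _) => x; lra.
have T0 : (T%:R : R) != 0 by have := natT_ge110 (R := R) d1 hT => h; rewrite gt_eqF //; lra.
have -> : (total_gap (T := T) Rs (smooth (T := T) U) T + 2)%:E =
    (\sum_(1 <= t < T.+1) (gap (smooth (T := T) U) (bisons_play B eta beta Rs t) (Rs t)
       + 2 / T%:R)%:E)%E.
  rewrite sumEFin big_split /= sumr_const_nat subn1 -(mulr_natr (2 / T%:R)).
  by rewrite (divfK T0).
rewrite /regret big_seq [leRHS]big_seq; apply: lee_sum => t.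
rewrite mem_index_iota ltnS => /andP[t1 tT].
apply: (loss_gap_le d1 hT dU); last by apply: hRs; rewrite t1.
by apply: (state_pd d1 hT hRs dW pW hW); rewrite (leq_trans (leq_pred t)).
Qed.
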